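(* There exist universal constants $c_0,c_1,c_2,\mu_0>0$ such that for every step size $\mu\in(0,\mu_0)$ there is a constant $0<\rho_0<1$ (depending only on $\mu$) with the following property. Let $\boldsymbol{x}\in\mathbb{R}^n$ be a fixed nonzero vector, let $m\ge c_0 n$, and let $\boldsymbol{a}_1,\dots,\boldsymbol{a}_m$ be independent $\mathcal{N}(\boldsymbol{0},\boldsymbol{I})$ random vectors in $\mathbb{R}^n$. Then, in the noiseless setting, with probability exceeding $1-c_1\exp[-c_2m]$, $$\mathrm{dist}^2\Big(\boldsymbol{z}-\frac{\mu}{m}\nabla l(\boldsymbol{z}),\,\boldsymbol{x}\Big)\ \le\ (1-\rho_0)\,\mathrm{dist}^2(\boldsymbol{z},\boldsymbol{x})$$ holds simultaneously for all $\boldsymbol{z}\in\mathbb{R}^n$ such that $\boldsymbol{h}=\boldsymbol{x}-\boldsymbol{z}$ satisfies $\|\boldsymbol{h}\|\le\|\boldsymbol{x}\|$ and does not satisfy both $\frac{\boldsymbol{x}^T\boldsymbol{h}}{\|\boldsymbol{x}\|\|\boldsymbol{h}\|}\in[0.6,1]$ and $\frac{\|\boldsymbol{h}\|}{\|\boldsymbol{x}\|}\in[0.6,1]$. Here $\nabla l$ is the TanhWFQ gradient.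
   Context: All vectors are real and $\|\cdot\|$ is the Euclidean norm. In the noiseless setting the measurements of the true signal $\boldsymbol{x}$ are $y_i=|\boldsymbol{a}_i^T\boldsymbol{x}|^2$, $i=1,\dots,m$. The distance up to global sign is $\mathrm{dist}(\boldsymbol{z},\boldsymbol{x})=\min\{\|\boldsymbol{z}-\boldsymbol{x}\|,\|\boldsymbol{z}+\boldsymbol{x}\|\}$. The TanhWFQ gradient is $$\frac{1}{2m}\nabla l(\boldsymbol{z})=\frac1m\sum_{i=1}^m \boldsymbol{a}_i\left(\boldsymbol{a}_i^T\boldsymbol{z}-\boldsymbol{a}_i^T\boldsymbol{x}\,\tanh\frac{(\boldsymbol{a}_i^T\boldsymbol{x})(\boldsymbol{a}_i^T\boldsymbol{z})}{\sigma_i^2}\right),\qquad \sigma_i^2=\big(|\boldsymbol{a}_i^T\boldsymbol{x}|-|\boldsymbol{a}_i^T\boldsymbol{z}|\big)^2.$$ Convention: if $\sigma_i^2=0$, the factor $\tanh(\cdot)$ is understood as its limiting value $\mathrm{sgn}\big((\boldsymbol{a}_i^T\boldsymbol{x})(\boldsymbol{a}_i^T\boldsymbol{z})\big)$, with $\mathrm{sgn}(0)=0$. *)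

(* Defs.v *)
From HB Require Import structures.
From mathcomp Require Export all_boot all_order all_algebra.
From mathcomp Require Export all_classical all_reals all_analysis.

Set Implicit Arguments.
Unset Strict Implicit.
Unset Printing Implicit Defensive.

Import Order.TTheory GRing.Theory Num.Theory.
Import numFieldNormedType.Exports.

Local Open Scope classical_set_scope.
Local Open Scope ring_scope.

Section Euclidean.
Context {R : realType} {n : nat}.
Implicit Types u v x z : 'cV[R]_n.

Definition dotv u v : R := (u^T *m v) 0 0.

(* The library norm `|v| on matrices is the sup norm, so the Euclidean norm is
   defined here. *)
Definition enorm v : R := Num.sqrt (dotv v v).

Definition dist z x : R := Num.min (enorm (z - x)) (enorm (z + x)).

End Euclidean.

Section TanhWFQ.
Context {R : realType} {n m : nat}.
Implicit Types (t : R) (x z : 'cV[R]_n) (a : 'I_m -> 'cV[R]_n) (i : 'I_m).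

Definition tanh t : R := (expR t - expR (- t)) / (expR t + expR (- t)).

Definition sigma2 a x z i : R := (`|dotv (a i) x| - `|dotv (a i) z|) ^+ 2.

(* When sigma_i^2 = 0 the value is the limit of the hyperbolic tangent, i.e.
   the sign of the numerator; Num.sg 0 = 0. *)
Definition tanh_weight a x z i : R :=
  let p := dotv (a i) x * dotv (a i) z in
  if sigma2 a x z i == 0 then Num.sg p else tanh (p / sigma2 a x z i).

(* The gradient of l itself: grad_l / (2 m) is the average over i of the
   summands, whence the factor 2 and the absence of 1/m. *)
Definition grad_l a x z : 'cV[R]_n :=
  2 *: \sum_(i < m)
         (dotv (a i) z - dotv (a i) x * tanh_weight a x z i) *: a i.

End TanhWFQ.

(* R^n with its Borel sigma-algebra. *)
Definition borelV (R : realType) (n : nat) :=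
  g_sigma_algebraType (@open 'cV[R]_n).

Section Gaussian.
Context {d : measure_display} {T : measurableType d} {R : realType}
  (P : probability T R).

Definition mutually_independent {d' : measure_display}
    {T' : measurableType d'} {I : finType} (X : I -> {RV P >-> T'}) : Prop :=
  forall (J : {set I}) (B : I -> set T'),
    (forall i, measurable (B i)) ->
    P [set w | forall i, i \in J -> B i (X i w)] =
    (\prod_(i in J) P (X i @^-1` B i))%E.

(* The law of X is N(0, I_n), the n-fold product of N(0, 1); the equality is
   on measurable boxes, which determine the law. *)
Definition standard_gaussian {n : nat} (X : {RV P >-> borelV R n}) : Prop :=
  forall B : 'I_n -> set R,
    (forall j, measurable (B j)) ->
    P [set w | forall j, B j ((X w : 'cV[R]_n) j 0)] =
    (\prod_(j < n) normal_prob 0 1 (B j))%E.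

End Gaussian.

(* Main.v *)
From HB Require Import structures.
Require Import Defs.
From mathcomp Require Import measurable_realfun ring lra.

(* Write h = x - z, u = a_i^T x and w = a_i^T h.  The step adds (2 mu / m) G to h
   for a combination G of the a_i such that <h, G> = - sum_i w^2 (1 - defect (u / w)),
   with a universal bounded function [defect], and |G|^2 <= 16 m^2 |h|^2.  So it suffices
   that, uniformly in h, sum_i w^2 defect (u / w) <= 0.98 m |h|^2.

   On each piece of the allowed region [defect] lies below a quadratic polynomial plus
   a triangular hat.  Quadratic polynomials turn the sum into quadratic forms in the
   a_i, controlled by the restricted isometry property.  For a hat, condition on w:
   the conditional density of u is at most a constant over its standard deviation,
   so for |x| = 1 the mean of w^2 hat (u / w) is at most a constant times
   |h|^4 / sqrt (|h|^2 - (x^T h)^2), through the third absolute moment of w.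
   A Chernoff bound and a union bound over a net of the unit ball make this uniform. *)

(** The point z = 0 is stationary: there h = x, so u / w = 1 for every i, and [defect 1 = 1] leaves
    no descent. This is why a neighbourhood of h = x is excluded, and why the mean of the defect
    weighted by w^2 must stay below 1. No pointwise bound achieves this, since the defect exceeds 1
    on part of (1/2, 1); the spread of u / w has to be used. The hat estimate uses it, but it
    degenerates when h is nearly parallel to x, and its additive deviation is too coarse when |h| is
    small. Nearly parallel directions are therefore left to quadratic majorants alone, and small
    transverse h is rescaled to a unit vector. Hats have explicit conditional integrals, and their
    2-homogeneous form is Lipschitz enough for a net argument. The constant 0.98 lies below the
    lower isometry constant 0.999, and this margin is the rate of descent. *)

Set Implicit Arguments.
Unset Strict Implicit.
Unset Printing Implicit Defensive.

Import Order.TTheory GRing.Theory Num.Theory.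
Import numFieldNormedType.Exports.

Local Open Scope classical_set_scope.
Local Open Scope ring_scope.

(** * The tanh weight *)

Section Weight.
Context {R : realType}.
Implicit Types s t u v w y : R.

Lemma expR_ge_cubic t : 0 <= t ->
  1 + t + t ^+ 2 / 2 + t ^+ 3 / 6 <= expR t.
Proof.
move=> t0.
have -> : 1 + t + t ^+ 2 / 2 + t ^+ 3 / 6 = series (exp_coeff t) 4.
  rewrite /series /= !big_nat_recr //= big_nil /exp_coeff /= add0r.
  by rewrite !factS fact0 /= expr0 expr1; field.
apply: nondecreasing_cvgn_le; last exact: is_cvg_series_exp_coeff.
by apply: nondecreasing_series => k _ _; exact: exp_coeff_ge0.
Qed.

Lemma one_sub_tanh t : 1 - tanh t = 2 / (expR (2 * t) + 1).
Proof.
have e0 := expR_gt0 t.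
rewrite /tanh expRN expRM_natl.
have h1 : expR t ^+ 2 + 1 != 0 by rewrite gt_eqF// ltr_wpDl// exprn_ge0// ltW.
have h2 : expR t != 0 by rewrite gt_eqF.
by field; rewrite h1 h2.
Qed.

Lemma tanhN t : tanh (- t) = - tanh t.
Proof. by rewrite /tanh opprK -mulNr opprB [X in _ / X]addrC. Qed.

Lemma one_add_tanh t : 1 + tanh t = 2 / (expR (- (2 * t)) + 1).
Proof. by rewrite -[tanh t]opprK -tanhN one_sub_tanh mulrN. Qed.

Lemma tanh_lt1 t : tanh t < 1.
Proof. by rewrite -subr_gt0 one_sub_tanh divr_gt0// ltr_wpDl// expR_ge0. Qed.

Lemma tanh_gtN1 t : -1 < tanh t.
Proof. by rewrite -ltrN2 -tanhN opprK tanh_lt1. Qed.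

(** [tanh_weight] sees [a], [x], [z] only through two inner products; this is that scalar function,
    convertible to it. *)
Definition weight u v : R :=
  let p := u * v in let q := (`|u| - `|v|) ^+ 2 in
  if q == 0 then Num.sg p else tanh (p / q).

Lemma weight_bound u v : -1 <= weight u v <= 1.
Proof.
rewrite /weight; case: ifP => _.
  by rewrite -ler_norml normr_sg lern1 leq_b1.
by rewrite !ltW ?tanh_lt1 ?tanh_gtN1.
Qed.

(** The product and the squared gap are both homogeneous of degree 2, so even a negative factor
    cancels; the factor will be [a_i^T h], of either sign. *)
Lemma weightZ w u v : w != 0 -> weight (w * u) (w * v) = weight u v.
Proof.
move=> w0; rewrite /weight !normrM -mulrBr exprMn real_normK ?num_real//.
have w2 : w ^+ 2 != 0 by rewrite expf_eq0.
have -> : w * u * (w * v) = w ^+ 2 * (u * v) by ring.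
rewrite mulf_eq0 (negbTE w2) /=; case: ifP => [_|q].
  by rewrite sgrM gtr0_sg ?mul1r// exprn_even_gt0.
by congr tanh; rewrite invfM mulrACA divff// mul1r.
Qed.

(* By homogeneity a pair [(u, v)] is normalised to [u - v = 1], [u = s]. *)
Definition defect s := s * (1 - weight s (s - 1)).

Lemma defectE u v : u != v ->
  (u - v) * u * (1 - weight u v) = (u - v) ^+ 2 * defect (u / (u - v)).
Proof.
rewrite -subr_eq0 => w0; rewrite /defect.
have <- : weight ((u - v) * (u / (u - v))) ((u - v) * (u / (u - v) - 1)) = weight u v.
  by congr weight; field.
by rewrite weightZ//; field.
Qed.

(** [s] and [s - 1] do not have opposite signs here, so their absolute values differ by exactly
    1. *)
Lemma weight_outer s : s <= 0 \/ 1 <= s -> weight s (s - 1) = tanh (s * (s - 1)).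
Proof.
move=> hs; have q1 : (`|s| - `|s - 1|) ^+ 2 = 1.
  case: hs => hs.
    by rewrite ler0_norm// ler0_norm; [ring|lra].
  by rewrite ger0_norm ?ger0_norm; [ring|lra|lra].
by rewrite /weight q1 oner_eq0 divr1.
Qed.

(** Now [s] and [s - 1] have opposite signs. Below 1/2 the trivial bound [2 * s] on the defect is
    used instead. *)
Lemma weight_inner s : 1 / 2 < s <= 1 ->
  weight s (s - 1) = - tanh (s * (1 - s) / (2 * s - 1) ^+ 2).
Proof.
move=> /andP[s0 s1]; have q1 : (`|s| - `|s - 1|) ^+ 2 = (2 * s - 1) ^+ 2.
  by rewrite ger0_norm ?ler0_norm; [ring|lra|lra].
rewrite /weight q1 -tanhN ifF; last by rewrite expf_eq0/=; apply/eqP; lra.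
by congr tanh; rewrite -mulNr; congr (_ / _); ring.
Qed.

Lemma defect_neg s : s <= 0 -> -1 <= defect s <= 0.
Proof.
move=> s0; have sx : 0 <= s * (s - 1) by nra.
rewrite /defect weight_outer; last by left.
rewrite one_sub_tanh; set x := s * (s - 1) in sx *.
have e1 := expR_ge1Dx (2 * x).
have e0 : 0 < expR (2 * x) + 1 by rewrite ltr_wpDl ?expR_ge0.
apply/andP; split; last by rewrite mulr_le0_ge0// divr_ge0// ltW.
rewrite mulrA ler_pdivlMr//.
by rewrite /x in e1 *; nra.
Qed.

Lemma defect_le_lin s : 0 <= s -> defect s <= 2 * s.
Proof.
by move=> s0; have /andP[h _] := weight_bound s (s - 1); rewrite /defect; nra.
Qed.

Lemma defect_ge0 s : 0 <= s -> 0 <= defect s.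
Proof.
move=> s0; have /andP[_ h] := weight_bound s (s - 1).
by rewrite /defect mulr_ge0// subr_ge0.
Qed.

(** With x = s (s - 1) the defect is 2 s / (exp (2 x) + 1), and the exponential is replaced by its
    cubic Taylor bound. The multiplied-out form turns later bounds into polynomial inequalities. *)
Lemma defect_ge1 s : 1 <= s ->
  defect s * (1 + s * (s - 1) + (s * (s - 1)) ^+ 2 + 2 / 3 * (s * (s - 1)) ^+ 3) <= s.
Proof.
move=> s1; have x0 : 0 <= s * (s - 1) by nra.
rewrite /defect weight_outer; last by right.
rewrite one_sub_tanh; set x := s * (s - 1) in x0 *.
have e1 : 1 + 2 * x + (2 * x) ^+ 2 / 2 + (2 * x) ^+ 3 / 6 <= expR (2 * x).
  by apply: expR_ge_cubic; lra.
have e0 : 0 < expR (2 * x) + 1 by rewrite ltr_wpDl ?expR_ge0.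
rewrite -mulrA ler_piMr//; first by lra.
rewrite mulrAC ler_pdivrMr//.
have -> : 2 * (1 + x + x ^+ 2 + 2 / 3 * x ^+ 3) =
   1 + 2 * x + (2 * x) ^+ 2 / 2 + (2 * x) ^+ 3 / 6 + 1 by field.
by rewrite mul1r lerD2r.
Qed.

(** Eighth power of [1 + t <= expR t] at t = - 1/16. *)
Lemma expR_half_ge : 149 / 250 <= expR (- (1 / 2)) :> R.
Proof.
have -> : - (1 / 2) = 8%:R * (- (1 / 16)) :> R by field.
rewrite expRM_natl; have h := expR_ge1Dx (- (1 / 16) : R).
apply: (le_trans (y := (1 - 1 / 16) ^+ 8)); first by lra.
by rewrite lerXn2r// nnegrE ?expR_ge0//; lra.
Qed.

(* Tangent lines to the convex function [exp (- 2 y)] at 1 and 1/4. *)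
Lemma expRN_ge_tangent1 y : (3 - 2 * y) / 8 <= expR (- (2 * y)).
Proof.
have -> : - (2 * y) = 4%:R * (- (1 / 2)) + (2 - 2 * y) by field.
rewrite expRD expRM_natl.
have h1 := expR_ge1Dx (2 - 2 * y).
have h2 : 1 / 8 <= expR (- (1 / 2) : R) ^+ 4.
  apply: (le_trans (y := (149 / 250) ^+ 4)); first by lra.
  by rewrite lerXn2r// ?nnegrE ?expR_ge0 ?expR_half_ge//; lra.
have h3 := expR_ge0 (2 - 2 * y); nra.
Qed.

Lemma expRN_ge_tangent4 y : 149 / 250 * (3 / 2 - 2 * y) <= expR (- (2 * y)).
Proof.
have -> : - (2 * y) = - (1 / 2) + (1 / 2 - 2 * y) by field.
rewrite expRD.
have h1 := expR_ge1Dx (1 / 2 - 2 * y); have h2 := expR_half_ge.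
have h3 := expR_ge0 (1 / 2 - 2 * y); nra.
Qed.

(** Here the defect is 2 s / (1 + exp (- 2 y)), so every lower bound [c] of the exponential bounds
    it; the two tangent lines above will serve as [c]. *)
Lemma defect_le_tangent s (y := s * (1 - s) / (2 * s - 1) ^+ 2) c : 1 / 2 < s <= 1 ->
  -1 < c <= expR (- (2 * y)) -> defect s * (1 + c) <= 2 * s.
Proof.
move=> hs /andP[c1 hc]; rewrite /defect weight_inner// opprK one_add_tanh -/y.
have s0 : 0 < s by case/andP: hs; lra.
rewrite -mulrA [2 * s]mulrC ler_pM2l// mulrAC ler_pdivrMr ?ltr_wpDl ?expR_ge0//.
by rewrite ler_pM2l// addrC lerD2r.
Qed.

End Weight.

(** * Majorants of the defect function *)

Section Majorants.
Context {R : realType}.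
Implicit Types e f g k s t y : R.

(** The line meets the trivial bound [2 * s] at s = 51/74. Further right, y decreases from about 3/2
    to 0: the tangent at 1 serves as long as y >= 4/9, that is s <= 4/5, and the tangent at 1/4
    beyond. *)
Lemma defect_le_inner s : 0 <= s <= 1 -> defect s <= 51 / 25 - 24 / 25 * s.
Proof.
move=> /andP[s0 s1]; have [hs|hs] := lerP s (51 / 74).
  by have := defect_le_lin s0; lra.
have q0 : 0 < (2 * s - 1) ^+ 2 by rewrite exprn_gt0//; lra.
set y := s * (1 - s) / (2 * s - 1) ^+ 2.
have ye : y * (2 * s - 1) ^+ 2 = s * (1 - s) by rewrite divfK// gt_eqF.
have s12 : 1 / 2 < s <= 1 by apply/andP; split; lra.
have [h8|h8] := lerP s (4 / 5).
- have y3 : y < 3 / 2.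
    rewrite /y ltr_pdivrMr//; nra.
  have /(defect_le_tangent s12) : -1 < (3 - 2 * y) / 8 <= expR (- (2 * y)).
    by rewrite expRN_ge_tangent1 andbT; lra.
  move=> h.
  (* Multiplication by (2 s - 1)^2 removes the quotient y. *)
  have {}h : defect s * (11 * (2 * s - 1) ^+ 2 - 2 * (s * (1 - s))) <= 16 * s * (2 * s - 1) ^+ 2.
    by rewrite -ye; nra.
  have p0 : 0 < 11 * (2 * s - 1) ^+ 2 - 2 * (s * (1 - s)) by nra.
  rewrite -(ler_pM2r p0); apply: le_trans h _.
  (* What remains is a cubic inequality in [s]; these products certify it on the interval for [lra].
     The same device recurs below. *)
  have h1 : 0 <= (s - 51 / 74) * (4 / 5 - s) by rewrite mulr_ge0 ?subr_ge0// ltW.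
  have h2 : 0 <= (s - 51 / 74) * (4 / 5 - s) * (s - 51 / 74) by rewrite mulr_ge0 ?subr_ge0// ltW.
  by lra.
- have y3 : y <= 4 / 9.
    rewrite /y ler_pdivrMr//; nra.
  have /(defect_le_tangent s12) : -1 < 149 / 250 * (3 / 2 - 2 * y) <= expR (- (2 * y)).
    by rewrite expRN_ge_tangent4 andbT; lra.
  move=> h.
  have {}h : defect s * (947 * (2 * s - 1) ^+ 2 - 596 * (s * (1 - s))) <= 1000 * s * (2 * s - 1) ^+ 2.
    by rewrite -ye; nra.
  have p0 : 0 < 947 * (2 * s - 1) ^+ 2 - 596 * (s * (1 - s)) by nra.
  rewrite -(ler_pM2r p0); apply: le_trans h _.
  have h1 : 0 <= (s - 4 / 5) * (1 - s) by rewrite mulr_ge0 ?subr_ge0// ltW.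
  have h2 : 0 <= (s - 4 / 5) * (1 - s) * (s - 4 / 5) by rewrite mulr_ge0 ?subr_ge0// ltW.
  by lra.
Qed.

Definition tri e f g k s := Num.max 0 (Num.min (e * (s - f)) (k * (g - s))).

Lemma le_tri A e f g k s t : t <= A \/ t <= A + e * (s - f) /\ t <= A + k * (g - s) ->
  t <= A + tri e f g k s.
Proof.
move=> h; rewrite -lerBlDl /tri le_max; case: h => [h|[h1 h2]].
  by rewrite subr_le0 h.
by rewrite le_min !lerBlDl h1 h2 orbT.
Qed.

Lemma defect_outer_sq s : 1 <= s -> defect s * (1 + s * (s - 1) + (s * (s - 1)) ^+ 2) <= s.
Proof.
move=> s1; apply: le_trans (defect_ge1 s1).
have d0 := @defect_ge0 R s ltac:(lra).
rewrite ler_wpM2l// lerDl mulr_ge0// exprn_ge0// mulr_ge0; lra.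
Qed.

Lemma defect_le_outer_parabola_hat s : 1 <= s <= 7 / 5 -> defect s <= 1 / 20 * (s + 5 / 2) ^+ 2 + 5 / 4 * (7 / 5 - s).
Proof.
move=> /andP[s1 s2]; have h := defect_outer_sq s1.
have p0 : 0 < 1 + s * (s - 1) + (s * (s - 1)) ^+ 2 by nra.
rewrite -(ler_pM2r p0); apply: le_trans h _.
have -> : s = 1 + (s - 1) by ring.
have : 0 <= s - 1 <= 2 / 5 by lra.
move: (s - 1) => t /andP[t0 t1] {s1 s2 p0 s}.
(* The inequality is nearly tight around t = 7/25, whence the squares centred there. *)
have h1 : 0 <= (t - 7 / 25) ^+ 2 by rewrite sqr_ge0.
have h2 : 0 <= t * (t - 7 / 25) ^+ 2 by rewrite mulr_ge0 ?sqr_ge0.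
have h3 : 0 <= t ^+ 3 by rewrite exprn_ge0.
have h4 : 0 <= t ^+ 3 * (2 / 5 - t) by rewrite mulr_ge0 ?subr_ge0.
have h5 : 0 <= t ^+ 3 * (4 / 25 - t ^+ 2) by rewrite mulr_ge0// subr_ge0; nra.
have h6 : 0 <= t ^+ 6 by rewrite exprn_ge0.
by lra.
Qed.

Lemma defect_le_outer_hat s : 1 <= s <= 9 / 5 -> defect s <= 2 / 5 + 9 / 10 * (9 / 5 - s).
Proof.
move=> /andP[s1 s2]; have h := defect_outer_sq s1.
have p0 : 0 < 1 + s * (s - 1) + (s * (s - 1)) ^+ 2 by nra.
rewrite -(ler_pM2r p0); apply: le_trans h _.
have -> : s = 1 + (s - 1) by ring.
have : 0 <= s - 1 <= 4 / 5 by lra.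
move: (s - 1) => t /andP[t0 t1] {s1 s2 p0 s}.
have h1 : 0 <= (t - 2 / 5) ^+ 2 by rewrite sqr_ge0.
have h2 : 0 <= t * (t - 2 / 5) ^+ 2 by rewrite mulr_ge0.
have h3 : 0 <= t ^+ 3 by rewrite exprn_ge0.
have h4 : 0 <= t ^+ 3 * (4 / 5 - t) by rewrite mulr_ge0 ?subr_ge0.
have h5 : 0 <= t ^+ 4 * (4 / 5 - t) by rewrite mulr_ge0 ?exprn_ge0 ?subr_ge0.
nra.
Qed.

(** Keeping only the cubic Taylor term gives decay of order s^(-5). *)
Lemma defect_le_tail s : 2 <= s -> defect s * (s ^+ 2 * (s - 1) ^+ 3) <= 3 / 2.
Proof.
move=> s2; have d0 := @defect_ge0 R s ltac:(lra).
have h := @defect_ge1 R s ltac:(lra).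
rewrite -(@ler_pM2r _ (2 / 3 * s)); last by lra.
have -> : 3 / 2 * (2 / 3 * s) = s by field.
apply: le_trans h; rewrite -[leLHS]mulrA ler_wpM2l//.
have x0 : 0 <= s * (s - 1) by nra.
have -> : s ^+ 2 * (s - 1) ^+ 3 * (2 / 3 * s) = 2 / 3 * (s * (s - 1)) ^+ 3 by field.
have := sqr_ge0 (s * (s - 1)); lra.
Qed.

Lemma defect_le_outer_parabola s : 1 <= s <= 2 -> defect s <= 1 / 50 + 9 / 50 * (s - 69 / 20) ^+ 2.
Proof.
move=> /andP[s1 s2]; have h := defect_outer_sq s1.
have p0 : 0 < 1 + s * (s - 1) + (s * (s - 1)) ^+ 2 by nra.
rewrite -(ler_pM2r p0); apply: le_trans h _.
have -> : s = 1 + (s - 1) by ring.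
have : 0 <= s - 1 <= 1 by lra.
move: (s - 1) => t /andP[t0 t1] {s1 s2 p0 s}.
have h3 : 0 <= t ^+ 3 by rewrite exprn_ge0.
have h6 : 0 <= t ^+ 6 by rewrite exprn_ge0.
have [t2|t2] := lerP t (1 / 2).
  have h1 : 0 <= (t - 6 / 25) ^+ 2 by rewrite sqr_ge0.
  have h2 : 0 <= t * (t - 7 / 25) ^+ 2 by rewrite mulr_ge0 ?sqr_ge0.
  have h4 : 0 <= t ^+ 3 * (1 / 2 - t) by rewrite mulr_ge0 ?subr_ge0.
  have h5 : 0 <= t ^+ 3 * (1 / 4 - t ^+ 2) by rewrite mulr_ge0// subr_ge0; nra.
  by lra.
have h1 : 0 <= (t - 1 / 2) * (1 - t) by rewrite mulr_ge0 ?subr_ge0// ltW.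
have h2 : 0 <= t ^+ 2 * (1 - t) by rewrite mulr_ge0 ?exprn_ge0 ?subr_ge0.
have h4 : 0 <= t ^+ 3 * (1 - t) by rewrite mulr_ge0 ?subr_ge0.
have h5 : 0 <= t ^+ 4 * (1 - t) by rewrite mulr_ge0 ?exprn_ge0 ?subr_ge0.
have h7 : 0 <= (t - 1 / 2) ^+ 2 by rewrite sqr_ge0.
by lra.
Qed.

Lemma defect_le_small s (c : R) : 2 <= s -> 3 / 2 <= c * (s ^+ 2 * (s - 1) ^+ 3) ->
  defect s <= c.
Proof.
move=> s2 h; have p0 : 0 < s ^+ 2 * (s - 1) ^+ 3.
  by rewrite mulr_gt0 ?exprn_gt0//; lra.
by rewrite -(ler_pM2r p0) (le_trans (defect_le_tail s2)).
Qed.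

Lemma defect_le1 s : 1 <= s -> defect s <= 1.
Proof.
move=> s1; have s0 : 0 < s by lra.
have d0 := @defect_ge0 _ s (ltW s0).
rewrite -(ler_pM2r s0) mul1r; apply: le_trans (defect_outer_sq s1).
by rewrite ler_wpM2l//; have := sqr_ge0 (s - 1); have := sqr_ge0 (s * (s - 1)); lra.
Qed.

Lemma defect_le_3half s : defect s <= 3 / 2.
Proof.
have [s0|s0] := lerP s 0; first by have /andP[_ h] := defect_neg s0; lra.
have [s1|s1] := lerP s 1.
  have := @defect_le_lin _ s (ltW s0); have := @defect_le_inner s.
  by rewrite s1 (ltW s0) => /(_ isT); lra.
by have := defect_le1 (ltW s1); lra.
Qed.

(** As [s ^+ 2 * (s - 1) ^+ 3] increases, the tail bound at the left end [a] of an interval covers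
    all of it, and each use becomes arithmetic. *)
Lemma defect_le_beyond (a c : R) s : 2 <= a <= s -> 0 <= c ->
  3 / 2 <= c * (a ^+ 2 * (a - 1) ^+ 3) -> defect s <= c.
Proof.
move=> /andP[a2 as_] c0 h; apply: defect_le_small; first by lra.
apply: (le_trans h); rewrite ler_wpM2l// ler_pM ?exprn_ge0//; try lra.
  by rewrite lerXn2r ?nnegrE; lra.
by rewrite lerXn2r ?nnegrE; lra.
Qed.

(** For small |h| the ratio u / w rarely lies in [-4, 4], so a crude hat of height 3 over the low
    floor 1/10 suffices. Its symmetry matters in [loss_le_wide_hat]. *)
Lemma defect_le_wide_hat s : defect s <= 1 / 10 + tri (3 / 4) (- 4) 4 (3 / 4) s.
Proof.
apply: le_tri; have [s0|s0] := lerP s 0.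
  by left; have /andP[_ h] := defect_neg s0; lra.
have [s2|s2] := lerP s 2; first by right; have := defect_le_3half s; lra.
have [s3|s3] := lerP s (13 / 5).
  have : defect s <= 3 / 8 by apply: (@defect_le_beyond 2); lra.
  by right; lra.
by left; apply: (@defect_le_beyond (13 / 5)); lra.
Qed.

(** A majorant without hat, meant for h nearly parallel to x. *)
Lemma defect_le_parabola s : 0 <= s -> defect s <= 1 / 50 + 9 / 50 * (s - 69 / 20) ^+ 2.
Proof.
move=> s0; have [s1|s1] := lerP s 1.
  have [s2|s2] := lerP s (51 / 74); first by have := defect_le_lin s0; nra.
  have : defect s <= 51 / 25 - 24 / 25 * s by apply: defect_le_inner; rewrite s0.
  by have := sqr_ge0 (s - 4 / 5); lra.
have [s2|s2] := lerP s 2; first by apply: defect_le_outer_parabola; rewrite s2 ltW.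
have [s3|s3] := lerP s (5 / 2).
  apply: defect_le_small; first by lra.
  have [t es] : exists t, s = 2 + t by exists (s - 2); ring.
  subst s; have t0 : 0 <= t by lra.
  have -> : 2 + t - 1 = 1 + t by ring.
  have h1 : 4 * (1 + 3 * t) <= (2 + t) ^+ 2 * (1 + t) ^+ 3.
    have := exprn_ge0 5 t0; have := exprn_ge0 4 t0; have := exprn_ge0 3 t0.
    have := exprn_ge0 2 t0; lra.
  apply: (le_trans (y := (1 / 50 + 9 / 50 * (t - 29 / 20) ^+ 2) * (4 * (1 + 3 * t)))).
    have h2 : 0 <= t * (1 / 2 - t) by nra.
    have := exprn_ge0 3 t0; lra.
  have -> : 2 + t - 69 / 20 = t - 29 / 20 by field.
  by rewrite ler_wpM2l//; have := sqr_ge0 (t - 29 / 20); lra.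
(* The parabola decreases up to 69/20, so on each short interval its value at the right end is
   compared with the tail bound at the left end. *)
have [s4|s4] := lerP s (11 / 4).
  by apply: (@defect_le_beyond (5 / 2)); nra.
have [s5|s5] := lerP s 3.
  by apply: (@defect_le_beyond (11 / 4)); nra.
have [s6|s6] := lerP s (31 / 10).
  by apply: (@defect_le_beyond 3); nra.
by apply: (@defect_le_beyond (31 / 10)); have := sqr_ge0 (s - 69 / 20); lra.
Qed.

(** The left side of the hat, 2/5 + 2 (s - 1/5), is exactly the trivial bound [2 * s]; the right
    side is the line of [defect_le_outer_hat]. *)
Lemma defect_le_hat s : defect s <= 2 / 5 + tri 2 (1 / 5) (9 / 5) (9 / 10) s.
Proof.
apply: le_tri; have [s0|s0] := lerP s 0.
  by left; have /andP[_ h] := defect_neg s0; lra.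
have h1 := defect_le_lin (ltW s0).
have [s1|s1] := lerP s 1.
  have h : defect s <= 51 / 25 - 24 / 25 * s by apply: defect_le_inner; lra.
  right; lra.
have [s2|s2] := lerP s (9 / 5).
  by right; have := @defect_le_outer_hat s; rewrite s2 (ltW s1) => /(_ isT); lra.
left; have h := defect_outer_sq (ltW s1).
have p0 : 0 < 1 + s * (s - 1) + (s * (s - 1)) ^+ 2 by nra.
rewrite -(ler_pM2r p0); apply: le_trans h _.
(* Tangent line to s (s - 1) at 9/5, then the linear part of its square. *)
have h2 : 36 / 25 + 13 / 5 * (s - 9 / 5) <= s * (s - 1) by nra.
have h3 : (36 / 25) ^+ 2 + 2 * (36 / 25) * (13 / 5 * (s - 9 / 5)) <= (s * (s - 1)) ^+ 2 by nra.
by lra.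
Qed.

(** The parabola becomes the quadratic form at x + 5/2 h, which is cheap unless x^T h is large; the
    hat covers the peak of the defect inside (1/2, 1). *)
Lemma defect_le_parabola_hat s :
  defect s <= 1 / 20 * (s + 5 / 2) ^+ 2 + tri (17 / 10) (4 / 25) (7 / 5) (5 / 4) s.
Proof.
apply: le_tri; have [s0|s0] := lerP s 0.
  by left; have /andP[_ h] := defect_neg s0; have := sqr_ge0 (s + 5 / 2); lra.
have h1 := defect_le_lin (ltW s0).
have [s1|s1] := lerP s 1.
  have h : defect s <= 51 / 25 - 24 / 25 * s by apply: defect_le_inner; lra.
  by right; have := sqr_ge0 s; have := sqr_ge0 (s - 1 / 2); split; lra.
have [s2|s2] := lerP s (7 / 5).
  right; have := @defect_le_outer_parabola_hat s; rewrite s2 (ltW s1) => /(_ isT).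
  by have := defect_le1 (ltW s1); have := sqr_ge0 (s - 1); split; lra.
(* From 7/5 on the parabola alone is at least 3/4. *)
left; apply: (le_trans (y := 3 / 4)); last by nra.
have h := defect_outer_sq (ltW s1).
have p0 : 0 < 1 + s * (s - 1) + (s * (s - 1)) ^+ 2 by nra.
rewrite -(ler_pM2r p0); apply: le_trans h _.
have h2 : 14 / 25 + 9 / 5 * (s - 7 / 5) <= s * (s - 1) by nra.
have h3 : (14 / 25) ^+ 2 + 2 * (14 / 25) * (9 / 5 * (s - 7 / 5)) <= (s * (s - 1)) ^+ 2 by nra.
by lra.
Qed.

End Majorants.

(** * Integration against densities and rotations *)

Section Integration.
Local Open Scope ereal_scope.

Import HBNNSimple.

Section Weighted.
Context d d' (T : measurableType d) (T' : measurableType d') (R : realType).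
Variables (mu : {measure set T -> \bar R}) (nu : {measure set T' -> \bar R}).
Variables (F : T -> R) (X : T -> T').
Hypotheses (mF : measurable_fun setT F) (F0 : forall t, (0 <= F t)%R).
Hypothesis mX : measurable_fun setT X.
Hypothesis FX : forall B, measurable B ->
  \int[mu]_t ((F t)%:E * (\1_B (X t))%:E) = nu B.

Let weighted_nnsfun (h : {nnsfun T' >-> R}) :
  \int[mu]_t ((F t)%:E * (h (X t))%:E) = \int[nu]_y (h y)%:E.
Proof.
under [RHS]eq_integral do rewrite fimfunE -fsumEFin//.
rewrite [RHS]ge0_integral_fsum//; last 2 first.
- by move=> r; exact/measurable_EFinP/measurableT_comp.
- by move=> n x _; rewrite EFinM nnfun_muleindic_ge0.
under [LHS]eq_integral.
  move=> x xD; rewrite fimfunE -fsumEFin// ge0_mule_fsumr; last first.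
    by move=> r; rewrite EFinM nnfun_muleindic_ge0.
  over.
have mi r : measurable_fun setT (fun x => \1_(h @^-1` [set r]) (X x) : R).
  by apply: measurableT_comp => //; exact: measurable_indic.
rewrite [LHS]ge0_integral_fsum//; last 2 first.
- move=> r; apply: emeasurable_funM; first exact/measurable_EFinP.
  by apply/measurable_EFinP; apply: measurable_funM => //; exact: mi.
- move=> n x _; apply: mule_ge0; first by rewrite lee_fin.
  by rewrite EFinM nnfun_muleindic_ge0.
apply: eq_fsbigr => r _.
rewrite integralZl_indic_nnsfun//= integral_indic// setIT -FX//.
have [r0|r0] := ltP r 0%R.
  rewrite preimage_nnfun0//.
  under eq_integral do rewrite indic0 EFinM mule0 mule0.
  by rewrite FX// measure0 mule0 integral0.
rewrite -ge0_integralZl//.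
- by apply: eq_integral => x _; rewrite EFinM muleCA.
- apply: emeasurable_funM; apply/measurable_EFinP => //; exact: mi.
- by move=> t _; rewrite mule_ge0// lee_fin.
Qed.

(** One statement for three uses: a density ([X] the identity), a joint law on an event ([F] an
    indicator), and a product of earlier factors. The hypothesis [FX] speaks of sets only; simple
    functions and monotone limits do the rest. *)
Lemma ge0_integral_weighted g : measurable_fun setT g -> (forall y, 0 <= g y) ->
  \int[mu]_t ((F t)%:E * g (X t)) = \int[nu]_y g y.
Proof.
move=> mg g0; pose h := nnsfun_approx measurableT mg.
have cvgh y : (EFin \o h^~ y) n @[n --> \oo] --> g y.
  exact: cvg_nnsfun_approx.
transitivity (lim (\int[nu]_y (h n y)%:E @[n --> \oo])); last first.
  rewrite -monotone_convergence//=.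
  - by apply: eq_integral => y _; apply/cvg_lim => //; exact: cvgh.
  - by move=> n; exact/measurable_EFinP/measurable_funTS.
  - by move=> n ? _; rewrite lee_fin.
  - by move=> ? _ ? ? mn; rewrite lee_fin; exact/lefP/nd_nnsfun_approx.
transitivity (lim (\int[mu]_t ((F t)%:E * (h n (X t))%:E) @[n --> \oo])).
  rewrite -monotone_convergence//=.
  - apply: eq_integral => t _; apply/esym/cvg_lim => //.
    by apply: cvgeZl => //; exact: cvgh.
  - move=> n; apply: emeasurable_funM; first exact/measurable_EFinP.
    by apply/measurable_EFinP; exact: measurableT_comp.
  - by move=> n ? _; rewrite mule_ge0// lee_fin.
  - move=> ? _ ? ? mn; apply: lee_wpmul2l; first by rewrite lee_fin.
    by rewrite lee_fin; exact/lefP/nd_nnsfun_approx.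
by apply: congr_lim; apply/funext => n /=; exact: weighted_nnsfun.
Qed.

End Weighted.

Section Shear.
Context {R : realType}.
Notation mu := (@lebesgue_measure R).

Definition translate (t : R) (y : measurableTypeR R) : measurableTypeR R := (y + t)%R.

Lemma measurable_translate t : measurable_fun setT (translate t).
Proof. exact: measurable_funD. Qed.

Lemma lebesgue_measure_translate (t : R) (A : set R) : measurable A ->
  pushforward mu (translate t) A = mu A.
Proof.
move=> mA; apply/esym; apply: (@lebesgue_measure_unique R (pushforward mu (translate t))) => //=.
  exact: measurable_translate.
move=> _ _ [[a b]] _ <-.
rewrite /pushforward (_ : _ @^-1` _ = `](a - t)%R, (b - t)%R]%classic).
  rewrite !lebesgue_measure_itv/= !lte_fin ltrD2r.
  by case: ifP => // _; rewrite -!EFinB; congr (_%:E)%E; ring.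
by apply/seteqP; split => y /=; rewrite !in_itv/= ltrBlDr lerBrDr.
Qed.

Lemma ge0_integral_translate (t : R) (f : R -> \bar R) :
  measurable_fun setT f -> (forall y, 0 <= f y) ->
  \int[mu]_y f (y + t)%R = \int[mu]_y f y.
Proof.
move=> mf f0.
rewrite -[LHS](@ge0_integral_pushforward _ _ _ _ R _ (@measurable_translate t) mu setT f)//.
apply: eq_measure_integral => //=; first exact: measurable_translate.
by move=> _ A mA _; exact: lebesgue_measure_translate.
Qed.

(** Iterated rather than a product measure, so that a shear is a translation inside the inner
    integral. *)
Definition lebesgue2 (G : R * R -> \bar R) := \int[mu]_x \int[mu]_y G (x, y).

Let measurable_shear1 (t : R) (G : R * R -> \bar R) : measurable_fun setT G ->
  measurable_fun setT (fun z : R * R => G (z.1, z.2 + t * z.1)%R).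
Proof.
move=> mG; apply: (measurableT_comp mG).
apply: measurable_fun_pair => //=; apply: measurable_funD => //.
exact: measurable_funM.
Qed.

Let measurable_shear2 (t : R) (G : R * R -> \bar R) : measurable_fun setT G ->
  measurable_fun setT (fun z : R * R => G (z.1 + t * z.2, z.2)%R).
Proof.
move=> mG; apply: (measurableT_comp mG).
apply: measurable_fun_pair => //=; apply: measurable_funD => //.
exact: measurable_funM.
Qed.

Let shear1 (t : R) (G : R * R -> \bar R) : measurable_fun setT G ->
  (forall z, 0 <= G z) ->
  lebesgue2 (fun z => G (z.1, z.2 + t * z.1)%R) = lebesgue2 G.
Proof.
move=> mG G0; apply: eq_integral => x _ /=.
rewrite (@ge0_integral_translate (t * x) (fun y => G (x, y)))//.
exact: measurableT_comp.
Qed.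

Let mu2C (G : R * R -> \bar R) : measurable_fun setT G ->
  (forall z, 0 <= G z) -> lebesgue2 G = \int[mu]_y \int[mu]_x G (x, y).
Proof. by move=> mG G0; exact: (@fubini_tonelli _ _ _ _ _ mu mu G). Qed.

Let shear2 (t : R) (G : R * R -> \bar R) : measurable_fun setT G ->
  (forall z, 0 <= G z) ->
  lebesgue2 (fun z => G (z.1 + t * z.2, z.2)%R) = lebesgue2 G.
Proof.
move=> mG G0; rewrite [RHS]mu2C// mu2C//; last exact: measurable_shear2.
apply: eq_integral => y _ /=.
rewrite (@ge0_integral_translate (t * y) (fun x => G (x, y)))//.
exact: measurableT_comp.
Qed.

(* A rotation is a product of three shears. *)
Lemma lebesgue_rotation (c s : R) (G : R * R -> \bar R) :
  (0 <= c)%R -> (c ^+ 2 + s ^+ 2 = 1)%R -> measurable_fun setT G ->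
  (forall z, 0 <= G z) ->
  lebesgue2 (fun z => G (c * z.1 + s * z.2, c * z.2 - s * z.1)%R) = lebesgue2 G.
Proof.
(* [t] is the tangent of half the angle; [0 <= c] keeps [1 + c] away from 0. *)
move=> c0 cs mG G0; pose t := (s / (1 + c))%R.
have c1 : (1 + c != 0)%R by rewrite gt_eqF//; lra.
have tc : (t * (1 + c) = s)%R by rewrite /t divfK.
have ts : (t * s = 1 - c)%R.
  by apply: (mulIf c1); rewrite mulrAC tc -expr2 -(addrK (c ^+ 2) (s ^+ 2))%R addrC [X in (- _ + X)%R]addrC cs; ring.
rewrite -[RHS](shear2 t)//.
rewrite -[RHS](@shear1 (- s))//; last exact: measurable_shear2.
rewrite -[RHS](@shear2 t)//; last first.
  by apply: (@measurable_shear1 _ (fun z => G (z.1 + t * z.2, z.2)%R)); exact: measurable_shear2.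
apply: eq_integral => x _; apply: eq_integral => y _ /=.
have cE : (c = 1 - t * s)%R by rewrite ts; ring.
by congr (G (_, _)); [rewrite -{1}tc|]; rewrite cE; ring.
Qed.

End Shear.

End Integration.

(** * Gaussian integrals in one and two dimensions *)

Section StandardNormal.
Context {R : realType}.
Local Open Scope ereal_scope.
Notation mu := (@lebesgue_measure R).
Notation N := (@normal_prob R 0 1).

Lemma normal_pdf01 (x : R) :
  (normal_pdf 0 1 x = normal_peak 1 * expR (- (x ^+ 2 / 2)))%R.
Proof.
by rewrite normal_pdfE ?oner_neq0// /normal_fun subr0 expr1n mulNr.
Qed.

Lemma ge0_integral_normal (m s : R) (g : R -> \bar R) : measurable_fun setT g ->
  (forall x, 0 <= g x) ->
  \int[normal_prob m s]_x g x = \int[mu]_x ((normal_pdf m s x)%:E * g x).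
Proof.
move=> mg g0; apply/esym.
apply: (@ge0_integral_weighted _ _ _ _ R mu (normal_prob m s) (normal_pdf m s) idfun) => //.
- exact: measurable_normal_pdf.
- exact: normal_pdf_ge0.
- exact: measurable_id.
- move=> B mB; rewrite -[RHS]/(\int[mu]_(x in B) (normal_pdf m s x)%:E).
  rewrite [RHS]integral_mkcond.
  apply: eq_integral => x _; rewrite patchE indicE.
  by case: (x \in B); rewrite ?mule1 ?mule0.
Qed.

Definition normal2 (G : R * R -> \bar R) := \int[N]_x \int[N]_y G (x, y).

Lemma normal2E (G : R * R -> \bar R) : measurable_fun setT G ->
  (forall z, 0 <= G z) ->
  normal2 G = lebesgue2 (fun z => (normal_pdf 0 1 z.1 * normal_pdf 0 1 z.2)%:E * G z).
Proof.
move=> mG G0; rewrite /normal2 ge0_integral_normal//; last 2 first.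
- exact: (@measurable_fun_fubini_tonelli_F _ _ _ _ _ N G).
- by move=> x; exact: integral_ge0.
apply: eq_integral => x _ /=.
rewrite ge0_integral_normal//; last exact: measurableT_comp.
rewrite -ge0_integralZl//=.
- by apply: eq_integral => y _; rewrite EFinM muleA.
- apply: emeasurable_funM; last exact: measurableT_comp.
  by apply/measurable_EFinP; exact: measurable_normal_pdf.
- by move=> y _; rewrite mule_ge0// lee_fin normal_pdf_ge0.
- by rewrite lee_fin normal_pdf_ge0.
Qed.

(** The product density depends on x^2 + y^2 only, so the Lebesgue case applies. *)
Lemma normal2_rotation (c s : R) (G : R * R -> \bar R) :
  (0 <= c)%R -> (c ^+ 2 + s ^+ 2 = 1)%R -> measurable_fun setT G ->
  (forall z, 0 <= G z) ->
  normal2 (fun z => G (c * z.1 + s * z.2, c * z.2 - s * z.1)%R) = normal2 G.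
Proof.
move=> c0 cs mG G0.
have mrot : measurable_fun setT
    (fun z : R * R => (c * z.1 + s * z.2, c * z.2 - s * z.1)%R).
  apply: measurable_fun_pair => //=.
    by apply: measurable_funD; exact: measurable_funM.
  by apply: measurable_funB; exact: measurable_funM.
pose H z := (normal_pdf 0 1 z.1 * normal_pdf 0 1 z.2)%:E * G z.
have mH : measurable_fun setT H.
  apply: emeasurable_funM => //; apply/measurable_EFinP.
  by apply: measurable_funM; apply: measurableT_comp => //; exact: measurable_normal_pdf.
have H0 z : 0 <= H z by rewrite mule_ge0// lee_fin mulr_ge0// normal_pdf_ge0.
rewrite (normal2E mG G0) -(lebesgue_rotation c0 cs mH H0) normal2E; last 2 first.
- exact: (measurableT_comp mG).
- by move=> z; exact: G0.
apply: eq_integral => x _; apply: eq_integral => y _; rewrite /H /=.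
congr (_%:E * _)%E; rewrite !normal_pdf01.
rewrite mulrACA [RHS]mulrACA -!expRD; congr (_ * expR _)%R.
have cE : (x ^+ 2 + y ^+ 2 = (c ^+ 2 + s ^+ 2) * (x ^+ 2 + y ^+ 2))%R by rewrite cs mul1r.
by rewrite -!opprD -!mulrDl cE; congr (- (_ / _))%R; ring.
Qed.

(** The integrand times the density is [s] times the centred normal density of deviation s = (1 - 2
    l)^(-1/2). *)
Lemma integral_normal_expR_sq (l : R) : (l < 1 / 2)%R ->
  \int[N]_x (expR (l * x ^+ 2))%:E = ((Num.sqrt (1 - 2 * l))^-1)%:E.
Proof.
move=> l2; set s := (Num.sqrt (1 - 2 * l))^-1%R.
have l0 : (0 < 1 - 2 * l)%R by lra.
have s0 : (0 < s)%R by rewrite invr_gt0 sqrtr_gt0.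
have s2 : (s ^+ 2 = (1 - 2 * l)^-1)%R by rewrite exprVn sqr_sqrtr// ltW.
have mf : measurable_fun setT (fun x : R => (expR (l * x ^+ 2))%:E).
  apply/measurable_EFinP; apply: measurableT_comp => //.
  by apply: measurable_funM => //; exact: measurable_funX.
rewrite ge0_integral_normal//.
transitivity (\int[mu]_x (s%:E * (normal_pdf 0 s x)%:E)).
  apply: eq_integral => x _; rewrite -!EFinM; congr (_%:E).
  rewrite normal_pdf01 normal_pdfE ?gt_eqF// /normal_fun subr0 /normal_peak.
  rewrite expr1n mul1r s2 [RHS]mulrA -[LHS]mulrA -expRD. congr (_ * expR _)%R.
    rewrite -mulrnAr sqrtrM ?invr_ge0 ?ltW// invfM sqrtrV ?ltW// -/s.
    by rewrite mulrA divff ?mul1r// gt_eqF.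
  by rewrite -(mulr_natr (1 - 2 * l)^-1) invfM invrK; field.
rewrite ge0_integralZl//.
- by rewrite integral_normal_pdf mule1.
- by apply/measurable_EFinP; exact: measurable_normal_pdf.
- by move=> x _; rewrite lee_fin normal_pdf_ge0.
- by rewrite lee_fin ltW.
Qed.

(** Makes the antiderivative in [integral_normal_cube] vanish at infinity. *)
Lemma tail_sq_expR (x : R) : (0 < x)%R -> ((x ^+ 2 + 2) * expR (- (x ^+ 2 / 2)) <= 16 / x)%R.
Proof.
move=> x0; rewrite expRN ler_pdivrMr ?expR_gt0//.
have h := @expR_ge_cubic R (x ^+ 2 / 2) ltac:(by rewrite divr_ge0// sqr_ge0).
rewrite mulrAC ler_pdivlMr//; apply: (le_trans (y := (16 * (1 + x ^+ 2 / 2 + (x ^+ 2 / 2) ^+ 2 / 2))%R)).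
  have := sqr_ge0 (x ^+ 2 - 1); have := sqr_ge0 (x - 1); have := sqr_ge0 (x ^+ 2 - x).
  have := sqr_ge0 (x + 1); have := sqr_ge0 x; lra.
rewrite ler_pM2l//; apply: le_trans h.
by rewrite lerDl divr_ge0// exprn_ge0// divr_ge0// sqr_ge0.
Qed.

(** The integrand is even and has an explicit antiderivative on the half-line. A third moment is
    wanted because the conditional integral of a hat given w carries the factor |w|^3. *)
Lemma integral_normal_cube :
  \int[N]_x (`|x| ^+ 3)%:E = (4 * normal_peak (1 : R))%:E.
Proof.
have mabs3 : measurable_fun setT (fun x : R => (`|x| ^+ 3)%:E).
  by apply/measurable_EFinP; apply: measurable_funX; exact: normr_measurable.
pose f (x : R) := (x ^+ 3 * expR (- (x ^+ 2 / 2)))%R.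
pose F (x : R) := (- ((x ^+ 2 + 2) * expR (- (x ^+ 2 / 2))))%R.
have dF (x : R) : is_derive x 1%R F (f x).
  rewrite /F /f; apply: is_derive_eq.
  by rewrite /GRing.scale /=; field.
have cf : continuous f.
  by move=> x; apply: differentiable_continuous; apply/derivable1_diffP; rewrite /f.
have F0 : F x @[x --> +oo%R] --> 0%R.
  apply: (@squeeze_cvgr _ _ _ _ (fun x => - 16 * x^-1)%R (cst 0%R)).
  - near=> x.
    have x0 : (0 < x)%R by near: x; exact: nbhs_pinfty_gt.
    rewrite /F mulNr lerN2 tail_sq_expR//= oppr_le0 mulr_ge0 ?expR_ge0//.
    by rewrite addr_ge0// sqr_ge0.
  - rewrite -[X in _ --> X](mulr0 (- 16)%R); apply: cvgMl_tmp.
    apply/gtr0_cvgV0; last exact: cvg_id.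
    by near=> x; near: x; exact: nbhs_pinfty_gt.
  - exact: cvg_cst.
have I0 : \int[mu]_(x in `[0%R, +oo[) (f x)%:E = 2%:E.
  rewrite (@ge0_continuous_FTC2y R f F 0 0)//.
  - by rewrite -EFinB /F expr0n/= mul0r oppr0 expR0; congr (_%:E); ring.
  - by move=> x x0; rewrite mulr_ge0 ?expR_ge0// exprn_ge0.
  - exact: continuous_subspaceT.
  - by apply: cvg_at_right_filter; apply: differentiable_continuous; apply/derivable1_diffP; exact: ex_derive.
  - by move=> x _; rewrite derive1E; exact: derive_val.
rewrite ge0_integral_normal//.
transitivity (\int[mu]_x ((normal_peak 1)%:E * (`|f x|)%:E)).
  apply: eq_integral => x _; rewrite -!EFinM; congr (_%:E).
  rewrite normal_pdf01 /f normrM normrX (ger0_norm (expR_ge0 _)).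
  by rewrite -mulrA; congr (_ * _)%R; rewrite mulrC.
have mf : measurable_fun setT f by exact: continuous_measurable_fun.
have cnf : continuous (fun x => `|f x|%R).
  by move=> x; apply: (cvg_comp f); [exact: cf|exact: norm_continuous].
rewrite ge0_integralZl//; last 2 first.
- by apply/measurable_EFinP; exact: continuous_measurable_fun.
- by rewrite lee_fin normal_peak_ge0.
rewrite (ge0_symfun_integralT _ cnf)//; last first.
  move=> x; rewrite /f /= sqrrN (_ : (- x) ^+ 3 = - x ^+ 3)%R; last by ring.
  by rewrite mulNr normrN.
rewrite -set_itvcy.
rewrite (_ : \int[mu]_(x in _) _ = 2%:E); last first.
  rewrite -[RHS]I0; apply: eq_integral => x; rewrite inE/= in_itv/= andbT => x0.
  by rewrite ger0_norm// mulr_ge0 ?expR_ge0// exprn_ge0.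
by rewrite -!EFinM; congr (_%:E); ring.
Unshelve. all: by end_near. Qed.

End StandardNormal.

Section Constants.
Context {R : realType}.

Lemma sin_le (x : R) : 0 <= x -> sin x <= x.
Proof.
rewrite le_eqVlt => /predU1P[<-|x0]; first by rewrite sin0.
have [|c _] := @MVT R sin cos 0 x x0 (fun y _ => is_derive_sin y).
  by apply: continuous_subspaceT; exact: continuous_sin.
rewrite sin0 !subr0 => ->.
by rewrite ler_piMl ?cos_le1// ltW.
Qed.

Lemma cos_half (x : R) : cos x = 2 * cos (x / 2) ^+ 2 - 1.
Proof.
have -> : cos x = cos ((x / 2) *+ 2) by congr cos; rewrite -mulr_natr divfK.
by rewrite cos_mulr2n mulr_natl.
Qed.

(** Archimedes: pi >= 16 sin (pi / 16), the sine coming from cos (pi / 2) = 0 through three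
    half-angle steps. *)
Lemma pi_ge31 : 31 / 10 <= pi :> R.
Proof.
have p0 : 0 < pi :> R := pi_gt0 R.
have cpos (y : R) : 0 <= y < pi / 2 -> 0 < cos y.
  by move=> hy; apply: cos_gt0_pihalf; lra.
have c4 := cos_half (pi / 2 : R); rewrite cos_pihalf in c4.
have c4p := cpos (pi / 2 / 2) ltac:(lra).
have c8 := cos_half (pi / 2 / 2 : R).
have c8p := cpos (pi / 2 / 2 / 2) ltac:(lra).
have c16 := cos_half (pi / 2 / 2 / 2 : R).
have := @sin_le (pi / 2 / 2 / 2 / 2) ltac:(lra).
have s16p : 0 <= sin (pi / 2 / 2 / 2 / 2 : R).
  by rewrite sin_ge0_pi//; lra.
have := cos2Dsin2 (pi / 2 / 2 / 2 / 2 : R).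
move: c4 c4p c8 c8p c16 s16p.
move: (cos (pi / 2 / 2)) (cos (pi / 2 / 2 / 2)) (cos (pi / 2 / 2 / 2 / 2)) (sin _).
move=> a b c s a2 a0 b2 b0 c2 s0 cs s1.
have a1 : a <= 442 / 625 by rewrite -(@ler_sqr _ a) ?nnegrE; lra.
have b1 : b <= 231 / 250 by rewrite -(@ler_sqr _ b) ?nnegrE; lra.
have s2 : 97 / 500 <= s by rewrite -(@ler_sqr _ _ s) ?nnegrE; lra.
lra.
Qed.

(** The squared peak is 1 / (2 pi); four times this bound is the factor 20/31 of all hat
    estimates. *)
Lemma normal_peak_sqr_le : normal_peak (1 : R) ^+ 2 <= 5 / 31.
Proof.
have p := pi_ge31.
have p0 : 0 <= 1 ^+ 2 * pi *+ 2 :> R by rewrite mulrn_wge0// mulr_ge0// pi_ge0.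
rewrite /normal_peak exprVn (sqr_sqrtr p0) expr1n mul1r.
by rewrite -mulr_natl -div1r ler_pdivrMr; lra.
Qed.

End Constants.

(** * Hats integrated against a normal law *)

Section Triangle.
Context {R : realType}.
Local Open Scope ereal_scope.
Notation mu := (@lebesgue_measure R).
Notation N := (@normal_prob R 0 1).

Lemma integral_affine (p q a b : R) : (a < b)%R ->
  \int[mu]_(x in `[a, b]) (p * x + q)%:E =
  ((b - a) * (p * ((a + b) / 2) + q))%:E.
Proof.
move=> ab; pose F (x : R) := (p / 2 * x ^+ 2 + q * x)%R.
have dF (x : R) : is_derive x 1%R F (p * x + q)%R.
  rewrite /F; apply: is_derive_eq.
  by rewrite /GRing.scale /=; field.
have cF : continuous F.
  by move=> x; apply: differentiable_continuous; apply/derivable1_diffP; rewrite /F.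
rewrite (@continuous_FTC2 R _ F a b)//.
- by rewrite -EFinB /F; congr (_%:E); field.
- apply: continuous_subspaceT => x.
  by apply: differentiable_continuous; apply/derivable1_diffP.
- split => //.
  + by apply: cvg_at_right_filter; exact: cF.
  + by apply: cvg_at_left_filter; exact: cF.
- by move=> x _; rewrite derive1E; exact: derive_val.
Qed.

Definition hat (e a k b x : R) := Num.max 0%R (Num.min (e * (x - a)) (k * (b - x)))%R.

Lemma measurable_hat e a k b : measurable_fun setT (hat e a k b).
Proof.
apply: measurable_maxr => //; apply: measurable_minr.
  by apply: measurable_funM => //; exact: measurable_funB.
by apply: measurable_funM => //; exact: measurable_funB.
Qed.

Lemma hat_ge0 e a k b x : (0 <= hat e a k b x)%R.
Proof. by rewrite le_max lexx. Qed.

(** Area of a triangle of base b - a and height (b - a) e k / (e + k). *)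
Lemma integral_hat_le (e a k b : R) : (0 < e)%R -> (0 < k)%R -> (a < b)%R ->
  \int[mu]_x (hat e a k b x)%:E <= ((b - a) ^+ 2 / 2 * (e * k / (e + k)))%:E.
Proof.
move=> e0 k0 ab; have ek : (e + k != 0)%R by rewrite gt_eqF// addr_gt0.
(* Abscissa of the apex, where the two sides meet. *)
pose c := ((e * a + k * b) / (e + k))%R.
have ca : (c - a = k * (b - a) / (e + k))%R by rewrite /c; field.
have bc : (b - c = e * (b - a) / (e + k))%R by rewrite /c; field.
have ac : (a < c)%R.
  by rewrite -subr_gt0 ca divr_gt0 ?addr_gt0// mulr_gt0// subr_gt0.
have cb : (c < b)%R.
  by rewrite -subr_gt0 bc divr_gt0 ?addr_gt0// mulr_gt0// subr_gt0.
pose f1 (x : R) := (e * x + - (e * a))%R; pose f2 (x : R) := (- k * x + k * b)%R.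
have mf1 : measurable_fun setT (EFin \o f1).
  by apply/measurable_EFinP; apply: measurable_funD => //; exact: measurable_funM.
have mf2 : measurable_fun setT (EFin \o f2).
  by apply/measurable_EFinP; apply: measurable_funD => //; exact: measurable_funM.
have p1 x : 0 <= ((EFin \o f1) \_ `[a, c]) x.
  rewrite patchE; case: ifPn => //; rewrite inE/= in_itv/= => /andP[h1 h2].
  by rewrite lee_fin /f1; nra.
have p2 x : 0 <= ((EFin \o f2) \_ `[c, b]) x.
  rewrite patchE; case: ifPn => //; rewrite inE/= in_itv/= => /andP[h1 h2].
  by rewrite lee_fin /f2; nra.
have m1 : measurable_fun setT ((EFin \o f1) \_ `[a, c]).
  by apply/(measurable_restrictT _ _).1 => //; exact: measurable_funTS.
have m2 : measurable_fun setT ((EFin \o f2) \_ `[c, b]).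
  by apply/(measurable_restrictT _ _).1 => //; exact: measurable_funTS.
apply: (@le_trans _ _ (\int[mu]_x (((EFin \o f1) \_ `[a, c]) x + ((EFin \o f2) \_ `[c, b]) x))).
  apply: ge0_le_integral => //.
  - by move=> x _; rewrite lee_fin hat_ge0.
  - by apply/measurable_EFinP; exact: measurable_hat.
  - exact: emeasurable_funD.
  move=> x _; rewrite /hat.
  have [xa|xa] := ltP x a.
    rewrite max_l ?adde_ge0//.
    by rewrite ge_min; apply/orP; left; nra.
  have [xb|xb] := ltP b x.
    rewrite max_l ?adde_ge0//.
    by rewrite ge_min; apply/orP; right; nra.
  have [xc|xc] := leP x c.
    apply: (@le_trans _ _ (f1 x)%:E).
      rewrite lee_fin ge_max ge_min /f1; apply/andP; split; first by nra.
      by apply/orP; left; nra.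
    rewrite patchE mem_set ?leeDl//=.
    by rewrite in_itv/= xa xc.
  apply: (@le_trans _ _ (f2 x)%:E).
    rewrite lee_fin ge_max ge_min /f2; apply/andP; split; first by nra.
    by apply/orP; right; nra.
  rewrite [X in _ <= _ + X]patchE [X in _ <= _ + X]ifT ?leeDr//.
  by rewrite inE/= in_itv/= xb (ltW xc).
rewrite ge0_integralD// -!integral_mkcond.
rewrite (integral_affine _ _ ac) (integral_affine _ _ cb) -EFinD lee_fin.
rewrite le_eqVlt; apply/orP; left; apply/eqP.
by rewrite /c; field.
Qed.

(* The 2-homogeneous form [w ^ 2 * tri (u / w)]. *)
Definition triform (e f g k u w : R) : R :=
  Num.max 0%R (Num.min (e * (u * w - f * w ^+ 2)) (k * (g * w ^+ 2 - u * w)))%R.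

Lemma measurable_triform e f g k : measurable_fun setT
  (fun z : R * R => triform e f g k z.1 z.2).
Proof.
have m1 : measurable_fun setT (fun z : R * R => z.1 * z.2)%R by exact: measurable_funM.
have m2 : measurable_fun setT (fun z : R * R => z.2 ^+ 2)%R by exact: measurable_funX.
apply: measurable_maxr => //; apply: measurable_minr.
  by apply: measurable_funM => //; apply: measurable_funB => //; exact: measurable_funM.
by apply: measurable_funM => //; apply: measurable_funB => //; exact: measurable_funM.
Qed.

Lemma triform_ge0 e f g k u w : (0 <= triform e f g k u w)%R.
Proof. by rewrite le_max lexx. Qed.

Definition hatarea (e f g k : R) : R := ((g - f) ^+ 2 / 2 * (e * k / (e + k)))%R.

Lemma integral_normal_hat_le (e a k b : R) : (0 < e)%R -> (0 < k)%R -> (a < b)%R ->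
  \int[N]_x (hat e a k b x)%:E <= (normal_peak 1 * hatarea e a b k)%:E.
Proof.
move=> e0 k0 ab.
have mh : measurable_fun setT (fun x => (hat e a k b x)%:E).
  by apply/measurable_EFinP; exact: measurable_hat.
have h0 x : 0 <= (hat e a k b x)%:E by rewrite lee_fin hat_ge0.
rewrite ge0_integral_normal//.
apply: (@le_trans _ _ (\int[mu]_x ((normal_peak 1)%:E * (hat e a k b x)%:E))).
  apply: ge0_le_integral => //.
  - by move=> x _; rewrite mule_ge0// lee_fin normal_pdf_ge0.
  - apply: emeasurable_funM => //; apply/measurable_EFinP.
    exact: measurable_normal_pdf.
  - exact: emeasurable_funM.
  move=> x _; apply: lee_wpmul2r => //.
  by rewrite lee_fin normal_pdf_ub// oner_neq0.
rewrite ge0_integralZl//; last by rewrite lee_fin normal_peak_ge0.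
rewrite EFinM; apply: lee_wpmul2l; first by rewrite lee_fin normal_peak_ge0.
exact: integral_hat_le.
Qed.

(** Given the first variable, w is fixed and the form is a hat in the second one, with slopes e ga
    |w| and k ga |w| and base (g - f) |w| / ga, hence of area proportional to |w|^3 / ga. The third
    moment of w = al z_1 then produces al^3. *)
Lemma integral_triform_le (e f g k al be ga : R) :
  (0 < e)%R -> (0 < k)%R -> (f < g)%R -> (0 <= al)%R -> (0 < ga)%R ->
  normal2 (fun z => (triform e f g k (be * z.1 + ga * z.2) (al * z.1))%:E) <=
  (4 * normal_peak (1 : R) ^+ 2 * hatarea e f g k * al ^+ 3 / ga)%:E.
Proof.
move=> e0 k0 fg al0 ga0; set c := (normal_peak 1 * hatarea e f g k / ga)%R.
have H0 : (0 <= hatarea e f g k)%R.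
  by rewrite mulr_ge0// ?divr_ge0 ?sqr_ge0// ?mulr_ge0 ?addr_ge0// ltW.
have c0 : (0 <= c)%R by rewrite divr_ge0 ?(ltW ga0)// mulr_ge0// normal_peak_ge0.
have inner (x : R) : \int[N]_y (triform e f g k (be * x + ga * y) (al * x))%:E <=
    (c * al ^+ 3)%:E * (`|x| ^+ 3)%:E.
  set w := (al * x)%R.
  have cw : (c * al ^+ 3 * `|x| ^+ 3 = normal_peak 1 * (hatarea e f g k * `|w| ^+ 3 / ga))%R.
    by rewrite /w normrM (ger0_norm al0) /c; field; rewrite gt_eqF.
  rewrite -EFinM cw.
  have [w0|w0|w0] := ltgtP w 0%R.
  (* For negative w the two sides of the hat trade places. *)
  - pose a := ((g * w - be * x) / ga)%R; pose b := ((f * w - be * x) / ga)%R.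
    have -> : (hatarea e f g k * `|w| ^+ 3 / ga = hatarea (k * (ga * - w)) a b (e * (ga * - w)))%R.
      rewrite ltr0_norm// /hatarea /a /b; field.
      by rewrite !gt_eqF ?addr_gt0// mulr_gt0// mulr_gt0// oppr_gt0.
    rewrite (_ : (fun y => _) = (fun y => (hat (k * (ga * - w)) a (e * (ga * - w)) b y)%:E)).
      have gw : (0 < ga * - w)%R by rewrite mulr_gt0// oppr_gt0.
      apply: integral_normal_hat_le; [exact: mulr_gt0|exact: mulr_gt0|].
      by rewrite /a /b ltr_pM2r ?invr_gt0// ltrD2r ltr_nM2r.
    apply/funext => y; congr (_%:E); rewrite /triform /hat minC; congr (Num.max _ (Num.min _ _)).
      by rewrite /a; field; rewrite gt_eqF.
    by rewrite /b; field; rewrite gt_eqF.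
  - pose a := ((f * w - be * x) / ga)%R; pose b := ((g * w - be * x) / ga)%R.
    have -> : (hatarea e f g k * `|w| ^+ 3 / ga = hatarea (e * (ga * w)) a b (k * (ga * w)))%R.
      rewrite gtr0_norm// /hatarea /a /b; field.
      by rewrite !gt_eqF ?addr_gt0// mulr_gt0// mulr_gt0.
    rewrite (_ : (fun y => _) = (fun y => (hat (e * (ga * w)) a (k * (ga * w)) b y)%:E)).
      have gw : (0 < ga * w)%R by rewrite mulr_gt0.
      apply: integral_normal_hat_le; [exact: mulr_gt0|exact: mulr_gt0|].
      by rewrite /a /b ltr_pM2r ?invr_gt0// ltrD2r ltr_pM2r.
    apply/funext => y; congr (_%:E); rewrite /triform /hat; congr (Num.max _ (Num.min _ _)).
      by rewrite /a; field; rewrite gt_eqF.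
    by rewrite /b; field; rewrite gt_eqF.
  - rewrite w0 normr0 expr0n/= mulr0 mul0r mulr0.
    rewrite integral0_eq// => y _.
    by rewrite /triform expr0n/= !mulr0 subrr !mulr0 minxx maxxx.
apply: (@le_trans _ _ (\int[N]_x ((c * al ^+ 3)%:E * (`|x| ^+ 3)%:E))).
  apply: ge0_le_integral => //.
  - by move=> x _; apply: integral_ge0 => y _; rewrite lee_fin triform_ge0.
  - apply: (@measurable_fun_fubini_tonelli_F _ _ _ _ _ N
      (fun z => (triform e f g k (be * z.1 + ga * z.2) (al * z.1))%:E)); last first.
      by move=> z; rewrite lee_fin triform_ge0.
    apply/measurable_EFinP.
    apply: (measurableT_comp (f := fun z : R * R => triform e f g k z.1 z.2)
      (g := fun z : R * R => (be * z.1 + ga * z.2, al * z.1)%R)).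
      exact: measurable_triform.
    apply: measurable_fun_pair => //=; last exact: measurable_funM.
    by apply: measurable_funD; exact: measurable_funM.
  - apply: emeasurable_funM => //; apply/measurable_EFinP.
    by apply: measurable_funX; exact: normr_measurable.
  - by move=> x _; exact: inner.
rewrite ge0_integralZl//; last 2 first.
- by apply/measurable_EFinP; apply: measurable_funX; exact: normr_measurable.
- by rewrite lee_fin mulr_ge0// exprn_ge0.
rewrite integral_normal_cube -EFinM lee_fin /c.
by rewrite le_eqVlt; apply/orP; left; apply/eqP; field; rewrite gt_eqF.
Qed.

End Triangle.

(** * Absorbing a third normal variable by rotations *)

Section Rotation3.
Context {R : realType}.
Local Open Scope ereal_scope.
Notation N := (@normal_prob R 0 1).

(** The rotation that sends (a, b) onto the first axis. *)
Lemma givens (a b : R) : (0 <= a)%R -> exists c s : R,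
  [/\ (0 <= c)%R, (c ^+ 2 + s ^+ 2 = 1)%R,
      (a * c + b * s = Num.sqrt (a ^+ 2 + b ^+ 2))%R & (b * c = a * s)%R].
Proof.
move=> a0; set r := Num.sqrt _.
have r2 : (r ^+ 2 = a ^+ 2 + b ^+ 2)%R by rewrite sqr_sqrtr// addr_ge0// sqr_ge0.
have r0 : (0 <= r)%R by exact: sqrtr_ge0.
have [re|rn] := eqVneq r 0%R.
  rewrite re expr0n/= in r2; have /eqP := esym r2.
  rewrite paddr_eq0 ?sqr_ge0// !sqrf_eq0 => /andP[/eqP -> /eqP ->].
  by exists 1%R, 0%R; split; rewrite ?re//; ring.
exists (a / r)%R, (b / r)%R; split.
- by rewrite divr_ge0.
- by rewrite !exprMn -mulrDl -r2 exprVn divff// expf_neq0.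
- by rewrite !mulrA -mulrDl -!expr2 -r2 expr2 mulfK.
- by ring.
Qed.

Let measurable_affine3 (g : R * R -> \bar R) (a b c d e f : R) : measurable_fun setT g ->
  measurable_fun setT (fun z : (R * R) * R =>
    g (a * z.1.1 + b * z.1.2 + c * z.2, d * z.1.1 + e * z.1.2 + f * z.2)%R).
Proof.
move=> mg; have m1 : measurable_fun setT (fun z : (R * R) * R => z.1.1) by exact: measurableT_comp.
have m2 : measurable_fun setT (fun z : (R * R) * R => z.1.2) by exact: measurableT_comp.
apply: (measurableT_comp mg); apply: measurable_fun_pair => /=.
  by apply: measurable_funD; [apply: measurable_funD|]; apply: measurable_funM.
by apply: measurable_funD; [apply: measurable_funD|]; apply: measurable_funM.
Qed.

Let measurable_affine2 (g : R * R -> \bar R) (a b c d e f : R) : measurable_fun setT g ->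
  measurable_fun setT (fun z : R * R =>
    g (a * z.1 + b * z.2 + c, d * z.1 + e * z.2 + f)%R).
Proof.
move=> mg; apply: (measurableT_comp mg); apply: measurable_fun_pair => /=.
  by apply: measurable_funD => //; apply: measurable_funD; apply: measurable_funM.
by apply: measurable_funD => //; apply: measurable_funD; apply: measurable_funM.
Qed.

(** One step of an incremental triangular factorisation. A first rotation, of variables 1 and 3,
    clears [p]; a second one, of variables 2 and 3, clears the new coefficient [q'], after which the
    third variable integrates to 1. The identities record how the Gram matrix grows. *)
Lemma normal3_reduction (al be ga p q : R) : (0 <= al)%R -> (0 <= ga)%R ->
  exists al' be' ga' : R,
  [/\ (0 <= al')%R, (0 <= ga')%R, (al' ^+ 2 = al ^+ 2 + p ^+ 2)%R,
      (al' * be' = al * be + p * q)%R &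
      (be' ^+ 2 + ga' ^+ 2 = be ^+ 2 + ga ^+ 2 + q ^+ 2)%R] /\
  forall g : R * R -> \bar R, measurable_fun setT g -> (forall z, 0 <= g z) ->
  normal2 (fun z => \int[N]_y g (be * z.1 + ga * z.2 + q * y, al * z.1 + p * y)%R) =
  normal2 (fun z => g (be' * z.1 + ga' * z.2, al' * z.1)%R).
Proof.
move=> al0 ga0; have [c [s [c0 cs acbs bcas]]] := givens p al0.
set al' := Num.sqrt _ in acbs.
pose be' := (be * c + q * s)%R; pose q' := (q * c - be * s)%R.
have [c2 [s2 [c20 cs2 acbs2 bcas2]]] := givens q' ga0.
set ga' := Num.sqrt _ in acbs2.
have al2 : (al' ^+ 2 = al ^+ 2 + p ^+ 2)%R by rewrite sqr_sqrtr// addr_ge0// sqr_ge0.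
have ga2 : (ga' ^+ 2 = ga ^+ 2 + q' ^+ 2)%R by rewrite sqr_sqrtr// addr_ge0// sqr_ge0.
have alc : (al' * c = al)%R.
  by rewrite -acbs -[RHS]mulr1 -cs mulrDl -mulrA [(p * s * c)%R]mulrAC bcas; ring.
have als : (al' * s = p)%R.
  by rewrite -acbs -[RHS]mulr1 -cs mulrDl [(al * c * s)%R]mulrAC -bcas; ring.
exists al', be', ga'; split.
  split; rewrite ?sqrtr_ge0//.
    have -> : (al' * be' = (al' * c) * be + (al' * s) * q)%R by rewrite /be'; ring.
    by rewrite alc als.
  have -> : (be ^+ 2 + ga ^+ 2 + q ^+ 2 = (c ^+ 2 + s ^+ 2) * (be ^+ 2 + q ^+ 2) + ga ^+ 2)%R by rewrite cs; ring.
  by rewrite ga2 /be' /q'; ring.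
move=> g mg g0.
pose F (z : R * R) := \int[N]_y g (be * z.1 + ga * z.2 + q * y, al * z.1 + p * y)%R.
have mF : measurable_fun setT F.
  apply: (@measurable_fun_fubini_tonelli_F _ _ _ _ _ N
    (fun z => g (be * z.1.1 + ga * z.1.2 + q * z.2, al * z.1.1 + p * z.2)%R)) => //.
  have := measurable_affine3 be ga q al 0 p mg.
  by apply: eq_measurable_fun => z _; rewrite mul0r addr0.
have F0 z : 0 <= F z by exact: integral_ge0.
pose K (z : R * R) := \int[N]_y g (be' * z.1 + ga * z.2 + q' * y, al' * z.1)%R.
have mK : measurable_fun setT K.
  apply: (@measurable_fun_fubini_tonelli_F _ _ _ _ _ N
    (fun z => g (be' * z.1.1 + ga * z.1.2 + q' * z.2, al' * z.1.1)%R)) => //.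
  have := measurable_affine3 be' ga q' al' 0 0 mg.
  by apply: eq_measurable_fun => z _; rewrite !mul0r !addr0.
have K0 z : 0 <= K z by exact: integral_ge0.
(* [K] is the integrand after the first rotation; Tonelli brings the pair to be rotated
   innermost. *)
transitivity (normal2 K).
  rewrite /normal2 (@fubini_tonelli _ _ _ _ _ N N F mF F0) (@fubini_tonelli _ _ _ _ _ N N K mK K0).
  apply: eq_integral => y _.
  have mG : measurable_fun setT (fun z : R * R =>
      g (be * z.1 + ga * y + q * z.2, al * z.1 + p * z.2)%R).
    have := measurable_affine2 be q (ga * y) al p 0 mg.
    by apply: eq_measurable_fun => z _; rewrite addr0 addrAC.
  have := @normal2_rotation R c (- s) _ c0 _ mG (fun z => g0 _).
  rewrite sqrrN => /(_ cs) rot.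
  rewrite -[LHS]/(normal2 (fun z : R * R =>
      g (be * z.1 + ga * y + q * z.2, al * z.1 + p * z.2)%R)) -rot.
  apply: eq_integral => x _; apply: eq_integral => t _ /=.
  have e1 : (al' * x = al * (c * x + - s * t) + p * (c * t - - s * x))%R.
    rewrite -acbs; have -> : (p * (c * t - - s * x) = (p * c) * t + p * s * x)%R by ring.
    by rewrite bcas; ring.
  by rewrite e1 /be' /q'; congr (g (_, _)); ring.
apply: eq_integral => x _.
have mG : measurable_fun setT (fun z : R * R =>
    g (be' * x + ga * z.1 + q' * z.2, al' * x)%R).
  have := measurable_affine2 ga q' (be' * x) 0 0 (al' * x) mg.
  by apply: eq_measurable_fun => z _; rewrite !mul0r !add0r addrC addrA.
have := @normal2_rotation R c2 (- s2) _ c20 _ mG (fun z => g0 _).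
rewrite sqrrN => /(_ cs2) rot.
rewrite -[LHS]/(normal2 (fun z : R * R =>
    g (be' * x + ga * z.1 + q' * z.2, al' * x)%R)) -rot.
apply: eq_integral => y _.
rewrite (eq_integral (fun=> g (be' * x + ga' * y, al' * x)%R)).
  by rewrite integral_cst//= probability_setT mule1.
move=> t _ /=; congr (g (_, _)); rewrite -acbs2.
have -> : (q' * (c2 * t - - s2 * y) = (q' * c2) * t + q' * s2 * y)%R by ring.
by rewrite bcas2; ring.
Qed.

End Rotation3.

Section MeasurableCoordinates.
Context {R : realType} {n : nat}.

Lemma measurable_coord (j : 'I_n) :
  measurable_fun setT (fun v : borelV R n => (v : 'cV[R]_n) j 0).
Proof.
apply: (measurability _ (RGenOpens.measurableE R)).
move=> _ [_ [a [b ->] <-]]; rewrite setTI; apply: sub_sigma_algebra.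
by apply: open_comp; [move=> v _; exact: coord_continuous | exact: interval_open].
Qed.

Lemma measurable_dotv (y : 'cV[R]_n) :
  measurable_fun setT (fun v : borelV R n => dotv (v : 'cV[R]_n) y).
Proof.
rewrite (_ : (fun v => _) = fun v : borelV R n => \sum_(j < n) ((v : 'cV[R]_n) j 0 * y j 0)%R).
  by apply: measurable_sum => j; apply: measurable_funM => //; exact: measurable_coord.
by apply/funext => v; rewrite /dotv mxE; apply: eq_bigr => j _; rewrite mxE.
Qed.

End MeasurableCoordinates.

Section GaussianVector.
Local Open Scope ereal_scope.

Section Joint.
Context d (T : measurableType d) (R : realType) (P : probability T R).
Context d1 d2 (T1 : measurableType d1) (T2 : measurableType d2).
Variables (nu1 : probability T1 R) (nu2 : probability T2 R).
Variables (E : set T) (X : T -> T1) (Y : T -> T2) (c : {nonneg R}).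
Hypotheses (mE : measurable E) (mX : measurable_fun setT X) (mY : measurable_fun setT Y).
Hypothesis XY : forall A B, measurable A -> measurable B ->
  P [set w | [/\ A (X w), B (Y w) & E w]] = c%:num%:E * (nu1 A * nu2 B).

(** Extends the product formula from rectangles, a pi-system, to all nonnegative measurable
    functions. [E] and [c] carry the boxes on coordinates not yet integrated. *)
Lemma ge0_integral_joint (g : T1 * T2 -> \bar R) : measurable_fun setT g ->
  (forall z, 0 <= g z) ->
  \int[P]_w ((\1_E w)%:E * g (X w, Y w)) =
  c%:num%:E * \int[nu1]_x \int[nu2]_y g (x, y).
Proof.
move=> mg g0.
have mXY : measurable_fun setT (fun w => (X w, Y w)) by exact: measurable_fun_pair.
rewrite (@ge0_integral_weighted _ _ _ _ R P (mscale c (nu1 \x nu2)) (\1_E) (fun w => (X w, Y w)))//.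
- rewrite ge0_integral_mscale//; congr (_ * _).
  by rewrite fubini_tonelli1.
move=> B mB.
transitivity (pushforward (mrestr P mE) (fun w => (X w, Y w)) B).
  rewrite /pushforward /mrestr.
  have mXB : measurable ((fun w => (X w, Y w)) @^-1` B).
    by rewrite -[X in measurable X]setTI; exact: mXY.
  rewrite -[X in _ = P X]setIT -integral_indic//; last exact: measurableI.
  apply: eq_integral => w _; rewrite -EFinM; congr (_%:E).
  by rewrite indicI /= mulrC.
pose C : set (set (T1 * T2)) :=
  [set C | exists A, measurable A /\ exists B, measurable B /\ C = A `*` B].
have CI : setI_closed C.
  move=> /= _ _ [X1 [mX1 [X2 [mX2 ->]]]] [Y1 [mY1 [Y2 [mY2 ->]]]].
  rewrite -setXI; exists (X1 `&` Y1); split; first exact: measurableI.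
  by exists (X2 `&` Y2); split => //; exact: measurableI.
have rect A : C A -> pushforward (mrestr P mE) (fun w => (X w, Y w)) A =
    mscale c (nu1 \x nu2) A.
  move=> [A1 [mA1 [A2 [mA2 ->]]]].
  rewrite /mscale /= product_measure1E// -XY// /pushforward /mrestr.
  by congr (P _); apply/seteqP; split => [w [[/= ? ?] ?]|w [? ? ?]].
apply: (measure_unique C (fun=> setT)) => //.
- rewrite measurable_prod_measurableType //; congr (<<s _ >>).
  rewrite predeqE; split => [[A mA [B' mB' <-]]|[A [mA [B' [mB' ->]]]]].
    by exists A; split => //; exists B'.
  by exists A => //; exists B'.
- move=> _; exists setT; split => //; exists setT; split => //.
  by rewrite setXTT.
- by rewrite bigcup_const//; exists 0%N.
- move=> _ /=; rewrite /pushforward /mrestr /=.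
  apply: (@le_lt_trans _ _ 1%E); last by rewrite ltry.
  by apply: probability_le1; rewrite preimage_setT setTI.
Qed.
End Joint.

Section Law.
Context {R : realType}.
Notation N := (@normal_prob R 0 1).

(** Packaged as a measurable function so that its image law is a probability, as
    [ge0_integral_joint] asks of [nu1]. *)
Definition lower2 (al be ga : R) (z : measurableTypeR R * measurableTypeR R) : R * R :=
  (be * z.1 + ga * z.2, al * z.1)%R.

Lemma measurable_lower2 al be ga : measurable_fun setT (lower2 al be ga).
Proof.
apply: measurable_fun_pair => /=; last exact: measurable_funM.
by apply: measurable_funD; exact: measurable_funM.
Qed.

HB.instance Definition _ al be ga := isMeasurableFun.Build _ _ _ _
  (lower2 al be ga) (measurable_lower2 al be ga).

Lemma integral_lower2 al be ga (g : R * R -> \bar R) : measurable_fun setT g ->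
  (forall z, 0 <= g z) ->
  \int[distribution (N \x N) (lower2 al be ga)]_z g z =
  normal2 (fun z => g (be * z.1 + ga * z.2, al * z.1)%R).
Proof.
move=> mg g0; rewrite ge0_integral_distribution//.
rewrite fubini_tonelli1//.
  exact: (measurableT_comp mg (measurable_lower2 al be ga)).
by move=> z; exact: g0.
Qed.

Context d (T : measurableType d) (P : probability T R) (n : nat).
Variables (X : {RV P >-> borelV R n}) (y1 y2 : 'cV[R]_n).
Hypothesis gaussX : standard_gaussian X.

Let psum (y z : 'cV[R]_n) (k : nat) : R := (\sum_(j < n | (j < k)%N) y j ord0 * z j ord0)%R.
Let coord (j : 'I_n) (w : T) : R := (X w : 'cV[R]_n) j 0%R.
Let tail (k : nat) (B : 'I_n -> set R) := [set w | forall j : 'I_n, (k <= j)%N -> B j (coord j w)].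

Let measurable_coordX j : measurable_fun setT (coord j).
Proof. by apply: (measurableT_comp (measurable_coord j)). Qed.

Let measurable_tail k B : (forall j, measurable (B j)) -> measurable (tail k B).
Proof.
move=> mB; rewrite (_ : tail k B = \bigcap_(j in [set j : 'I_n | (k <= j)%N]) (coord j @^-1` B j)).
  apply: fin_bigcap_measurable => // j _.
  by rewrite -[X in measurable X]setTI; exact: measurable_coordX.
by apply/seteqP; split.
Qed.

Let psumS y z k (kn : (k < n)%N) :
  psum y z k.+1 = (psum y z k + y (Ordinal kn) ord0 * z (Ordinal kn) ord0)%R.
Proof.
rewrite /psum (bigD1 (Ordinal kn))//= addrC; congr (_ + _)%R.
by apply: eq_bigl => j; rewrite ltnS -val_eqE /= andbC ltn_neqAle.
Qed.

(** [standard_gaussian] speaks of boxes only, so the law of the two inner products is reached one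
    coordinate at a time: the first [k] coordinates enter through partial sums, the others stay
    constrained to boxes. At k = 0 this is the hypothesis on [X]; at k = n the box constraint is
    void. *)
Let partial_law k : (k <= n)%N -> exists al be ga : R,
  [/\ (0 <= al)%R, (0 <= ga)%R, (al ^+ 2 = psum y1 y1 k)%R,
     (al * be = psum y1 y2 k)%R & (be ^+ 2 + ga ^+ 2 = psum y2 y2 k)%R] /\
  forall (g : R * R -> \bar R) B, measurable_fun setT g -> (forall z, 0 <= g z) ->
    (forall j, measurable (B j)) ->
  \int[P]_w ((\1_(tail k B) w)%:E * g (psum (X w) y2 k, psum (X w) y1 k)) =
  (\prod_(j < n | (k <= j)%N) fine (N (B j)))%:E *
    normal2 (fun z => g (be * z.1 + ga * z.2, al * z.1)%R).
Proof.
elim: k => [|k IH] kn.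
  exists 0%R, 0%R, 0%R; split.
    by rewrite /psum !big_pred0//; split => //; ring.
  move=> g B mg g0 mB.
  have ps y z : psum y z 0 = 0%R by rewrite /psum big_pred0.
  rewrite (_ : normal2 _ = g (0, 0)%R); last first.
    transitivity (\int[N]_x \int[N]_y (cst (g (0, 0)%R)) y).
      by apply: eq_integral => x _; apply: eq_integral => y _ /=; rewrite !mul0r addr0.
    have cN (c : \bar R) : \int[N]_x (cst c x) = c.
      by rewrite integral_cst//= probability_setT mule1.
    by rewrite -[RHS]cN; apply: eq_integral => x _; rewrite cN.
  under eq_integral do rewrite !ps.
  rewrite ge0_integralZr//; last first.
    by apply/measurable_EFinP; apply: measurable_indic; exact: measurable_tail.
  congr (_ * _).
  rewrite integral_indic// ?setIT; last exact: measurable_tail.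
  transitivity (P [set w | forall j, B j ((X w : 'cV[R]_n) j 0%R)]).
    by congr (P _); apply/seteqP; split => w /= h j; [apply: h|move=> _; apply: h].
  rewrite gaussX// (big_morph EFin (@EFinM R) erefl).
  by apply: eq_big => [j|j _]; rewrite ?leq0n// fineK// fin_num_measure//; exact: mB.
have {IH} [al [be [ga [[al0 ga0 al2 albe bega] IH]]]] := IH (ltnW kn).
pose i := Ordinal kn.
have [al' [be' [ga' [[al0' ga0' al2' albe' bega'] red]]]] :=
  @normal3_reduction R al be ga (y1 i ord0) (y2 i ord0) al0 ga0.
exists al', be', ga'; split.
  rewrite !psumS; split => //.
  - by rewrite al2' al2 expr2.
  - by rewrite albe' albe.
  - by rewrite bega' bega expr2.
move=> g B mg g0 mB.
have mS y : measurable_fun setT (fun w => psum (X w) y k).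
  rewrite (_ : (fun w => _) = fun w =>
      (\sum_(j < n) if (j < k)%N then coord j w * y j ord0 else 0)%R); last first.
    by apply/funext => w; rewrite /psum [LHS]big_mkcond.
  apply: measurable_sum => j; case: (j < k)%N => //.
  by apply: measurable_funM => //; exact: measurable_coordX.
have mSS : measurable_fun setT (fun w => (psum (X w) y2 k, psum (X w) y1 k)).
  exact: measurable_fun_pair.
have c0 : (0 <= \prod_(j < n | (k.+1 <= j)%N) fine (N (B j)))%R.
  by apply: prodr_ge0 => j _; exact: fine_ge0.
pose g' (z : (R * R) * R) := g (z.1.1 + y2 i ord0 * z.2, z.1.2 + y1 i ord0 * z.2)%R.
have mg' : measurable_fun setT g'.
  apply: (measurableT_comp mg); apply: measurable_fun_pair => /=.
    apply: measurable_funD; first exact: measurableT_comp.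
    exact: measurable_funM.
  apply: measurable_funD; first exact: measurableT_comp.
  exact: measurable_funM.
have g'0 z : 0 <= g' z by exact: g0.
rewrite -red//.
transitivity (\int[P]_w ((\1_(tail k.+1 B) w)%:E *
    g' ((psum (X w) y2 k, psum (X w) y1 k), coord i w))).
  by apply: eq_integral => w _; rewrite !psumS /g' /= ![(coord i w * _)%R]mulrC !(mulrC (y2 _ _)) !(mulrC (y1 _ _)).
rewrite (@ge0_integral_joint _ T R P _ _ _ _ (distribution (N \x N) (lower2 al be ga)) N
  (tail k.+1 B) _ _ (NngNum c0) (measurable_tail _ mB) mSS (measurable_coordX i) _ g' mg' g'0); last first.
  move=> A B' mA mB'.
  (* The induction hypothesis with [B'] in slot [i] yields the joint law of the partial sums and of
     coordinate [i]. *)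
  pose B2 j := if j == i then B' else B j.
  have mB2 j : measurable (B2 j) by rewrite /B2; case: ifP => _; [exact: mB'|exact: mB].
  have mA1 : measurable_fun setT (fun z => (\1_A z : R)%:E).
    by apply/measurable_EFinP; exact: measurable_indic.
  have A0 z : 0 <= (\1_A z : R)%:E by rewrite lee_fin.
  have := IH _ B2 mA1 A0 mB2.
  rewrite (bigD1 i)//= -(integral_lower2 _ _ _ mA1 A0) integral_indic// setIT.
  rewrite /B2 eqxx (eq_bigr (fun j => fine (N (B j)))); last first.
    by move=> j /andP[_ /negbTE ->].
  rewrite (eq_bigl (fun j : 'I_n => (k.+1 <= j)%N)); last first.
    by move=> j; rewrite -val_eqE /= ltn_neqAle eq_sym andbC.
  rewrite EFinM fineK ?fin_num_measure// [X in _ = X](_ : _ =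
    (\prod_(j < n | (k < j)%N) fine (N (B j)))%:E * (distribution (N \x N) (lower2 al be ga) A * N B')); last first.
    by rewrite -muleA muleCA; congr (_ * _); rewrite muleC.
  move=> <-.
  have mtl := measurable_tail k mB2.
  have mpre : measurable ((fun w => (psum (X w) y2 k, psum (X w) y1 k)) @^-1` A).
    by rewrite -[X in measurable X]setTI; exact: mSS.
  transitivity (P (tail k B2 `&` ((fun w => (psum (X w) y2 k, psum (X w) y1 k)) @^-1` A))).
    congr (P _); apply/seteqP; split => w.
      move=> [Aw Bw tw]; split => // j; rewrite leq_eqVlt /B2 => /predU1P[kj|kj].
        by rewrite (_ : j = i) ?eqxx//; apply: val_inj.
      by rewrite ifF; [exact: tw|apply/negbTE; rewrite -val_eqE /= gtn_eqF].
    move=> [tw Aw]; split => //.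
      by have := tw i (leqnn _); rewrite /B2 eqxx.
    move=> j kj; have := tw j (ltnW kj); rewrite /B2 ifF//.
    by apply/negbTE; rewrite -val_eqE /= gtn_eqF.
  rewrite -[X in P X]setIT -integral_indic//; last exact: measurableI.
  by apply: eq_integral => w _; rewrite indicI -EFinM.
congr (_ * _).
pose H z := \int[N]_y g' (z, y).
have mH : measurable_fun setT H.
  exact: (@measurable_fun_fubini_tonelli_F _ _ _ _ _ N g').
rewrite -[LHS]/(\int[distribution (N \x N) (lower2 al be ga)]_z H z).
rewrite integral_lower2//.
by move=> z; exact: integral_ge0.
Qed.

(** This is the Cholesky factor of the Gram matrix of [y1] and [y2]. The first variable alone drives
    the product with [y1], so integrating the second one innermost amounts to conditioning on that
    product. *)
Lemma gaussian_law : exists al be ga : R,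
  [/\ (0 <= al)%R, (0 <= ga)%R, (al ^+ 2 = dotv y1 y1)%R,
     (al * be = dotv y1 y2)%R & (be ^+ 2 + ga ^+ 2 = dotv y2 y2)%R] /\
  forall g : R * R -> \bar R, measurable_fun setT g -> (forall z, 0 <= g z) ->
  \int[P]_w g (dotv (X w) y2, dotv (X w) y1) =
  normal2 (fun z => g (be * z.1 + ga * z.2, al * z.1)%R).
Proof.
have dE y z : psum y z n = dotv y z.
  rewrite /psum /dotv mxE; under eq_bigl do rewrite ltn_ord.
  by apply: eq_bigr => j _; rewrite mxE.
have [al [be [ga [[h1 h2 h3 h4 h5] law]]]] := partial_law (leqnn n).
exists al, be, ga; split; first by rewrite -!dE.
move=> g mg g0; have := law g (fun=> setT) mg g0 (fun=> measurableT).
rewrite big_pred0 ?mul1e; last by move=> j; rewrite leqNgt ltn_ord.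
move=> <-; apply: eq_integral => w _; rewrite !dE indicE mem_set ?mul1e//.
Qed.

End Law.
End GaussianVector.

(** * Gaussian vectors and concentration *)

Section IndependentProduct.
Local Open Scope ereal_scope.
Context {R : realType} d (T : measurableType d) (P : probability T R).
Context d' (T' : measurableType d') (m : nat).
Variables (X : 'I_m -> {RV P >-> T'}) (g : T' -> R) (M : R).
Hypotheses (indX : mutually_independent X) (mg : measurable_fun setT g).
Hypothesis g0 : forall y, (0 <= g y)%R.
Hypothesis gM : forall i, \int[P]_w (g (X i w))%:E <= M%:E.

Let e (i : 'I_m) : R := fine (\int[P]_w (g (X i w))%:E).

Let eE i : (e i)%:E = \int[P]_w (g (X i w))%:E.
Proof.
rewrite /e fineK// ge0_fin_numE; last by apply: integral_ge0 => w _; rewrite lee_fin.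
by rewrite (le_lt_trans (gM i))// ltry.
Qed.

Let tail (k : nat) (B : 'I_m -> set T') := [set w | forall i : 'I_m, (k <= i)%N -> B i (X i w)].

Let measurable_tail k B : (forall i, measurable (B i)) -> measurable (tail k B).
Proof.
move=> mB; rewrite (_ : tail k B = \bigcap_(i in [set i : 'I_m | (k <= i)%N]) (X i @^-1` B i)).
  apply: fin_bigcap_measurable => // i _.
  by rewrite -[X in measurable X]setTI; exact: measurable_funP.
by apply/seteqP; split.
Qed.

Let head (k : nat) (w : T) : R := (\prod_(i < m | (i < k)%N) g (X i w))%R.

Let head_ge0 k w : (0 <= head k w)%R.
Proof. by apply: prodr_ge0 => i _; exact: g0. Qed.

Let mgX i : measurable_fun setT (fun w => g (X i w)).
Proof. exact: measurableT_comp. Qed.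

Let measurable_head k : measurable_fun setT (head k).
Proof.
rewrite (_ : head k = fun w => (\prod_(i < m) if (i < k)%N then g (X i w) else 1)%R).
  by apply: measurable_prod => i _; case: (i < k)%N.
by apply/funext => w; rewrite /head [LHS]big_mkcond.
Qed.

Let headS k w (km : (k < m)%N) : head k.+1 w = (head k w * g (X (Ordinal km) w))%R.
Proof.
rewrite /head (bigD1 (Ordinal km))//= mulrC; congr (_ * _)%R.
by apply: eq_bigl => j; rewrite ltnS -val_eqE /= andbC ltn_neqAle.
Qed.

(** The scheme of [partial_law] again: independence is given on events, and the factors [g (X i)]
    replace indicators one at a time. *)
Let partial k : (k <= m)%N -> forall B, (forall i, measurable (B i)) ->
  \int[P]_w (head k w * \1_(tail k B) w)%:E =
  ((\prod_(i < m | (i < k)%N) e i) * \prod_(i < m | (k <= i)%N) fine (P (X i @^-1` B i)))%:E.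
Proof.
have mpre i B : measurable B -> measurable (X i @^-1` B).
  by move=> mB; rewrite -[X in measurable X]setTI; exact: measurable_funP.
elim: k => [|k IH] km B mB.
  rewrite big_pred0// mul1r.
  transitivity (P (tail 0 B)).
    rewrite -[X in P X]setIT -integral_indic//; last exact: measurable_tail.
    by apply: eq_integral => w _; rewrite /head big_pred0// mul1r.
  transitivity (P [set w | forall i, i \in [set: 'I_m]%SET -> B i (X i w)]).
    by congr (P _); apply/seteqP; split => w /= h i; [move=> _; exact: h|move=> _; apply: h; rewrite finset.in_setT].
  rewrite indX// (big_morph EFin (@EFinM R) erefl).
  apply: eq_big => [i|i _]; rewrite ?finset.in_setT// fineK// fin_num_measure//.
  exact: mpre.
pose i := Ordinal km.
have c0 : (0 <= (\prod_(i < m | (i < k)%N) e i) * \prod_(i < m | (k.+1 <= i)%N) fine (P (X i @^-1` B i)))%R.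
  rewrite mulr_ge0// prodr_ge0// => j _; rewrite fine_ge0//.
  by apply: integral_ge0 => w _; rewrite lee_fin.
have mF : measurable_fun setT (fun w => head k w * \1_(tail k.+1 B) w)%R.
  apply: measurable_funM => //; apply: measurable_indic; exact: measurable_tail.
have F0 w : (0 <= head k w * \1_(tail k.+1 B) w)%R by rewrite mulr_ge0.
have mgE : measurable_fun setT (EFin \o g) by exact/measurable_EFinP.
have FX C : measurable C ->
    \int[P]_w ((head k w * \1_(tail k.+1 B) w)%:E * (\1_C (X i w))%:E) =
    mscale (NngNum c0) (distribution P (X i)) C.
  move=> mC; pose B2 j := if j == i then C else B j.
  have mB2 j : measurable (B2 j) by rewrite /B2; case: ifP.
  transitivity (\int[P]_w (head k w * \1_(tail k B2) w)%:E).
    apply: eq_integral => w _; rewrite -EFinM -mulrA; congr (_ * _)%:E.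
    have -> : tail k B2 = tail k.+1 B `&` (X i @^-1` C).
      apply/seteqP; split => v /=.
        move=> tw; split; last by have := tw i (leqnn _); rewrite /B2 eqxx.
        move=> j kj; have := tw j (ltnW kj); rewrite /B2 ifF//.
        by apply/negbTE; rewrite -val_eqE /= gtn_eqF.
      move=> [tw Cw] j; rewrite leq_eqVlt /B2 => /predU1P[kj|kj].
        by rewrite (_ : j = i) ?eqxx//; apply: val_inj.
      by rewrite ifF; [exact: tw|apply/negbTE; rewrite -val_eqE /= gtn_eqF].
    by rewrite indicI.
  rewrite (IH (ltnW km))//.
  have -> : (\prod_(j < m | (k <= j)%N) fine (P (X j @^-1` B2 j)) =
      fine (P (X i @^-1` C)) * \prod_(j < m | (k < j)%N) fine (P (X j @^-1` B j)))%R.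
    rewrite (bigD1 i)//= {1}/B2 eqxx; congr (_ * _)%R.
    apply: eq_big => [j|j /andP[_ /negbTE ji]]; last by rewrite /B2 ji.
    by rewrite -val_eqE /= [RHS]ltn_neqAle eq_sym andbC.
  rewrite mulrCA mulrC EFinM fineK//.
  by rewrite fin_num_measure//; exact: mpre.
have mXi : measurable_fun setT (X i) by exact: measurable_funP.
have gE0 y : 0 <= (EFin \o g) y by rewrite lee_fin.
have := @ge0_integral_weighted _ _ _ _ R P _ _ (X i) mF F0 mXi FX _ mgE gE0.
rewrite ge0_integral_mscale// ge0_integral_distribution// -eE => h.
transitivity (\int[P]_w ((head k w * \1_(tail k.+1 B) w)%:E * (EFin \o g) (X i w))).
  by apply: eq_integral => w _; rewrite headS -EFinM; congr (_%:E); rewrite mulrAC.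
rewrite h.
rewrite -EFinM; congr (_%:E); rewrite /= [in RHS](bigD1 i)//=.
rewrite mulrC mulrA; congr (_ * _ * _)%R.
by apply: eq_bigl => j; rewrite ltnS -val_eqE /= andbC ltn_neqAle.
Qed.

Lemma integral_prod_le : \int[P]_w (\prod_(i < m) g (X i w))%:E <= (M ^+ m)%:E.
Proof.
have := partial (leqnn m) (fun=> measurableT).
rewrite [X in (_ * X)%:E]big_pred0 ?mulr1; last by move=> j; rewrite leqNgt ltn_ord.
under [in X in _ = X]eq_bigl do rewrite ltn_ord.
move=> h; rewrite (_ : \int[P]_w _ = (\prod_(i < m) e i)%:E).
  rewrite lee_fin -[m in leRHS]card_ord -prodr_const.
  apply: ler_prod => i _; rewrite -!lee_fin eE gM andbT.
  by apply: integral_ge0 => w _; rewrite lee_fin.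
rewrite -h; apply: eq_integral => w _; rewrite /head indicE mem_set ?mulr1//.
by congr (_%:E); apply: eq_bigl => j; rewrite ltn_ord.
Qed.

End IndependentProduct.

Section Chernoff.
Local Open Scope ereal_scope.
Context {R : realType} d (T : measurableType d) (P : probability T R).
Context d' (T' : measurableType d') (m : nat).
Variables (X : 'I_m -> {RV P >-> T'}) (f : T' -> R).
Hypotheses (indX : mutually_independent X) (mf : measurable_fun setT f).

(** Exponential Markov inequality. Measurability is part of the conclusion because the events enter
    a union bound over a net. *)
Lemma chernoff_sum (l M t : R) : (0 < l)%R ->
  (forall i, \int[P]_w (expR (l * f (X i w)))%:E <= (expR M)%:E) ->
  measurable [set w | (t * m%:R <= \sum_(i < m) f (X i w))%R] /\
  P [set w | (t * m%:R <= \sum_(i < m) f (X i w))%R] <= (expR ((M - l * t) * m%:R))%:E.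
Proof.
move=> l0 hM.
have msum : measurable_fun setT (fun w => \sum_(i < m) f (X i w))%R.
  by apply: measurable_sum => i; exact: measurableT_comp.
have mA : measurable [set w | (t * m%:R <= \sum_(i < m) f (X i w))%R].
  rewrite (_ : [set w | _] = (fun w => \sum_(i < m) f (X i w))%R @^-1` `[(t * m%:R)%R, +oo[%classic).
    by rewrite -[X in measurable X]setTI; exact: msum.
  by apply/seteqP; split => w /=; rewrite in_itv/= andbT.
split => //; set A := [set w | _] in mA *.
have mg : measurable_fun setT (fun y => expR (l * f y)).
  by apply: measurableT_comp => //; exact: measurable_funM.
have := @integral_prod_le R d T P d' T' m X (fun y => expR (l * f y)) (expR M) indX mg (fun y => expR_ge0 _) hM.
rewrite -[X in _ <= X%:E -> _]expRM_natr => h.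
have -> : ((M - l * t) * m%:R = M * m%:R - l * (t * m%:R))%R by ring.
rewrite expRB EFinM lee_pdivlMr ?expR_gt0//.
apply: le_trans h; rewrite muleC -[X in P X]setIT -integral_indic// -ge0_integralZl//; last first.
  by apply/measurable_EFinP; exact: measurable_indic.
apply: ge0_le_integral => //.
- by apply: emeasurable_funM => //; apply/measurable_EFinP; exact: measurable_indic.
- apply/measurable_EFinP; apply: measurable_prod => i _.
  exact: (measurableT_comp mg).
move=> w _; rewrite -EFinM lee_fin indicE -expR_sum -mulr_sumr.
have [|] := boolP (w \in A); last by rewrite mulr0 expR_ge0.
by rewrite inE /A /= mulr1 ler_expR ler_pM2l.
Qed.

End Chernoff.

Section DotProduct.
Context {R : realType} {n : nat}.
Implicit Types u v w : 'cV[R]_n.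

Lemma dotvE u v : dotv u v = \sum_(j < n) u j 0 * v j 0.
Proof. by rewrite /dotv mxE; apply: eq_bigr => j _; rewrite mxE. Qed.

Lemma dotvC u v : dotv u v = dotv v u.
Proof. by rewrite !dotvE; apply: eq_bigr => j _; rewrite mulrC. Qed.

Lemma dotvDr u v w : dotv u (v + w) = dotv u v + dotv u w.
Proof. by rewrite /dotv mulmxDr mxE. Qed.

Lemma dotvNr u v : dotv u (- v) = - dotv u v.
Proof. by rewrite /dotv mulmxN mxE. Qed.

Lemma dotvBr u v w : dotv u (v - w) = dotv u v - dotv u w.
Proof. by rewrite dotvDr dotvNr. Qed.

Lemma dotvZr c u v : dotv u (c *: v) = c * dotv u v.
Proof. by rewrite /dotv -scalemxAr mxE. Qed.

Lemma dotvDl u v w : dotv (u + v) w = dotv u w + dotv v w.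
Proof. by rewrite dotvC dotvDr !(dotvC w). Qed.

Lemma dotvNl u v : dotv (- u) v = - dotv u v.
Proof. by rewrite dotvC dotvNr dotvC. Qed.

Lemma dotvBl u v w : dotv (u - v) w = dotv u w - dotv v w.
Proof. by rewrite dotvDl dotvNl. Qed.

Lemma dotvZl c u v : dotv (c *: u) v = c * dotv u v.
Proof. by rewrite dotvC dotvZr dotvC. Qed.

Lemma dotv_sumr u (I : finType) (F : I -> 'cV[R]_n) :
  dotv u (\sum_i F i) = \sum_i dotv u (F i).
Proof. by rewrite /dotv mulmx_sumr summxE. Qed.

Lemma dotvv_ge0 u : 0 <= dotv u u.
Proof. by rewrite dotvE sumr_ge0// => j _; rewrite -expr2 sqr_ge0. Qed.

Lemma dotvv_eq0 u : (dotv u u == 0) = (u == 0).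
Proof.
apply/idP/eqP => [|->]; last by rewrite /dotv mulmx0 mxE.
rewrite dotvE psumr_eq0 => [/allP u0|j _]; last by rewrite -expr2 sqr_ge0.
apply/colP => j; rewrite mxE; apply/eqP.
by have := u0 j (mem_index_enum _); rewrite -expr2 sqrf_eq0.
Qed.

Lemma dotv_cauchy u v : dotv u v ^+ 2 <= dotv u u * dotv v v.
Proof.
have [/eqP v0|v0] := eqVneq (dotv v v) 0.
  rewrite dotvv_eq0 in v0; rewrite (eqP v0) /dotv !mulmx0 mxE expr0n.
  by rewrite mulr0.
have vp : 0 < dotv v v by rewrite lt_def v0 dotvv_ge0.
(* The squared norm of this vector is [dotv v v] times the gap in the inequality. *)
have := dotvv_ge0 (dotv v v *: u - dotv u v *: v).
rewrite dotvBl !dotvBr !dotvZl !dotvZr (dotvC v u) => h.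
rewrite -subr_ge0 -(pmulr_rge0 _ vp); apply: le_trans h _.
by rewrite le_eqVlt; apply/orP; left; apply/eqP; ring.
Qed.

Lemma enorm_ge0 u : 0 <= enorm u.
Proof. exact: sqrtr_ge0. Qed.

Lemma sqr_enorm u : enorm u ^+ 2 = dotv u u.
Proof. by rewrite sqr_sqrtr// dotvv_ge0. Qed.

End DotProduct.

(** * Nets of the unit ball and union bounds *)

Section Net.
Context {R : realType}.

Section Grid.
Variables (k n : nat).
Hypotheses (k0 : (0 < k)%N) (n0 : (0 < n)%N).

(** Integer vectors as magnitudes and signs; bounded magnitudes make the type finite. Zero has two
    encodings, which can only enlarge the count. *)
Definition grid := {ffun 'I_n -> 'I_(k * n).+1 * bool}.
Definition grid_weight (z : grid) : nat := (\sum_j (z j).1)%N.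
(** With this mesh, n coordinate errors add up to a Euclidean distance of at most 1 / k, and the
    unit ball, whose l1-norms are at most sqrt n, needs integer l1-norms of at most k n. *)
Definition grid_step : R := (k%:R * Num.sqrt n%:R)^-1.
Definition grid_point (z : grid) : 'cV[R]_n :=
  \col_j ((-1) ^+ (z j).2 * (z j).1%:R * grid_step).

Let sn0 : 0 < Num.sqrt (n%:R : R). Proof. by rewrite sqrtr_gt0 ltr0n. Qed.

(* Each integer vector [z] of l1-norm at most [k n] has weight
   [2 ^ (k n - |z|) >= 1], and these weights sum to at most [2 ^ (k n) * 4 ^ n]. *)
Lemma card_grid :
  #|[pred z : grid | (grid_weight z <= k * n)%N]|%:R <= 2 ^+ (k * n) * 4 ^+ n :> R.
Proof.
have geom N : \sum_(i < N) (2^-1 : R) ^+ i <= 2.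
  suff -> : \sum_(i < N) (2^-1 : R) ^+ i = 2 - 2 * 2^-1 ^+ N.
    by rewrite gerBl mulr_ge0// exprn_ge0.
  elim: N => [|N IH]; first by rewrite big_ord0 expr0; ring.
  by rewrite big_ord_recr /= IH exprS; field.
pose F (p : 'I_(k * n).+1 * bool) : R := 2^-1 ^+ p.1.
have F0 p : 0 <= F p by rewrite exprn_ge0.
have sF : \sum_p F p <= 4.
  rewrite -(pair_bigA _ (fun i b => F (i, b))) /=.
  under eq_bigr do rewrite big_bool /F /= -mulr2n.
  rewrite sumrMnl mulr2n; apply: (le_trans (lerD (geom _) (geom _))); lra.
rewrite -sum1_card natr_sum.
apply: (@le_trans _ _ (\sum_(z : grid) 2 ^+ (k * n) * \prod_j F (z j))).
  rewrite big_mkcond /=; apply: ler_sum => z _; case: ifP => [hz|_]; last first.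
    by rewrite mulr_ge0 ?exprn_ge0// prodr_ge0.
  rewrite /F -(big_morph (fun a => (2^-1 : R) ^+ a) (exprD _) (expr0 _)) -/(grid_weight z).
  rewrite exprVn ler_pdivlMr ?exprn_gt0// mul1r.
  by rewrite ler_eXn2l// ltr1n.
rewrite -mulr_sumr ler_wpM2l ?exprn_ge0//.
rewrite -(bigA_distr_bigA (fun (j : 'I_n) p => F p)) -[X in _ <= 4 ^+ X]card_ord -prodr_const.
by apply: ler_prod => j _; rewrite sF sumr_ge0.
Qed.

Lemma sum_norm_le (y : 'cV[R]_n) : dotv y y <= 1 ->
  \sum_j `|y j 0| <= Num.sqrt n%:R.
Proof.
move=> y1; rewrite -[leLHS]ger0_norm ?sumr_ge0// -sqrtr_sqr ler_wsqrtr//.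
pose a : 'cV[R]_n := \col_j `|y j 0|.
have -> : \sum_j `|y j 0| = dotv a (const_mx 1).
  by rewrite dotvE; apply: eq_bigr => j _; rewrite !mxE mulr1.
apply: le_trans (dotv_cauchy _ _) _.
have -> : dotv a a = dotv y y.
  by rewrite !dotvE; apply: eq_bigr => j _; rewrite !mxE -!expr2 real_normK ?num_real.
have -> : dotv (const_mx 1 : 'cV[R]_n) (const_mx 1) = n%:R.
  rewrite dotvE (eq_bigr (fun=> 1)) => [|j _]; last by rewrite !mxE mulr1.
  by rewrite sumr_const card_ord.
by rewrite ler_piMl.
Qed.

(** Rounding towards 0 keeps the norm from growing, so net points inherit [dotv h h <= 1] and all
    bounds that increase with |h|. *)
Lemma grid_dense (y : 'cV[R]_n) : dotv y y <= 1 -> exists z : grid,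
  [/\ (grid_weight z <= k * n)%N, dotv (grid_point z) (grid_point z) <= dotv y y &
      dotv (y - grid_point z) (y - grid_point z) <= (k%:R ^+ 2)^-1].
Proof.
move=> y1.
pose t (j : 'I_n) : R := `|y j 0| * (k%:R * Num.sqrt n%:R).
have t0 j : 0 <= t j by rewrite mulr_ge0// mulr_ge0// ?ler0n// ltW.
pose q j : nat := Num.truncn (t j).
have qle j : (q j)%:R <= t j by rewrite truncn_le.
have qlt j : t j < (q j)%:R + 1 by rewrite natr1 truncnS_gt.
have sq : (\sum_j q j <= k * n)%N.
  rewrite -(ler_nat R) natr_sum; apply: (@le_trans _ _ (\sum_j t j)).
    by apply: ler_sum.
  rewrite -mulr_suml natrM mulrCA -[X in _ <= _ * X](@sqr_sqrtr _ n%:R) ?ler0n//.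
  by rewrite expr2 ler_wpM2l ?ler0n// ler_wpM2r ?sum_norm_le// ltW.
have qk j : (q j < (k * n).+1)%N.
  by rewrite ltnS; apply: leq_trans sq; rewrite (bigD1 j)//= leq_addr.
pose z : grid := [ffun j => (Ordinal (qk j), y j 0 < 0)].
have stepK : (k%:R * Num.sqrt n%:R) * grid_step = 1.
  by rewrite /grid_step divff// gt_eqF// mulr_gt0// ltr0n.
have yt j : `|y j 0| = t j * grid_step by rewrite /t -mulrA stepK mulr1.
have ys j : y j 0 = (-1) ^+ (y j 0 < 0)%R * `|y j 0| by rewrite -realEsign// num_real.
exists z; split.
- by rewrite /grid_weight; under eq_bigr do rewrite ffunE.
- rewrite !dotvE; apply: ler_sum => j _; rewrite mxE ffunE /= -!expr2.
  rewrite !exprMn -signr_odd sqrr_sign mul1r -[leRHS]real_normK ?num_real// yt exprMn.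
  by rewrite ler_wpM2r ?sqr_ge0// ler_sqr ?nnegrE ?ler0n.
rewrite dotvE; apply: (@le_trans _ _ (\sum_(j < n) grid_step ^+ 2)).
  apply: ler_sum => j _; rewrite !mxE ffunE /= -expr2.
  rewrite {1}ys -mulrA -mulrBr yt -mulrBl mulrA -mulrA exprMn.
  rewrite exprMn sqrr_sign mul1r ler_piMl ?sqr_ge0//.
  rewrite expr_le1// ?subr_ge0//.
  by have := qlt j; lra.
rewrite sumr_const card_ord /grid_step -mulr_natl exprVn exprMn sqr_sqrtr ?ler0n//.
have nn : n%:R != 0 :> R by rewrite pnatr_eq0 -lt0n.
have kk : k%:R != 0 :> R by rewrite pnatr_eq0 -lt0n.
by rewrite le_eqVlt; apply/orP; left; apply/eqP; field; rewrite nn kk.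
Qed.

End Grid.

Section NetUnion.
Context d (T : measurableType d) (P : probability T R).

Lemma expR1_ge2 : 2 <= expR 1 :> R.
Proof. by have := expR_ge1Dx (1 : R); lra. Qed.

(** The net has at most 2^((k + 2) n) <= exp ((k + 2) n) points, and the hypothesis on [m] pays for
    them with half of the exponent kap m. *)
Lemma net_union (k n m : nat) (kap : R) (B : 'cV[R]_n -> set T) :
  (0 < k)%N -> (0 < n)%N -> 0 < kap -> (k + 2)%:R * n%:R <= kap / 2 * m%:R ->
  (forall y, dotv y y <= 1 -> measurable (B y) /\
     (P (B y) <= (expR (- kap * m%:R))%:E)%E) ->
  exists E : set T, [/\ measurable E, ((1 - expR (- (kap / 2) * m%:R))%:E <= P E)%E &
    forall w, E w -> forall y, dotv y y <= 1 -> exists y',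
      [/\ dotv y' y' <= dotv y y, dotv (y - y') (y - y') <= (k%:R ^+ 2)^-1 & ~ B y' w]].
Proof.
move=> k0 n0 kap0 hm hB.
pose V := [pred z : grid k n | (grid_weight z <= k * n)%N && (dotv (grid_point z) (grid_point z) <= 1)].
pose bad := \big[setU/set0]_(z | V z) B (grid_point z).
pose r : R := expR (- kap * m%:R).
have [mbad Pbad] : measurable bad /\ (P bad <= (\sum_(z | V z) r)%:E)%E.
  apply: (big_rec2 (fun (A : set T) (s : R) => measurable A /\ (P A <= s%:E)%E)).
    by rewrite measure0.
  move=> z A s /andP[_ z1] [mA PA]; have [mB PB] := hB _ z1.
  split; first exact: measurableU.
  by apply: (le_trans (measureU2 P mB mA)); rewrite EFinD leeD.
exists (~` bad); split; first exact: measurableC.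
- rewrite probability_setC// EFinB leeB//; apply: (le_trans Pbad).
  rewrite lee_fin sumr_const -[leLHS]mulr_natl.
  have cV : #|V|%:R <= expR (kap / 2 * m%:R) :> R.
    apply: (@le_trans _ _ (2 ^+ (k * n) * 4 ^+ n)).
      apply: le_trans (card_grid k n); rewrite ler_nat; apply: subset_leq_card.
      by apply/fintype.subsetP => z; rewrite !inE => /andP[].
    have -> : (4 : R) ^+ n = 2 ^+ (2 * n) by rewrite exprM; congr (_ ^+ _); ring.
    rewrite -exprD -mulnDl; apply: (@le_trans _ _ (expR 1 ^+ ((k + 2) * n))).
      by rewrite lerXn2r ?nnegrE ?expR_ge0 ?expR1_ge2.
    by rewrite -expRM_natr mul1r natrM ler_expR.
  apply: (le_trans (ler_wpM2r (expR_ge0 (- kap * m%:R) : 0 <= r) cV)).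
  by rewrite /r -expRD ler_expR le_eqVlt; apply/orP; left; apply/eqP; field.
- move=> w Ew y y1; have [z [z1 z2 z3]] := grid_dense k0 n0 y1.
  exists (grid_point z); split => // Bw; apply: Ew.
  rewrite /bad (bigD1 z) /=; first by left.
  by rewrite z1 (le_trans z2).
Qed.

End NetUnion.
End Net.

(** * Restricted isometry *)

Section Concentration.
Context {R : realType} d (T : measurableType d) (P : probability T R) (n : nat).

(** With b = dotv y y the left side is (1 - 2 l b)^(-1/2). By [1 + t <= expR t] the claim follows
    from (1 + 2 (l b + 4 l^2)) (1 - 2 l b) >= 1, which holds for |l| <= 1/4 and b <= 1. *)
Lemma mgf_sq (X : {RV P >-> borelV R n}) (y : 'cV[R]_n) (l : R) :
  standard_gaussian X -> dotv y y <= 1 -> `|l| <= 1 / 4 ->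
  (\int[P]_w (expR (l * dotv (X w : 'cV[R]_n) y ^+ 2))%:E <=
   (expR (l * dotv y y + 4 * l ^+ 2))%:E)%E.
Proof.
move=> gX y1 hl; have [al [be [ga [[al0 ga0 al2 _ _] law]]]] := gaussian_law y y gX.
pose g (z : R * R) : \bar R := (expR (l * z.2 ^+ 2))%:E.
have mg : measurable_fun setT g.
  apply/measurable_EFinP; apply: measurableT_comp => //.
  by apply: measurable_funM => //; exact: measurable_funX.
rewrite (law g mg) => [|z]; last by rewrite lee_fin expR_ge0.
rewrite /normal2 /g /=.
under eq_integral => x _.
  rewrite integral_cst//= probability_setT mule1 exprMn mulrA.
  over.
move: hl; rewrite ler_norml => /andP[l1 l2].
have a0 : 0 <= al ^+ 2 by exact: sqr_ge0.
have la : l * al ^+ 2 < 1 / 2 by rewrite al2 in a0 *; nra.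
rewrite integral_normal_expR_sq// lee_fin -al2 -div1r.
have s0 : 0 < 1 - 2 * (l * al ^+ 2) by lra.
rewrite ler_pdivrMr ?sqrtr_gt0//.
rewrite -(@ler_sqr _ 1) ?nnegrE ?mulr_ge0 ?expR_ge0 ?sqrtr_ge0//.
rewrite expr1n exprMn sqr_sqrtr ?(ltW s0)// -expRM_natl.
have h := expR_ge1Dx (2%:R * (l * al ^+ 2 + 4 * l ^+ 2)).
apply: (@le_trans _ _ ((1 + 2%:R * (l * al ^+ 2 + 4 * l ^+ 2)) * (1 - 2 * (l * al ^+ 2)))); last first.
  by rewrite ler_wpM2r// ltW.
rewrite al2 in la s0 a0 *.
set b := dotv y y in y1 a0 la s0 *.
have h1 : 0 <= l ^+ 2 * (1 - b ^+ 2) by rewrite mulr_ge0 ?sqr_ge0//; nra.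
have hlb : l * b <= 1 / 4 by nra.
have h2 : 0 <= l ^+ 2 * (1 - 4 * (l * b)) by rewrite mulr_ge0 ?sqr_ge0//; lra.
by lra.
Qed.

Variables (m : nat) (X : 'I_m -> {RV P >-> borelV R n}).
Hypotheses (gX : forall i, standard_gaussian (X i)) (iX : mutually_independent X).

Let mX (y : 'cV[R]_n) : measurable_fun setT (fun v : borelV R n => dotv (v : 'cV[R]_n) y ^+ 2).
Proof. by apply: measurable_funX; exact: measurable_dotv. Qed.

(** l = del / 8 minimises the exponent 4 l^2 - l del, to - del^2 / 16. *)
Lemma sum_sq_upper_tail (y : 'cV[R]_n) (del : R) : dotv y y <= 1 -> 0 < del <= 1 ->
  let A := [set w | (dotv y y + del) * m%:R <= \sum_(i < m) dotv (X i w : 'cV[R]_n) y ^+ 2] in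
  measurable A /\ (P A <= (expR (- (del ^+ 2 / 16) * m%:R))%:E)%E.
Proof.
move=> y1 /andP[d0 d1].
have l0 : 0 < del / 8 by lra.
have := @chernoff_sum R d T P _ (borelV R n) m X _ iX (mX y) (del / 8)
  (del / 8 * dotv y y + 4 * (del / 8) ^+ 2) (dotv y y + del) l0.
have -> : del / 8 * dotv y y + 4 * (del / 8) ^+ 2 - del / 8 * (dotv y y + del) = - (del ^+ 2 / 16) by field.
by apply=> i; apply: mgf_sq => //; rewrite ger0_norm; lra.
Qed.

Lemma sum_sq_lower_tail (y : 'cV[R]_n) (del : R) : dotv y y <= 1 -> 0 < del <= 1 ->
  let A := [set w | \sum_(i < m) dotv (X i w : 'cV[R]_n) y ^+ 2 <= (dotv y y - del) * m%:R] in
  measurable A /\ (P A <= (expR (- (del ^+ 2 / 16) * m%:R))%:E)%E.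
Proof.
move=> y1 /andP[d0 d1] A.
have l0 : 0 < del / 8 by lra.
have mXN : measurable_fun setT (fun v : borelV R n => - dotv (v : 'cV[R]_n) y ^+ 2).
  exact: measurableT_comp.
have := @chernoff_sum R d T P _ (borelV R n) m X _ iX mXN (del / 8)
  (- (del / 8) * dotv y y + 4 * (del / 8) ^+ 2) (- dotv y y + del) l0.
have -> : - (del / 8) * dotv y y + 4 * (del / 8) ^+ 2 - del / 8 * (- dotv y y + del) = - (del ^+ 2 / 16) by field.
rewrite (_ : [set w | (- dotv y y + del) * m%:R <= _] = A).
  apply=> i; rewrite -(sqrrN (del / 8)).
  under eq_integral do rewrite mulrN -mulNr.
  by apply: mgf_sq => //; rewrite normrN ger0_norm; lra.
apply/seteqP; split => w /=; rewrite sumrN => h.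
  by rewrite /A /=; move: h; rewrite lerNr -mulNr opprD opprK.
by rewrite lerNr -mulNr opprD opprK.
Qed.

End Concentration.

Section QuadraticForm.
Context {R : realType} {n m : nat} (a : 'I_m -> 'cV[R]_n).
Hypothesis m0 : (0 < m)%N.
Implicit Types y : 'cV[R]_n.

Definition qform y : R := \sum_(i < m) dotv (a i) y ^+ 2.

Lemma qform_ge0 y : 0 <= qform y.
Proof. by rewrite sumr_ge0// => i _; rewrite sqr_ge0. Qed.

Lemma qformZ c y : qform (c *: y) = c ^+ 2 * qform y.
Proof. by rewrite /qform mulr_sumr; apply: eq_bigr => i _; rewrite dotvZr exprMn. Qed.

Lemma dotv_parallelogram y y' :
  dotv (y + y') (y + y') + dotv (y - y') (y - y') = 2 * dotv y y + 2 * dotv y' y'.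
Proof. by rewrite !(dotvDl, dotvDr, dotvNl, dotvNr) (dotvC y' y); ring. Qed.

Lemma dotv_diff_le (eps : R) y y' : 0 < eps -> dotv y y <= 1 -> dotv y' y' <= 1 ->
  dotv (y - y') (y - y') <= eps ^+ 2 -> `|dotv y y - dotv y' y'| <= 2 * eps.
Proof.
move=> e0 y1 y1' yy.
have -> : dotv y y - dotv y' y' = dotv (y - y') (y + y').
  by rewrite !(dotvDl, dotvDr, dotvNl, dotvNr) (dotvC y' y); ring.
rewrite -ler_sqr ?nnegrE ?mulr_ge0 ?(ltW e0)// real_normK ?num_real//.
apply: le_trans (dotv_cauchy _ _) _.
have h := dotv_parallelogram y y'; have h2 := dotvv_ge0 (y - y').
have -> : (2 * eps) ^+ 2 = eps ^+ 2 * 4 by ring.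
by apply: ler_pM; rewrite ?dotvv_ge0//; lra.
Qed.

(** w^2 - w'^2 = (w + w') (w - w'), and the product is split with weight [eps]. The sign [s] in
    [key], 1 or -1, treats both directions at once. *)
Lemma qform_diff_le (S eps : R) y y' : 0 < eps -> dotv y y <= 1 -> dotv y' y' <= 1 ->
  dotv (y - y') (y - y') <= eps ^+ 2 ->
  (forall v, qform v <= S * dotv v v) -> 0 <= S ->
  qform y - qform y' <= 5 / 2 * eps * S /\ qform y' - qform y <= 5 / 2 * eps * S.
Proof.
move=> e0 y1 y1' yy hS S0.
have hp : qform (y + y') <= S * 4.
  apply: le_trans (hS _) _; rewrite ler_wpM2l//.
  by have := dotv_parallelogram y y'; have := dotvv_ge0 (y - y'); lra.
have hm : qform (y - y') <= S * eps ^+ 2 by apply: le_trans (hS _) _; rewrite ler_wpM2l.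
have key (s : R) : s ^+ 2 = 1 ->
    s * (qform y - qform y') <= eps / 2 * qform (y + y') + qform (y - y') / (2 * eps).
  move=> s2; rewrite /qform -sumrB !mulr_sumr mulr_suml -big_split /=.
  apply: ler_sum => i _; rewrite dotvDr dotvBr.
  set w := dotv (a i) y; set w' := dotv (a i) y'.
  have e20 : 0 < 2 * eps by lra.
  rewrite -subr_ge0.
  have -> : eps / 2 * (w + w') ^+ 2 + (w - w') ^+ 2 / (2 * eps) - s * (w ^+ 2 - w' ^+ 2) =
    (s ^+ 2 * (eps * (w + w')) ^+ 2 + (w - w') ^+ 2 - 2 * s * (eps * (w + w')) * (w - w')) / (2 * eps).
    by rewrite s2; field; rewrite gt_eqF.
  rewrite divr_ge0 ?(ltW e20)//.
  have -> : s ^+ 2 * (eps * (w + w')) ^+ 2 + (w - w') ^+ 2 - 2 * s * (eps * (w + w')) * (w - w') =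
    (s * (eps * (w + w')) - (w - w')) ^+ 2 by ring.
  exact: sqr_ge0.
have bnd : eps / 2 * qform (y + y') + qform (y - y') / (2 * eps) <= 5 / 2 * eps * S.
  have h1 : eps / 2 * qform (y + y') <= eps / 2 * (S * 4).
    by rewrite ler_wpM2l// divr_ge0// ltW.
  have h2 : qform (y - y') / (2 * eps) <= S * eps / 2.
    rewrite ler_pdivrMr; last by lra.
    by apply: le_trans hm _; rewrite le_eqVlt; apply/orP; left; apply/eqP; field.
  by lra.
split.
  by apply: le_trans bnd; rewrite -[leLHS]mul1r; apply: key; rewrite expr1n.
by apply: le_trans bnd; rewrite -opprB -mulN1r; apply: key; rewrite sqrrN expr1n.
Qed.

Lemma unit_ball_homogeneous (f : 'cV[R]_n -> R) (b : R) :
  (forall c y, f (c *: y) = c ^+ 2 * f y) ->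
  (forall y, dotv y y = 1 -> f y <= b) -> forall y, f y <= b * dotv y y.
Proof.
move=> fZ fb y; have [y0|y0] := eqVneq y 0.
  have := fZ 0 0; rewrite scale0r expr0n mul0r y0 => ->.
  by rewrite /dotv mulmx0 mxE mulr0.
have d0 : 0 < dotv y y by rewrite lt_def dotvv_ge0 dotvv_eq0 y0.
have e0 : enorm y != 0 by rewrite gt_eqF// sqrtr_gt0.
have := fb ((enorm y)^-1 *: y).
rewrite dotvZl dotvZr fZ mulrA -expr2 exprVn sqr_enorm mulVf ?gt_eqF// => /(_ erefl).
by rewrite mulrC ler_pdivrMr.
Qed.

Section FromNet.
Variables (del eps : R).
Hypotheses (eps0 : 0 < eps <= 1 / 4) (del0 : 0 < del <= 1).
Hypothesis upper : forall y, dotv y y <= 1 -> exists y',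
  [/\ dotv y' y' <= dotv y y, dotv (y - y') (y - y') <= eps ^+ 2 &
     qform y' <= (dotv y' y' + del) * m%:R].
Hypothesis lower : forall y, dotv y y <= 1 -> exists y',
  [/\ dotv y' y' <= dotv y y, dotv (y - y') (y - y') <= eps ^+ 2 &
     (dotv y' y' - del) * m%:R <= qform y'].

Let mR : 0 < m%:R :> R. Proof. by rewrite ltr0n. Qed.

(* The best constant [s] satisfies [s <= 4 + s / 8] by approximation from the net. *)
Lemma qform_le5 y : qform y <= 5 * m%:R * dotv y y.
Proof.
pose A := [set S : R | 0 <= S /\ forall y, qform y <= S * m%:R * dotv y y].
have A0 : A !=set0.
  exists ((\sum_(i < m) dotv (a i) (a i)) / m%:R); split.
    by rewrite divr_ge0// sumr_ge0// => i _; exact: dotvv_ge0.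
  move=> v; rewrite divfK ?gt_eqF// mulr_suml.
  by apply: ler_sum => i _; exact: dotv_cauchy.
have lbA : has_inf A by split => //; exists 0 => S [].
have /andP[e0 e1] := eps0; have /andP[d0 d1] := del0.
(* In [qform v <= 2 * qform v' + 2 * qform (v - v')] the net point contributes at most 4 m and the
   remainder at most S m / 8. *)
have step S : A S -> A (4 + S / 8).
  move=> [S0 hS]; split; first by lra.
  apply: unit_ball_homogeneous => [|v v1]; first exact: qformZ.
  have [v' [v1' vv hv]] : exists y', [/\ dotv y' y' <= dotv v v,
      dotv (v - y') (v - y') <= eps ^+ 2 & qform y' <= (dotv y' y' + del) * m%:R].
    by apply: upper; rewrite v1.
  have hq : qform v <= 2 * qform v' + 2 * qform (v - v').
    rewrite /qform !mulr_sumr -big_split /=; apply: ler_sum => i _.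
    rewrite dotvBr; set w := dotv _ v; set w' := dotv _ v'.
    by have := sqr_ge0 (w - 2 * w'); lra.
  have hd : qform (v - v') <= S * m%:R / 16.
    apply: le_trans (hS _) _; rewrite ler_wpM2l// ?mulr_ge0// ?(ltW mR)//.
    by apply: le_trans vv _; nra.
  rewrite v1 in v1'; apply: le_trans hq _.
  have hv2 : qform v' <= 2 * m%:R by apply: le_trans hv _; rewrite ler_pM2r//; lra.
  by lra.
have AinfA : A (inf A).
  split; first by apply: lb_le_inf => // S [].
  move=> v; have [v0|v0] := eqVneq v 0.
    have := qformZ 0 0; rewrite scale0r expr0n mul0r v0 => ->.
    by rewrite /dotv mulmx0 mxE mulr0.
  have p0 : 0 < dotv v v by rewrite lt_def dotvv_ge0 dotvv_eq0 v0.
  rewrite -mulrA -ler_pdivrMr ?mulr_gt0//; apply: lb_le_inf => // S [S0 hS].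
  by rewrite ler_pdivrMr ?mulr_gt0// mulrA.
have h1 : inf A <= 4 + inf A / 8 by apply: ge_inf; [exact: lbA.2|exact: step].
apply: le_trans (AinfA.2 y) _.
rewrite ler_wpM2r ?dotvv_ge0// ler_wpM2r ?(ltW mR)//; lra.
Qed.

(** Passing from the net to the sphere costs 2 eps in the norm and 25/2 eps in the form, by
    [qform_diff_le] with S = 5 m: at most 15 eps in all. *)
Lemma qform_rip y :
  (1 - (del + 15 * eps)) * m%:R * dotv y y <= qform y <= (1 + (del + 15 * eps)) * m%:R * dotv y y.
Proof.
have S0 : 0 <= 5 * m%:R :> R by rewrite mulr_ge0// ltW.
have /andP[e0 e1] := eps0.
have em : 0 < eps * m%:R by rewrite mulr_gt0.
apply/andP; split.
  suff h : - qform y <= - ((1 - (del + 15 * eps)) * m%:R) * dotv y y by rewrite mulNr lerN2 in h.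
  apply: (@unit_ball_homogeneous (fun v => - qform v)) => [c v|v v1].
    by rewrite qformZ mulrN.
  have [|v' [v1' vv hv]] := @lower v; first by rewrite v1.
  rewrite v1 in v1'.
  have := dotv_diff_le e0 _ v1' vv; rewrite v1 lexx ler_norml => /(_ isT) /andP[_ h1].
  have [_ h2] := @qform_diff_le _ eps v v' e0 ltac:(by rewrite v1) v1' vv qform_le5 S0.
  have h3 : (1 - 2 * eps - del) * m%:R <= (dotv v' v' - del) * m%:R.
    by rewrite ler_pM2r//; lra.
  by lra.
apply: unit_ball_homogeneous => [|v v1]; first exact: qformZ.
have [|v' [v1' vv hv]] := @upper v; first by rewrite v1.
rewrite v1 in v1'.
have [h2 _] := @qform_diff_le _ eps v v' e0 ltac:(by rewrite v1) v1' vv qform_le5 S0.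
have h3 : (dotv v' v' + del) * m%:R <= (1 + del) * m%:R.
  by rewrite ler_pM2r//; lra.
by lra.
Qed.

End FromNet.

End QuadraticForm.

Section RipEvent.
Context {R : realType}.

Lemma probability_setI_ge d (T : measurableType d) (P : probability T R)
    (E F : set T) (a b : R) : measurable E -> measurable F ->
  ((1 - a)%:E <= P E)%E -> ((1 - b)%:E <= P F)%E -> ((1 - (a + b))%:E <= P (E `&` F))%E.
Proof.
move=> mE mF hE hF.
have hc (A : set T) (c : R) : measurable A -> ((1 - c)%:E <= P A)%E -> (P (~` A) <= c%:E)%E.
  move=> mA hA; rewrite probability_setC// leeBlDr ?fin_num_measure//.
  by rewrite -leeBlDl ?fin_num_measure// -EFinB.
have : (P (~` (E `&` F)) <= (a + b)%:E)%E.
  rewrite setCI; apply: (le_trans (measureU2 P (measurableC mE) (measurableC mF))).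
  by rewrite EFinD leeD// hc.
rewrite probability_setC; last exact: measurableI.
rewrite leeBlDr ?fin_num_measure//; last exact: measurableI.
by rewrite -leeBlDl ?fin_num_measure// -EFinB.
Qed.

Lemma rip_event (eta : R) : 0 < eta <= 1 -> exists c0 c2 : R, [/\ 0 < c0, 0 < c2 &
  forall (n m : nat) (d : measure_display) (T : measurableType d) (P : probability T R)
    (X : 'I_m -> {RV P >-> borelV R n}),
  (0 < n)%N -> (0 < m)%N -> (forall i, standard_gaussian (X i)) ->
  mutually_independent X -> c0 * n%:R <= m%:R ->
  exists E : set T, [/\ measurable E, ((1 - 2 * expR (- c2 * m%:R))%:E <= P E)%E &
    forall w, E w -> forall y : 'cV[R]_n,
    (1 - eta) * m%:R * dotv y y <= qform (fun i => X i w : 'cV[R]_n) y <=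
      (1 + eta) * m%:R * dotv y y]].
Proof.
(* This mesh makes 15 eps <= eta / 2; the other half of [eta] is the deviation on the net. *)
move=> /andP[eta0 eta1]; pose k := (Num.truncn (30 / eta)).+1.
have k0 : (0 < k)%N by [].
have kR : 0 < k%:R :> R by rewrite ltr0n.
have hk : 30 / eta < k%:R by rewrite /k truncnS_gt.
have hk' : 30 < k%:R * eta by rewrite -ltr_pdivrMr.
pose eps := (k%:R : R)^-1.
have eps0 : 0 < eps by rewrite invr_gt0.
have ek : eps * k%:R = 1 by rewrite mulVf// gt_eqF.
have eps1 : 30 * eps <= eta.
  by rewrite -(@ler_pM2r _ k%:R)// -mulrA ek mulr1 mulrC ltW// mulrC.
have eps4 : 0 < eps <= 1 / 4 by rewrite eps0; lra.
pose kap : R := (eta / 2) ^+ 2 / 16.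
have kap0 : 0 < kap by rewrite divr_gt0// exprn_gt0// divr_gt0.
have del01 : 0 < eta / 2 <= 1 by lra.
exists (2 * (k + 2)%:R / kap), (kap / 2); split.
- by rewrite divr_gt0// mulr_gt0// ltr0n addn_gt0 orbT.
- by rewrite divr_gt0.
move=> n m d T P X n0 m0 gX iX hm.
have hkm : (k + 2)%:R * n%:R <= kap / 2 * m%:R :> R.
  have -> : (k + 2)%:R * n%:R = kap / 2 * (2 * (k + 2)%:R / kap * n%:R) :> R.
    by field; rewrite gt_eqF.
  by rewrite ler_pM2l// divr_gt0.
have [E1 [mE1 PE1 hE1]] := @net_union R d T P k n m kap
  (fun y => [set w | (dotv y y + eta / 2) * m%:R <= \sum_(i < m) dotv (X i w : 'cV[R]_n) y ^+ 2])
  k0 n0 kap0 hkm (fun y y1 => sum_sq_upper_tail gX iX y1 del01).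
have [E2 [mE2 PE2 hE2]] := @net_union R d T P k n m kap
  (fun y => [set w | \sum_(i < m) dotv (X i w : 'cV[R]_n) y ^+ 2 <= (dotv y y - eta / 2) * m%:R])
  k0 n0 kap0 hkm (fun y y1 => sum_sq_lower_tail gX iX y1 del01).
exists (E1 `&` E2); split.
- exact: measurableI.
- have -> : 2 * expR (- (kap / 2) * m%:R) = expR (- (kap / 2) * m%:R) + expR (- (kap / 2) * m%:R) by ring.
  exact: probability_setI_ge.
move=> w [w1 w2] y.
have h : (1 - (eta / 2 + 15 * eps)) * m%:R * dotv y y <= qform (fun i => X i w : 'cV[R]_n) y <=
   (1 + (eta / 2 + 15 * eps)) * m%:R * dotv y y.
  apply: qform_rip => // v v1.
    have [v' [h1 h2 h3]] := hE1 _ w1 v v1; exists v'; split; rewrite ?exprVn//.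
    by rewrite ltW// ltNge; apply/negP.
  have [v' [h1 h2 h3]] := hE2 _ w2 v v1; exists v'; split; rewrite ?exprVn//.
  by rewrite ltW// ltNge; apply/negP.
have md : 0 <= m%:R * dotv y y by rewrite mulr_ge0// dotvv_ge0.
move: h; rewrite -!mulrA => /andP[ha hb]; apply/andP; split.
  by apply: le_trans ha; rewrite ler_wpM2r//; lra.
by apply: le_trans hb _; rewrite ler_wpM2r//; lra.
Qed.

End RipEvent.

(** * Moments of the homogeneous hats *)

Section HatMoments.
Context {R : realType}.
Variables (e f g k : R).
Hypotheses (e0 : 0 < e) (k0 : 0 < k) (fg : f < g).

Let H := hatarea e f g k.
(** [C] is the height of the hat, [L] the Lipschitz constant of [triform_lip], [c] the constant of
    [integral_triform_le]. *)
Let C := e * k * (g - f) / (e + k).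
Let L := e + k + e * `|f| + k * `|g|.
Let c := 4 * normal_peak (1 : R) ^+ 2 * H.

(** Weighting the two sides by [k] and [e] eliminates [u], and the minimum is below the weighted
    mean. *)
Lemma triform_le_sq (u w : R) : triform e f g k u w <= C * w ^+ 2.
Proof.
have ek : 0 < e + k by rewrite addr_gt0.
have C0 : 0 <= C by rewrite divr_ge0 ?(ltW ek)// !mulr_ge0 ?subr_ge0// ltW.
rewrite /triform ge_max mulr_ge0 ?sqr_ge0//= -(ler_pM2l ek).
have -> : (e + k) * (C * w ^+ 2) = k * (e * (u * w - f * w ^+ 2)) + e * (k * (g * w ^+ 2 - u * w)).
  by rewrite /C; field; rewrite gt_eqF.
set A := e * _; set B := k * (_ - _); set M := Num.min A B.
have hA : M <= A by rewrite ge_min lexx.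
have hB : M <= B by rewrite ge_min lexx orbT.
by rewrite mulrDl addrC lerD// ler_pM2l.
Qed.

Lemma triform_lip (u w w' : R) :
  triform e f g k u w - triform e f g k u w' <= L * (`|w - w'| * (`|u| + `|w| + `|w'|)).
Proof.
set D := L * _.
have q0 : 0 <= `|w - w'| * (`|u| + `|w| + `|w'|) by rewrite mulr_ge0// !addr_ge0.
have L0 : 0 <= L by rewrite !addr_ge0 ?mulr_ge0// ltW.
have D0 : 0 <= D by rewrite mulr_ge0.
have lin (s t : R) : s * (u * w - t * w ^+ 2) - s * (u * w' - t * w' ^+ 2) <=
    (`|s| + `|s| * `|t|) * (`|w - w'| * (`|u| + `|w| + `|w'|)).
  have -> : s * (u * w - t * w ^+ 2) - s * (u * w' - t * w' ^+ 2) =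
    s * u * (w - w') - s * t * ((w - w') * (w + w')) by ring.
  rewrite (le_trans (ler_norm _))// (le_trans (ler_normB _ _))// !normrM.
  have h1 : `|w + w'| <= `|w| + `|w'| by exact: ler_normD.
  rewrite mulrDl lerD//.
    by rewrite -mulrA ler_wpM2l// mulrC ler_wpM2l// -addrA lerDl addr_ge0.
  rewrite ler_wpM2l// ?mulr_ge0// ler_wpM2l//.
  by apply: le_trans h1 _; rewrite -addrA lerDr.
rewrite lerBlDr /triform.
have hA := lin e f; have hB := lin (- k) g.
have hL1 : (`|e| + `|e| * `|f|) * (`|w - w'| * (`|u| + `|w| + `|w'|)) <= D.
  rewrite ler_wpM2r// /L (gtr0_norm e0).
  by have := mulr_ge0 (ltW k0) (normr_ge0 g); have := k0; lra.
have hL2 : (`|- k| + `|- k| * `|g|) * (`|w - w'| * (`|u| + `|w| + `|w'|)) <= D.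
  rewrite ler_wpM2r// /L normrN (gtr0_norm k0).
  by have := mulr_ge0 (ltW e0) (normr_ge0 f); have := e0; lra.
set A := e * _ in hA *; set A' := e * (u * w' - _) in hA *.
have eB v : - k * (u * v - g * v ^+ 2) = k * (g * v ^+ 2 - u * v) by ring.
rewrite !eB in hB.
set B := k * _ in hB *; set B' := k * (g * w' ^+ 2 - _) in hB *.
have hAD : A <= D + A' by rewrite -lerBlDr (le_trans hA hL1).
have hBD : B <= D + B' by rewrite -lerBlDr (le_trans _ hL2)// (le_trans _ hB)//; lra.
rewrite ge_max; apply/andP; split.
  by rewrite addr_ge0// le_max lexx.
rewrite -lerBlDl le_max; apply/orP; right.
rewrite le_min !lerBlDl; apply/andP; split.
  by apply: le_trans hAD; rewrite ge_min lexx.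
by apply: le_trans hBD; rewrite ge_min lexx orbT.
Qed.

Lemma sqr_le_expR (t : R) : 0 <= t -> t ^+ 2 <= 2 * expR t.
Proof.
move=> t0; have h := expR_ge_cubic t0; have := exprn_ge0 3 t0.
by lra.
Qed.

Lemma expR_le_quadratic (t : R) : 0 <= t -> expR t <= 1 + t + t ^+ 2 * expR t.
Proof.
move=> t0; have h := expR_ge1Dx (- t).
have hl : expR t <= 1 + t * expR t.
  have : expR t * expR (- t) = 1 by rewrite -expRD subrr expR0.
  have := expR_gt0 t; nra.
by nra.
Qed.

Section Fixed.
Context {n : nat} (x h : 'cV[R]_n).
Hypotheses (x1 : dotv x x = 1) (h1 : dotv h h <= 1).
Let D := dotv h h - dotv x h ^+ 2.
Hypothesis D0 : 0 < D.

(** In the factor given by [gaussian_law], al = |h| and D = (al ga)^2, so al^3 / ga is |h|^4 / sqrt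
    D. *)
Lemma mean_triform d (T : measurableType d) (P : probability T R)
  (X : {RV P >-> borelV R n}) : standard_gaussian X ->
  (\int[P]_w (triform e f g k (dotv (X w : 'cV[R]_n) x) (dotv (X w : 'cV[R]_n) h))%:E <=
   (c * dotv h h ^+ 2 / Num.sqrt D)%:E)%E.
Proof.
move=> gX; have [al [be [ga [[al0 ga0 al2 albe bega] law]]]] := gaussian_law h x gX.
pose G (z : R * R) : \bar R := (triform e f g k z.1 z.2)%:E.
have mG : measurable_fun setT G by apply/measurable_EFinP; exact: measurable_triform.
rewrite (law G mG) => [|z]; last by rewrite lee_fin triform_ge0.
have DE : D = (al * ga) ^+ 2.
  by rewrite /D exprMn -al2 (dotvC x h) -albe -[ga ^+ 2](addKr (be ^+ 2)) bega x1; ring.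
have ag : 0 < al * ga.
  rewrite lt_def mulr_ge0// andbT; apply/negP => /eqP ag.
  by move: D0; rewrite DE ag expr0n ltxx.
have gap : 0 < ga.
  by rewrite lt_def ga0 andbT; apply/negP => /eqP g0; rewrite g0 mulr0 ltxx in ag.
have alp : 0 < al.
  by rewrite lt_def al0 andbT; apply/negP => /eqP g0; rewrite g0 mul0r ltxx in ag.
rewrite /G /=; apply: (le_trans (integral_triform_le _ e0 k0 fg al0 gap)).
rewrite lee_fin DE sqrtr_sqr (gtr0_norm ag) -al2 /c /H.
rewrite le_eqVlt; apply/orP; left; apply/eqP; field.
by rewrite !gt_eqF.
Qed.

(** The form is only bounded by C w^2, hence sub-exponential. Its second-order term is at most (l
    C)^2 w^4 exp (w^2 / 8) <= 128 (l C)^2 exp (w^2 / 4), and the last exponential has mean at most 2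
    by [mgf_sq]. *)
Lemma mgf_triform d (T : measurableType d) (P : probability T R)
  (X : {RV P >-> borelV R n}) (l : R) : standard_gaussian X ->
  0 < l -> l * C <= 1 / 8 ->
  (\int[P]_w (expR (l * triform e f g k (dotv (X w : 'cV[R]_n) x) (dotv (X w : 'cV[R]_n) h)))%:E <=
   (expR (l * (c * dotv h h ^+ 2 / Num.sqrt D) + 256 * C ^+ 2 * l ^+ 2))%:E)%E.
Proof.
move=> gX l0 lC; set mu := c * _ / _.
have C0 : 0 <= C by rewrite divr_ge0 ?addr_ge0 ?(ltW e0) ?(ltW k0)// !mulr_ge0 ?subr_ge0// ltW.
pose Tf w := triform e f g k (dotv (X w : 'cV[R]_n) x) (dotv (X w : 'cV[R]_n) h).
pose Q w := expR (1 / 4 * dotv (X w : 'cV[R]_n) h ^+ 2).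
have mdot (y : 'cV[R]_n) : measurable_fun setT (fun w => dotv (X w : 'cV[R]_n) y).
  exact: (measurableT_comp (measurable_dotv y)).
have mTf : measurable_fun setT Tf.
  apply: (measurableT_comp (measurable_triform e f g k)
    (g := fun w => (dotv (X w : 'cV[R]_n) x, dotv (X w : 'cV[R]_n) h))).
  exact: measurable_fun_pair.
have mQ : measurable_fun setT Q.
  apply: measurableT_comp => //; apply: measurable_funM => //.
  exact: measurable_funX.
have T0 w : 0 <= Tf w by exact: triform_ge0.
have Q0 w : 0 <= Q w by exact: expR_ge0.
have ptw w : expR (l * Tf w) <= 1 + l * Tf w + 128 * C ^+ 2 * l ^+ 2 * Q w.
  set W := dotv (X w : 'cV[R]_n) h.
  have TW : Tf w <= C * W ^+ 2 by exact: triform_le_sq.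
  have W0 : 0 <= W ^+ 2 by exact: sqr_ge0.
  have lT : 0 <= l * Tf w by rewrite mulr_ge0// ltW.
  have lTW : l * Tf w <= 1 / 8 * W ^+ 2 by nra.
  have lTW2 : (l * Tf w) ^+ 2 <= (l * C) ^+ 2 * (W ^+ 2) ^+ 2.
    have lTC : l * Tf w <= l * C * W ^+ 2 by rewrite -mulrA ler_pM2l.
    by rewrite -exprMn lerXn2r ?nnegrE// (le_trans lT).
  have W4 : (W ^+ 2) ^+ 2 <= 128 * expR (1 / 8 * W ^+ 2).
    have := @sqr_le_expR (1 / 8 * W ^+ 2) ltac:(lra).
    by rewrite exprMn; lra.
  have QE : Q w = expR (1 / 8 * W ^+ 2) * expR (1 / 8 * W ^+ 2).
    by rewrite -expRD; congr expR; rewrite -/W; field.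
  apply: (le_trans (expR_le_quadratic lT)); rewrite lerD2l.
  have hE : expR (l * Tf w) <= expR (1 / 8 * W ^+ 2) by rewrite ler_expR.
  apply: (@le_trans _ _ (((l * C) ^+ 2 * (128 * expR (1 / 8 * W ^+ 2))) * expR (1 / 8 * W ^+ 2))).
    apply: ler_pM; [exact: sqr_ge0|exact: expR_ge0| |exact: hE].
    by apply: (le_trans lTW2); rewrite ler_wpM2l// sqr_ge0.
  by rewrite QE le_eqVlt; apply/orP; left; apply/eqP; ring.
have IQ : (\int[P]_w (Q w)%:E <= 2%:E)%E.
  apply: (le_trans (mgf_sq gX h1 _)); first by rewrite ger0_norm.
  rewrite lee_fin; apply: (@le_trans _ _ (expR (1 / 2))).
    by rewrite ler_expR; have := h1; lra.
  have e2 := @expR_half_ge R.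
  have : expR (1 / 2) * expR (- (1 / 2)) = 1 :> R by rewrite -expRD subrr expR0.
  by have := expR_gt0 (1 / 2 : R); nra.
have IT := mean_triform gX; rewrite -/mu in IT.
apply: (@le_trans _ _ (\int[P]_w (1%:E + (l%:E * (Tf w)%:E + (128 * C ^+ 2 * l ^+ 2)%:E * (Q w)%:E)))%E).
  apply: ge0_le_integral => //.
  - apply/measurable_EFinP; apply: measurableT_comp => //; exact: measurable_funM.
  - apply/measurable_EFinP; apply: measurable_funD => //; apply: measurable_funD; exact: measurable_funM.
  - by move=> w _; rewrite lee_fin addrA ptw.
have K0 : 0 <= 128 * C ^+ 2 * l ^+ 2.
  by apply: mulr_ge0; [apply: mulr_ge0|]; rewrite ?sqr_ge0.
rewrite ge0_integralD//; last 2 first.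
- by move=> w _; rewrite lee_fin addr_ge0// mulr_ge0// ltW.
- by apply/measurable_EFinP; apply: measurable_funD; exact: measurable_funM.
rewrite ge0_integralD//; last 4 first.
- by move=> w _; rewrite lee_fin mulr_ge0// ltW.
- by apply/measurable_EFinP; exact: measurable_funM.
- by move=> w _; rewrite lee_fin mulr_ge0.
- by apply/measurable_EFinP; exact: measurable_funM.
rewrite integral_cst//= probability_setT mule1.
rewrite ge0_integralZl//; do ?[exact/measurable_EFinP | by rewrite lee_fin ltW | by move=> w _; rewrite lee_fin].
rewrite ge0_integralZl//; do ?[exact/measurable_EFinP | by rewrite lee_fin | by move=> w _; rewrite lee_fin].
apply: (@le_trans _ _ (1%:E + (l%:E * mu%:E + (128 * C ^+ 2 * l ^+ 2)%:E * 2%:E))%E).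
  apply: leeD2l; apply: leeD; apply: lee_wpmul2l => //.
  by rewrite lee_fin ltW.
rewrite -!EFinM -!EFinD lee_fin.
apply: le_trans (expR_ge1Dx _); lra.
Qed.

End Fixed.

End HatMoments.

(** * Uniform bound for hats *)

Section UniformHat.
Context {R : realType}.

(** The Lipschitz bound is split as D^2 / (2 eps) + 3/2 eps (U^2 + W^2 + W'^2); summed over i, the
    two terms are at most eps m and 9 eps m, whence 10. *)
Lemma sum_triform_diff (e f g k eps : R) n m (a : 'I_m -> 'cV[R]_n) (x h h' : 'cV[R]_n) :
  0 < e -> 0 < k -> 0 < eps -> (forall y, qform a y <= 2 * m%:R * dotv y y) ->
  dotv x x = 1 -> dotv h h <= 1 -> dotv h' h' <= 1 ->
  dotv (h - h') (h - h') <= eps ^+ 2 ->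
  \sum_i triform e f g k (dotv (a i) x) (dotv (a i) h) <=
  \sum_i triform e f g k (dotv (a i) x) (dotv (a i) h') +
    (e + k + e * `|f| + k * `|g|) * (10 * eps) * m%:R.
Proof.
move=> e0 k0 ep hq x1 h1 h1' hh; rewrite addrC -lerBlDr -sumrB.
set L := e + k + _ + _.
have L0 : 0 <= L by rewrite !addr_ge0 ?mulr_ge0// ltW.
apply: (@le_trans _ _ (\sum_i L * (dotv (a i) (h - h') ^+ 2 / (2 * eps) +
    3 / 2 * eps * (dotv (a i) x ^+ 2 + dotv (a i) h ^+ 2 + dotv (a i) h' ^+ 2)))).
  apply: ler_sum => i _; rewrite dotvBr.
  set u := dotv _ x; set w := dotv _ h; set w' := dotv _ h'.
  apply: (le_trans (triform_lip f g e0 k0 u w w')); rewrite ler_wpM2l//.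
  have -> : u ^+ 2 + w ^+ 2 + w' ^+ 2 = `|u| ^+ 2 + `|w| ^+ 2 + `|w'| ^+ 2.
    by rewrite !real_normK ?num_real.
  rewrite -[(w - w') ^+ 2]real_normK ?num_real//.
  move: (`|w - w'|) (`|u|) (`|w|) (`|w'|) => D U W W'.
  have -> : D * (U + W + W') = (2 * eps * (D * (U + W + W'))) / (2 * eps).
    by field; rewrite gt_eqF.
  rewrite -lerBlDr; have -> : 3 / 2 * eps * (U ^+ 2 + W ^+ 2 + W' ^+ 2) =
      3 * eps ^+ 2 * (U ^+ 2 + W ^+ 2 + W' ^+ 2) / (2 * eps) by field; rewrite gt_eqF.
  rewrite -mulrBl ler_pM2r ?invr_gt0 ?mulr_gt0//.
  have := sqr_ge0 (D - eps * (U + W + W')).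
  have := mulr_ge0 (sqr_ge0 eps) (sqr_ge0 (U - W)).
  have := mulr_ge0 (sqr_ge0 eps) (sqr_ge0 (U - W')).
  have := mulr_ge0 (sqr_ge0 eps) (sqr_ge0 (W - W')).
  by lra.
rewrite -mulr_sumr big_split /= -mulr_suml -mulr_sumr !big_split /= -!/(qform a _).
rewrite -[leRHS]mulrA; apply: ler_wpM2l => //.
have m0 : 0 <= m%:R :> R by [].
have q1 : qform a (h - h') / (2 * eps) <= eps * m%:R.
  rewrite ler_pdivrMr ?mulr_gt0//; apply: (le_trans (hq _)).
  have -> : eps * m%:R * (2 * eps) = 2 * m%:R * eps ^+ 2 by ring.
  by rewrite ler_wpM2l// mulr_ge0.
have q2 : qform a x <= 2 * m%:R by have := hq x; rewrite x1 mulr1.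
have q3 y : dotv y y <= 1 -> qform a y <= 2 * m%:R.
  by move=> y1; apply: (le_trans (hq _)); rewrite ler_piMr// mulr_ge0.
have q4 : 3 / 2 * eps * (qform a x + qform a h + qform a h') <= 3 / 2 * eps * (6 * m%:R).
  rewrite ler_wpM2l ?mulr_ge0 ?(ltW ep)//.
  by have := q3 _ h1; have := q3 _ h1'; lra.
by lra.
Qed.

Lemma normal_dist_diff (eps : R) n (x h h' : 'cV[R]_n) : 0 < eps -> dotv x x = 1 ->
  dotv h h <= 1 -> dotv h' h' <= 1 -> dotv (h - h') (h - h') <= eps ^+ 2 ->
  dotv h h - dotv x h ^+ 2 - 4 * eps <= dotv h' h' - dotv x h' ^+ 2.
Proof.
move=> ep x1 h1 h1' hh.
have := dotv_diff_le ep h1 h1' hh; rewrite ler_norml => /andP[_ hd].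
have : `|dotv x h ^+ 2 - dotv x h' ^+ 2| <= 2 * eps.
  have -> : dotv x h ^+ 2 - dotv x h' ^+ 2 = dotv x (h - h') * dotv x (h + h').
    by rewrite dotvBr dotvDr; ring.
  rewrite -ler_sqr ?nnegrE ?mulr_ge0 ?(ltW ep)// real_normK ?num_real//.
  have -> : (2 * eps) ^+ 2 = eps ^+ 2 * 4 by ring.
  have b1 : dotv x (h - h') ^+ 2 <= eps ^+ 2.
    by apply: (le_trans (dotv_cauchy _ _)); rewrite x1 mul1r.
  have b2 : dotv x (h + h') ^+ 2 <= 4.
    apply: (le_trans (dotv_cauchy _ _)); rewrite x1 mul1r.
    by have := dotv_parallelogram h h'; have := dotvv_ge0 (h - h'); lra.
  by rewrite exprMn; apply: ler_pM; rewrite ?sqr_ge0.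
rewrite ler_norml => /andP[hd' _].
by lra.
Qed.

(** With z = 4 eps / d0^2 one has D' >= (1 - z) D, hence sqrt D' >= (1 - z) sqrt D. The lower bound
    [d0] on sqrt D is what makes the mean stable when h moves to the net. *)
Lemma div_sqrt_perturb (c A A' D D' d0 eps : R) : 0 < d0 -> 0 < eps ->
  d0 ^+ 2 <= D -> D - 4 * eps <= D' -> 8 * eps <= d0 ^+ 2 ->
  0 <= A' -> A' <= A -> A <= c ->
  A' / Num.sqrt D' <= A / Num.sqrt D + 8 * eps * c / d0 ^+ 3.
Proof.
move=> dp ep Dd DD e1 A'0 AA Ac.
have d2 : 0 < d0 ^+ 2 by rewrite exprn_gt0.
have D0 : 0 < D by lra.
have D'0 : 0 < D' by lra.
have s0 : 0 < Num.sqrt D by rewrite sqrtr_gt0.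
have s0' : 0 < Num.sqrt D' by rewrite sqrtr_gt0.
have sd : d0 <= Num.sqrt D.
  by rewrite -[d0]gtr0_norm// -sqrtr_sqr ler_wsqrtr.
pose z := 4 * eps / d0 ^+ 2.
have z0 : 0 <= z by apply: divr_ge0; [apply: mulr_ge0 => //|]; exact: ltW.
have zE : z * d0 ^+ 2 = 4 * eps by rewrite /z divfK// gt_eqF.
have z1 : z <= 1 / 2 by rewrite /z ler_pdivrMr//; lra.
have ss : Num.sqrt D * (1 - z) <= Num.sqrt D'.
  have z1' : 0 <= 1 - z by lra.
  rewrite -[1 - z]ger0_norm// -sqrtr_sqr -sqrtrM; last exact: ltW.
  rewrite ler_wsqrtr//; apply: le_trans DD.
  have h1 : z * d0 ^+ 2 <= z * D by rewrite ler_wpM2l.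
  have h2 : 0 <= D * (z * (1 - z)) by apply: mulr_ge0; [exact: ltW | exact: mulr_ge0].
  have -> : D * (1 - z) ^+ 2 = D - z * D - D * (z * (1 - z)) by ring.
  by lra.
apply: (@le_trans _ _ (A / Num.sqrt D')); first by rewrite ler_pM2r// invr_gt0.
move: (Num.sqrt D) (Num.sqrt D') s0 s0' sd ss => s s' s0 s0' sd ss.
have A0 : 0 <= A by exact: le_trans AA.
have c0 : 0 <= c by exact: le_trans Ac.
rewrite -lerBlDl.
have -> : A / s' - A / s = A * (s - s') / (s * s') by field; rewrite !gt_eqF.
rewrite ler_pdivrMr ?mulr_gt0//.
have -> : 8 * eps * c / d0 ^+ 3 = 2 * z * c / d0 by rewrite /z; field; rewrite gt_eqF.
have h3 : s - s' <= z * s by lra.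
have h4 : s / 2 <= s'.
  apply: le_trans ss; apply: ler_wpM2l; first exact: ltW.
  by lra.
apply: (@le_trans _ _ (c * (z * s))).
  have [hs|hs] := lerP (s - s') 0.
    apply: (@le_trans _ _ 0); first by rewrite mulr_ge0_le0.
    by apply: mulr_ge0 => //; apply: mulr_ge0 => //; exact: ltW.
  by apply: ler_pM => //; exact: ltW.
have -> : c * (z * s) = (2 * z * c / d0) * (s * (d0 / 2)) by field; rewrite gt_eqF.
apply: ler_wpM2l.
  by apply: divr_ge0; [apply: mulr_ge0 => //; exact: mulr_ge0 | exact: ltW].
by rewrite ler_pM2l//; lra.
Qed.

Lemma triform_event (e f g k del d0 : R) : 0 < e -> 0 < k -> f < g ->
  0 < del <= 1 -> 0 < d0 -> exists c0 c2 : R, [/\ 0 < c0, 0 < c2 &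
  forall (n m : nat) (d : measure_display) (T : measurableType d) (P : probability T R)
    (X : 'I_m -> {RV P >-> borelV R n}) (x : 'cV[R]_n),
  (0 < n)%N -> (0 < m)%N -> (forall i, standard_gaussian (X i)) ->
  mutually_independent X -> c0 * n%:R <= m%:R -> dotv x x = 1 ->
  exists E : set T, [/\ measurable E, ((1 - expR (- c2 * m%:R))%:E <= P E)%E &
    forall w, E w ->
    (forall y, qform (fun i => X i w : 'cV[R]_n) y <= 2 * m%:R * dotv y y) ->
    forall h : 'cV[R]_n, dotv h h <= 1 -> d0 ^+ 2 <= dotv h h - dotv x h ^+ 2 ->
    \sum_i triform e f g k (dotv (X i w : 'cV[R]_n) x) (dotv (X i w : 'cV[R]_n) h) <=
    (20 / 31 * hatarea e f g k * dotv h h ^+ 2 / Num.sqrt (dotv h h - dotv x h ^+ 2) + del) * m%:R]].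
Proof.
move=> e0 k0 fg /andP[del0 del1] dp.
set H := hatarea e f g k.
have H0 : 0 <= H.
  by rewrite mulr_ge0// ?divr_ge0 ?sqr_ge0// ?mulr_ge0 ?addr_ge0// ltW.
pose c := 4 * normal_peak (1 : R) ^+ 2 * H.
have c0 : 0 <= c by rewrite mulr_ge0// mulr_ge0// sqr_ge0.
have cle : c <= 20 / 31 * H.
  by rewrite /c ler_wpM2r//; have := @normal_peak_sqr_le R; lra.
pose C := e * k * (g - f) / (e + k).
have C0 : 0 <= C by rewrite divr_ge0 ?addr_ge0 ?(ltW e0) ?(ltW k0)// !mulr_ge0 ?subr_ge0// ltW.
pose C1 := C + 1.
have C10 : 0 < C1 by rewrite /C1; lra.
pose L := e + k + e * `|f| + k * `|g|.
have L0 : 0 <= L by rewrite !addr_ge0 ?mulr_ge0// ltW.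
pose del' := del / 2.
have del'0 : 0 < del' by rewrite /del'; lra.
(* 256 C1^2 l^2 is half of l del': the second-order term of [mgf_triform] takes one half of the
   gain, and [kap] is the other. *)
pose l := del' / (32 * (4 * C1) ^+ 2).
have pC : 0 < 32 * (4 * C1) ^+ 2 by apply: mulr_gt0 => //; apply: exprn_gt0; exact: mulr_gt0.
have l0 : 0 < l by exact: divr_gt0.
have lE : l * (32 * (4 * C1) ^+ 2) = del' by rewrite /l divfK// gt_eqF.
have lC : l * C <= 1 / 8.
  have CC : C <= C1 ^+ 2 by rewrite /C1; nra.
  have : l * C <= l * C1 ^+ 2 by rewrite ler_pM2l.
  by move: lE; rewrite /del'; lra.
pose kap := l * del' / 2.
have kap0 : 0 < kap by rewrite divr_gt0// mulr_gt0.
(* A mesh of at most 1 / K gives 8 eps <= d0^2, a perturbation of the mean of at most del / 4, and a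
   Lipschitz error of at most del / 4. The last two and del' = del / 2 add up to [del]. *)
pose K := 8 / d0 ^+ 2 + 32 * c / (d0 ^+ 3 * del) + 40 * L / del.
pose N := (Num.truncn K).+1.
have N0 : (0 < N)%N by [].
have NR : 0 < N%:R :> R by rewrite ltr0n.
have hN : K < N%:R by rewrite /N truncnS_gt.
pose eps := (N%:R : R)^-1.
have ep : 0 < eps by rewrite invr_gt0.
have eK : eps * K <= 1 by rewrite /eps mulrC ler_pdivrMr// mul1r ltW.
have d2 : 0 < d0 ^+ 2 by rewrite exprn_gt0.
have d3 : 0 < d0 ^+ 3 by rewrite exprn_gt0.
have K1 : 0 <= 8 / d0 ^+ 2 by rewrite divr_ge0// ltW.
have K2 : 0 <= 32 * c / (d0 ^+ 3 * del).
  by apply: divr_ge0; [exact: mulr_ge0 | apply: mulr_ge0; exact: ltW].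
have K3 : 0 <= 40 * L / del.
  by apply: divr_ge0; [exact: mulr_ge0 | exact: ltW].
have eK1 : eps * (8 / d0 ^+ 2) <= 1.
  by apply: le_trans eK; rewrite ler_pM2l// /K; lra.
have eK2 : eps * (32 * c / (d0 ^+ 3 * del)) <= 1.
  by apply: le_trans eK; rewrite ler_pM2l// /K; lra.
have eK3 : eps * (40 * L / del) <= 1.
  by apply: le_trans eK; rewrite ler_pM2l// /K; lra.
have e1 : 8 * eps <= d0 ^+ 2.
  by move: eK1; rewrite mulrA ler_pdivrMr// mul1r mulrC.
have e2 : 8 * eps * c / d0 ^+ 3 <= del / 4.
  rewrite ler_pdivrMr//; move: eK2; rewrite mulrA ler_pdivrMr ?mulr_gt0// mul1r.
  by lra.
have e3 : L * (10 * eps) <= del / 4.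
  by move: eK3; rewrite mulrA ler_pdivrMr// mul1r; lra.
exists (2 * (N + 2)%:R / kap), (kap / 2); split.
- by rewrite divr_gt0// mulr_gt0// ltr0n addn_gt0 orbT.
- by rewrite divr_gt0.
move=> n m d T P X x n0 m0 gX iX hm x1.
have mR : 0 < m%:R :> R by rewrite ltr0n.
have hkm : (N + 2)%:R * n%:R <= kap / 2 * m%:R :> R.
  have -> : (N + 2)%:R * n%:R = kap / 2 * (2 * (N + 2)%:R / kap * n%:R) :> R.
    by field; rewrite gt_eqF.
  by rewrite ler_pM2l// divr_gt0.
pose D (h : 'cV[R]_n) := dotv h h - dotv x h ^+ 2.
pose mu h := c * dotv h h ^+ 2 / Num.sqrt (D h).
pose Tf (h v : 'cV[R]_n) := triform e f g k (dotv v x) (dotv v h).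
have mTf h : measurable_fun setT (fun v : borelV R n => Tf h v).
  apply: (measurableT_comp (measurable_triform e f g k)
    (g := fun v : borelV R n => (dotv (v : 'cV[R]_n) x, dotv (v : 'cV[R]_n) h))).
  by apply: measurable_fun_pair; exact: measurable_dotv.
(* [mgf_triform] needs [0 < D h]. Elsewhere the bad set is empty, which costs nothing: net points
   near an admissible [h] satisfy [0 < D h']. *)
pose B h := if 0 < D h then [set w | (mu h + del') * m%:R <= \sum_(i < m) Tf h (X i w)] else set0.
have hB h : dotv h h <= 1 -> measurable (B h) /\ (P (B h) <= (expR (- kap * m%:R))%:E)%E.
  move=> h1; rewrite /B; case: ifP => D0; last by rewrite measure0; split => //; rewrite lee_fin expR_ge0.
  have [mA PA] := @chernoff_sum R d T P _ (borelV R n) m X _ iX (mTf h) l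
    (l * mu h + 256 * C ^+ 2 * l ^+ 2) (mu h + del') l0
    (fun i => mgf_triform e0 k0 fg x1 h1 D0 (gX i) l0 lC).
  split => //; apply: (le_trans PA); rewrite lee_fin ler_expR ler_pM2r//.
  have : 256 * C ^+ 2 * l ^+ 2 <= kap; last by rewrite /kap; lra.
  have CC : C ^+ 2 <= C1 ^+ 2 by rewrite /C1; nra.
  have -> : kap = 256 * C1 ^+ 2 * l ^+ 2 by rewrite /kap -lE; field.
  by rewrite ler_wpM2r ?sqr_ge0// ler_wpM2l.
have [E [mE PE hE]] := @net_union R d T P N n m kap B N0 n0 kap0 hkm hB.
exists E; split => // w Ew hq h h1 hD.
have [h' [h1' hh nB]] := hE w Ew h h1.
have h1'' := le_trans h1' h1.
have hh' : dotv (h - h') (h - h') <= eps ^+ 2 by rewrite /eps exprVn.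
apply: (le_trans (sum_triform_diff f g e0 k0 ep hq x1 h1 h1'' hh')).
have DD : D h - 4 * eps <= D h' by exact: normal_dist_diff.
have Dh : d0 ^+ 2 <= D h by [].
have Dh'0 : 0 < D h' by lra.
move: nB; rewrite /B Dh'0 /= => /negP; rewrite -ltNge => /ltW nB.
apply: (@le_trans _ _ ((mu h' + del') * m%:R + L * (10 * eps) * m%:R)).
  by rewrite lerD2r.
rewrite -mulrDl ler_pM2r//.
suff hmu : mu h' <= mu h + del / 4.
  have : mu h <= 20 / 31 * H * dotv h h ^+ 2 / Num.sqrt (D h).
    by rewrite /mu ler_wpM2r ?invr_ge0 ?sqrtr_ge0// ler_wpM2r// sqr_ge0.
  by move: hmu e3; rewrite /del' -/(D h); lra.
have r4 : dotv h' h' ^+ 2 <= dotv h h ^+ 2.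
  by rewrite lerXn2r// nnegrE dotvv_ge0.
have r41 : dotv h h ^+ 2 <= 1 by rewrite expr_le1// dotvv_ge0.
apply: le_trans (div_sqrt_perturb (c := c) dp ep Dh DD e1 _ (ler_wpM2l c0 r4) _) _.
- by rewrite mulr_ge0// sqr_ge0.
- by rewrite ler_piMr.
by rewrite lerD2l.
Qed.

End UniformHat.

(** * Contraction *)

Section Loss.
Context {R : realType}.
Implicit Types u v w s : R.

(* The junk value [u / 0 = 0] is harmless, being multiplied by [0]. *)
Definition loss u w := w ^+ 2 * defect (u / w).

Lemma lossZ (c : R) u w : c != 0 -> loss (c * u) (c * w) = c ^+ 2 * loss u w.
Proof.
by move=> c0; rewrite /loss exprMn -mulf_div divff// mul1r mulrA.
Qed.

(** Carries a majorant of [defect] over to its 2-homogeneous form; [0 <= Phi] takes care of w =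
    0. *)
Lemma loss_le (phi : R -> R) (Phi : R) u w : 0 <= Phi ->
  (forall s, u = s * w -> defect s <= phi s) ->
  (forall s, u = s * w -> w != 0 -> w ^+ 2 * phi s = Phi) -> loss u w <= Phi.
Proof.
move=> P0 hd hP; rewrite /loss; have [->|w0] := eqVneq w 0; first by rewrite expr0n mul0r.
have us : u = u / w * w by rewrite divfK.
by rewrite -(hP _ us w0) ler_wpM2l ?sqr_ge0// hd.
Qed.

(** The link to descent: the left side is the coefficient of a_i in the gradient sum, times a_i^T
    h. *)
Lemma residual_weight u v : (v - u * weight u v) * (u - v) = loss u (u - v) - (u - v) ^+ 2.
Proof.
have [->|uv] := eqVneq u v; first by rewrite subrr /loss expr0n /= mul0r mulr0 subrr.
by rewrite /loss -(defectE uv); ring.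
Qed.

(** The residual divided by w is [defect - 1], and [defect] lies in [-1, 3/2]. *)
Lemma residual_weight_sq u v : (v - u * weight u v) ^+ 2 <= 4 * (u - v) ^+ 2.
Proof.
have [->|uv] := eqVneq u v.
  (* Here sigma^2 = 0: by convention the weight is the sign of v^2, and the residual vanishes. *)
  rewrite subrr expr0n/= mulr0 /weight subrr expr0n/= eqxx.
  have [->|v0] := eqVneq v 0; first by rewrite mul0r subrr expr0n.
  by rewrite gtr0_sg ?mulr1 ?subrr ?expr0n// -expr2 exprn_even_gt0.
have w2 : 0 < (u - v) ^+ 2 by rewrite exprn_even_gt0// subr_eq0.
rewrite -(ler_pM2r w2) -exprMn residual_weight /loss.
set s := u / _; have d1 : -1 <= defect s <= 3 / 2.
  rewrite defect_le_3half andbT; have [s0|s0] := lerP s 0.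
    by case/andP: (defect_neg s0).
  by apply: le_trans (defect_ge0 (ltW s0)).
have -> : ((u - v) ^+ 2 * defect s - (u - v) ^+ 2) ^+ 2 =
    (defect s - 1) ^+ 2 * (u - v) ^+ 2 * (u - v) ^+ 2 by ring.
rewrite ler_pM2r// ler_pM2r//; nra.
Qed.

(** With p = x^T h the square comes from the component of h orthogonal to x. For p <= 0 < s one has
    (1 - p s)^2 >= 1, so the global bound 3/2 suffices. *)
Lemma loss_le_projection u w (p : R) : p <= 0 -> loss u w <= 3 / 2 * (w - p * u) ^+ 2.
Proof.
move=> p0; have q0 : 0 <= 3 / 2 * (w - p * u) ^+ 2 by rewrite mulr_ge0 ?sqr_ge0.
rewrite /loss; have [->|w0] := eqVneq w 0; first by rewrite expr0n mul0r mulr_ge0 ?sqr_ge0.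
have us : u = u / w * w by rewrite divfK.
set s := u / w in us *.
have [s0|s0] := lerP s 0.
  by apply: le_trans q0; rewrite mulr_ge0_le0 ?sqr_ge0//; case/andP: (defect_neg s0).
have -> : 3 / 2 * (w - p * u) ^+ 2 = w ^+ 2 * (3 / 2 * (1 - p * s) ^+ 2) by rewrite us; ring.
rewrite ler_wpM2l ?sqr_ge0//; apply: (le_trans (defect_le_3half s)); nra.
Qed.

Lemma loss_le_shift u w : loss u w <= 1 / 50 * w ^+ 2 + 9 / 50 * (u - 69 / 20 * w) ^+ 2.
Proof.
apply: (@loss_le (fun s => 1 / 50 + 9 / 50 * (s - 69 / 20) ^+ 2)).
- by rewrite addr_ge0// mulr_ge0 ?sqr_ge0.
- move=> s _; have [s0|s0] := lerP s 0; last by rewrite defect_le_parabola// ltW.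
  have /andP[_ h] := defect_neg s0; apply: (le_trans h).
  by rewrite addr_ge0// mulr_ge0 ?sqr_ge0.
- by move=> s -> _; ring.
Qed.

(** The vertex 69/20 of the parabola is replaced by 1 / p, so that the square again comes from the
    orthogonal component. As 69/20 times 7/25 is below 1, the new square dominates on [0, 69/20];
    further right the floor 1/50 is enough. *)
Lemma loss_le_shrink u w (p : R) : 0 <= p <= 7 / 25 ->
  loss u w <= 1 / 50 * w ^+ 2 + 9 / 50 * (69 / 20) ^+ 2 * (w - p * u) ^+ 2.
Proof.
move=> /andP[p0 p1].
apply: (@loss_le (fun s => 1 / 50 + 9 / 50 * (69 / 20) ^+ 2 * (1 - p * s) ^+ 2)).
- by have := sqr_ge0 w; have := sqr_ge0 (w - p * u); lra.
- have q0 (s : R) : 0 <= 9 / 50 * (69 / 20) ^+ 2 * (1 - p * s) ^+ 2.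
    by have := sqr_ge0 (1 - p * s); lra.
  move=> s _; have [s0|s0] := lerP s 0.
    have /andP[_ h] := defect_neg s0; apply: (le_trans h).
    by rewrite addr_ge0.
  have [s1|s1] := lerP s (69 / 20).
    apply: (le_trans (defect_le_parabola (ltW s0))).
    have h : 69 / 20 * (p * s) <= s by nra.
    have : 0 <= (s - 69 / 20 * (p * s)) * (69 / 20 - s + (69 / 20 - 69 / 20 * (p * s))).
      by apply: mulr_ge0; lra.
    by lra.
  apply: (@le_trans _ _ (1 / 50)); last by rewrite lerDl.
  by apply: (@defect_le_beyond _ (31 / 10)); lra.
- by move=> s -> _; ring.
Qed.

Lemma triform_tri (e f g k : R) s w : w ^+ 2 * tri e f g k s = triform e f g k (s * w) w.
Proof.
rewrite /tri /triform maxr_pMr ?sqr_ge0// minr_pMr ?sqr_ge0// mulr0.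
by congr (Num.max _ (Num.min _ _)); ring.
Qed.

Lemma loss_le_hat u w : loss u w <= 2 / 5 * w ^+ 2 + triform 2 (1 / 5) (9 / 5) (9 / 10) u w.
Proof.
apply: (@loss_le (fun s => 2 / 5 + tri 2 (1 / 5) (9 / 5) (9 / 10) s)).
- by rewrite addr_ge0 ?triform_ge0// mulr_ge0 ?sqr_ge0.
- by move=> s _; exact: defect_le_hat.
- by move=> s -> _; rewrite mulrDr triform_tri mulrC.
Qed.

Lemma loss_le_parabola_hat u w : loss u w <=
  1 / 20 * (u + 5 / 2 * w) ^+ 2 + triform (17 / 10) (4 / 25) (7 / 5) (5 / 4) u w.
Proof.
apply: (@loss_le (fun s => 1 / 20 * (s + 5 / 2) ^+ 2 + tri (17 / 10) (4 / 25) (7 / 5) (5 / 4) s)).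
- by rewrite addr_ge0 ?triform_ge0// mulr_ge0 ?sqr_ge0.
- by move=> s _; exact: defect_le_parabola_hat.
- by move=> s -> _; rewrite mulrDr triform_tri; congr (_ + _); ring.
Qed.

(** For r = |h| <= 1/20, multiplying the argument by 20 r moves it towards 0, where the symmetric
    hat is larger. The resulting form is free of [r], so a single hat, evaluated at the unit vector
    h / |h|, serves all small h. *)
Lemma loss_le_wide_hat (r : R) u w : 0 < r <= 1 / 20 -> loss u (r * w) <=
  r ^+ 2 * (1 / 10 * w ^+ 2 + triform 15 (- (1 / 5)) (1 / 5) 15 u w).
Proof.
move=> /andP[r0 r1]; pose s1 (s : R) := 20 * r * s.
apply: (@loss_le (fun s => 1 / 10 + tri (3 / 4) (- 4) 4 (3 / 4) (s1 s))).
- by rewrite mulr_ge0 ?sqr_ge0// addr_ge0 ?triform_ge0// mulr_ge0 ?sqr_ge0.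
- move=> s _; apply: (le_trans (defect_le_wide_hat s)); rewrite lerD2l /tri ge_max le_max lexx/=.
  rewrite le_max; apply/orP; right; rewrite le_min !ge_min /s1.
  have [s0|s0] := lerP s 0.
    have : s <= 20 * r * s by nra.
    have : 20 * r * s <= 0 by nra.
    by move=> h1 h2; apply/andP; split; apply/orP; left; lra.
  have : 20 * r * s <= s by nra.
  have : 0 <= 20 * r * s by rewrite !mulr_ge0// ltW.
  by move=> h1 h2; apply/andP; split; apply/orP; right; lra.
- move=> s us w0.
  rewrite mulrDr (triform_tri _ _ _ _ (s1 s) (r * w)) us mulrDr; congr (_ + _); first by ring.
  rewrite /triform maxr_pMr ?sqr_ge0// minr_pMr ?sqr_ge0// mulr0 /s1.
  by congr (Num.max _ (Num.min _ _)); field.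
Qed.

End Loss.

(** * Numerical inequalities on the pieces of the region *)

Section RegionCases.
Context {R : realType}.
Implicit Types r p t : R.
(* [K] is the upper isometry constant, [d0] a lower bound of
   [sqrt (|h|^2 - (x^T h)^2)] wherever a hat is used, and [del] the allowed deviation. *)
Let K : R := 1001 / 1000.
Let d0 : R := (1 / 20) ^+ 2 / 2.
Let del : R := (1 / 100) ^+ 2 / 10.

(** Throughout, r = |h|, p = x^T h, and t is the length of the component of h orthogonal to x. Here
    t^2 <= 0.64 r^2, and 1.5 times 0.64 is 0.96. *)
Lemma case_projection r p : 0 < r -> p <= - (6 / 10) * r ->
  p <= 0 /\ 3 / 2 * K * (r ^+ 2 - p ^+ 2) <= 98 / 100 * r ^+ 2.
Proof.
move=> r0 pr; have p0 : p <= 0 by lra.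
split=> //; have : 0 <= (- p - 6 / 10 * r) * (- p + 6 / 10 * r) by apply: mulr_ge0; lra.
by have := sqr_ge0 r; rewrite /K; lra.
Qed.

Lemma case_shrink r p : 0 < r -> p <= r -> 4 / 5 * r <= p -> r <= 7 / 25 ->
  0 <= p <= 7 / 25 /\
  K * (1 / 50 * r ^+ 2 + 9 / 50 * (69 / 20) ^+ 2 * (r ^+ 2 - p ^+ 2)) <= 98 / 100 * r ^+ 2.
Proof.
move=> r0 pr rp r1; split; first by apply/andP; split; lra.
have : 0 <= (p - 4 / 5 * r) * (p + 4 / 5 * r) by apply: mulr_ge0; lra.
by have := sqr_ge0 r; rewrite /K; lra.
Qed.

(** As r^2 <= 21/20 t, the hat costs about 0.54 r^2 and the floor 0.4 r^2. With r >= 1/20 this also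
    gives t >= d0, and [del] fits into the remaining slack. *)
Lemma case_hat r t : 1 / 20 <= r -> 0 <= t -> r ^+ 2 <= 21 / 20 * t ->
  d0 ^+ 2 <= t ^+ 2 /\
  2 / 5 * K * r ^+ 2 + 20 / 31 * (576 / 725) * (r ^+ 2) ^+ 2 / t + del <= 98 / 100 * r ^+ 2.
Proof.
move=> r1 t0 rt; have r2 : (1 / 20) ^+ 2 <= r ^+ 2 by rewrite ler_sqr ?nnegrE//; lra.
have t1 : (1 / 20) ^+ 2 / 2 <= t by lra.
split; first by apply: lerXn2r => //; rewrite ?nnegrE /d0; lra.
have : 20 / 31 * (576 / 725) * (r ^+ 2) ^+ 2 / t <= 20 / 31 * (576 / 725) * (21 / 20) * r ^+ 2.
  rewrite ler_pdivrMr; last by lra.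
  have : r ^+ 2 * r ^+ 2 <= r ^+ 2 * (21 / 20 * t) by rewrite ler_pM2l//; lra.
  by lra.
by rewrite /K /del; lra.
Qed.

Lemma case_wide_hat r p : 0 < r <= 1 / 20 -> - (6 / 10) * r < p < 4 / 5 * r ->
  [/\ r ^+ 2 <= (1 / 20) ^+ 2, p ^+ 2 <= (4 / 5) ^+ 2 * r ^+ 2 &
  (1 / 10 * K + 20 / 31 + del) * r ^+ 2 <= 98 / 100 * r ^+ 2].
Proof.
move=> /andP[r0 r1] /andP[p1 p2]; split.
- by rewrite ler_sqr ?nnegrE//; lra.
- have : 0 <= (4 / 5 * r - p) * (4 / 5 * r + p) by apply: mulr_ge0; lra.
  by lra.
- by rewrite ler_pM2r ?exprn_gt0// /K /del; lra.
Qed.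

Lemma case_shift r p t : 7 / 25 <= r <= 6 / 10 -> 4 / 5 * r <= p -> 0 <= t ->
  t ^+ 2 = r ^+ 2 - p ^+ 2 -> 21 / 20 * t <= r ^+ 2 ->
  K * (1 / 50 * r ^+ 2 + 9 / 50 * (1 - 69 / 10 * p + (69 / 20) ^+ 2 * r ^+ 2)) <=
  98 / 100 * r ^+ 2.
Proof.
move=> /andP[r1 r2] rp t0 tE tr.
have h1 : (7 / 25) ^+ 2 <= r ^+ 2 by rewrite ler_sqr ?nnegrE//; lra.
have h2 : r ^+ 2 <= (6 / 10) ^+ 2 by rewrite ler_sqr ?nnegrE//; lra.
have h3 : (21 / 20 * t) ^+ 2 <= (r ^+ 2) ^+ 2.
  have := sqr_ge0 r; rewrite ler_sqr ?nnegrE//; lra.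
rewrite exprMn tE in h3.
have h4 : 0 <= (r ^+ 2 - (7 / 25) ^+ 2) * ((6 / 10) ^+ 2 - r ^+ 2).
  by apply: mulr_ge0; lra.
(* With this bound the bracket is at most 5.3 r^2, and 0.02 + 0.18 times 5.3 is 0.974. *)
have : 1 + 2641 / 400 * r ^+ 2 <= 69 / 10 * p.
  by rewrite -ler_sqr ?nnegrE; lra.
by rewrite /K; lra.
Qed.

(** A bootstrap: |p| <= 0.8 r gives t >= 0.6 r, hence r >= 0.63; now the excluded region forces p <
    0.6 r, so t >= 0.8 r and r >= 0.84. On this short range a cubic inequality in [r] remains. *)
Lemma case_parabola_hat r p t : 0 < r <= 1 -> 0 <= t -> t ^+ 2 = r ^+ 2 - p ^+ 2 ->
  21 / 20 * t <= r ^+ 2 -> - (6 / 10) * r < p < 4 / 5 * r ->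
  ~ (6 / 10 * r <= p /\ 6 / 10 <= r) -> d0 ^+ 2 <= t ^+ 2 /\
  1 / 20 * K * (1 + 5 * p + 25 / 4 * r ^+ 2) +
    20 / 31 * (961 / 1250 * (85 / 118)) * (r ^+ 2) ^+ 2 / t + del <= 98 / 100 * r ^+ 2.
Proof.
move=> /andP[r0 r1] t0 tE tr /andP[p1 p2] hreg.
have t1 : 6 / 10 * r <= t.
  rewrite -ler_sqr ?nnegrE ?mulr_ge0 ?(ltW r0)// tE.
  have : 0 <= (4 / 5 * r - p) * (4 / 5 * r + p) by apply: mulr_ge0; lra.
  by lra.
have r2 : 63 / 100 <= r.
  by rewrite -(ler_pM2r r0); lra.
have p3 : p < 6 / 10 * r.
  by rewrite ltNge; apply/negP => h; apply: hreg; split => //; lra.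
have t2 : 4 / 5 * r <= t.
  rewrite -ler_sqr ?nnegrE ?mulr_ge0 ?(ltW r0)// tE.
  have : 0 <= (6 / 10 * r - p) * (6 / 10 * r + p) by apply: mulr_ge0; lra.
  by lra.
have r3 : 84 / 100 <= r.
  by rewrite -(ler_pM2r r0); lra.
have tp : 0 < t by lra.
split; first by apply: lerXn2r => //; rewrite ?nnegrE /d0; lra.
have : (r ^+ 2) ^+ 2 / t <= 5 / 4 * r ^+ 3.
  rewrite ler_pdivrMr//.
  have : 5 / 4 * r ^+ 3 * (4 / 5 * r) <= 5 / 4 * r ^+ 3 * t.
    by rewrite ler_wpM2l// mulr_ge0// exprn_ge0// ltW.
  by lra.
rewrite -[X in _ + X + _]mulrA; set q := _ / t => hq.
have h1 : 0 <= (1 - r) * (r - 84 / 100) by apply: mulr_ge0; lra.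
have h2 : 0 <= r * ((1 - r) * (r - 84 / 100)) by rewrite mulr_ge0 ?(ltW r0).
by rewrite /K /del; lra.
Qed.

End RegionCases.

Section SumLoss.
Context {R : realType} {n m : nat}.
Variables (a : 'I_m -> 'cV[R]_n) (x : 'cV[R]_n).
Hypothesis x1 : dotv x x = 1.
Let K : R := 1001 / 1000.
Hypothesis qub : forall y, qform a y <= K * m%:R * dotv y y.
Let d0 : R := (1 / 20) ^+ 2 / 2.
Let del : R := (1 / 100) ^+ 2 / 10.
Let hat_bound (e f g k : R) := forall h : 'cV[R]_n, dotv h h <= 1 ->
  d0 ^+ 2 <= dotv h h - dotv x h ^+ 2 ->
  \sum_i triform e f g k (dotv (a i) x) (dotv (a i) h) <=
  (20 / 31 * hatarea e f g k * dotv h h ^+ 2 / Num.sqrt (dotv h h - dotv x h ^+ 2) + del) * m%:R.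
Hypothesis hat_central : hat_bound 2 (1 / 5) (9 / 5) (9 / 10).
Hypothesis hat_narrow : hat_bound (17 / 10) (4 / 25) (7 / 5) (5 / 4).
Hypothesis hat_wide : hat_bound 15 (- (1 / 5)) (1 / 5) 15.

Let S h := \sum_i loss (dotv (a i) x) (dotv (a i) h).
Let M : R := m%:R.
Let M0 : 0 <= M. Proof. by []. Qed.

Lemma sum_loss_projection h : dotv x h <= 0 ->
  S h <= 3 / 2 * K * M * (dotv h h - dotv x h ^+ 2).
Proof.
move=> p0; apply: (@le_trans _ _ (3 / 2 * qform a (h - dotv x h *: x))).
  rewrite /qform mulr_sumr; apply: ler_sum => i _.
  by rewrite dotvBr dotvZr; exact: loss_le_projection.
have -> : dotv h h - dotv x h ^+ 2 = dotv (h - dotv x h *: x) (h - dotv x h *: x).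
  by rewrite !(dotvBr, dotvBl, dotvZl, dotvZr) x1 (dotvC h x); ring.
by have := qub (h - dotv x h *: x); rewrite -/M; lra.
Qed.

Lemma sum_loss_shrink h : 0 <= dotv x h <= 7 / 25 ->
  S h <= K * M * (1 / 50 * dotv h h +
    9 / 50 * (69 / 20) ^+ 2 * (dotv h h - dotv x h ^+ 2)).
Proof.
move=> p0; apply: (@le_trans _ _ (1 / 50 * qform a h +
    9 / 50 * (69 / 20) ^+ 2 * qform a (h - dotv x h *: x))).
  rewrite /qform 2!mulr_sumr -big_split; apply: ler_sum => i _.
  by rewrite dotvBr dotvZr; exact: loss_le_shrink.
have -> : dotv h h - dotv x h ^+ 2 = dotv (h - dotv x h *: x) (h - dotv x h *: x).
  by rewrite !(dotvBr, dotvBl, dotvZl, dotvZr) x1 (dotvC h x); ring.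
by have := qub (h - dotv x h *: x); have := qub h; rewrite -/M; lra.
Qed.

Lemma sum_loss_shift h : S h <= K * M * (1 / 50 * dotv h h +
    9 / 50 * (1 - 69 / 10 * dotv x h + (69 / 20) ^+ 2 * dotv h h)).
Proof.
apply: (@le_trans _ _ (1 / 50 * qform a h + 9 / 50 * qform a (x - (69 / 20) *: h))).
  rewrite /qform 2!mulr_sumr -big_split; apply: ler_sum => i _.
  by rewrite dotvBr dotvZr; exact: loss_le_shift.
have -> : 1 - 69 / 10 * dotv x h + (69 / 20) ^+ 2 * dotv h h =
    dotv (x - (69 / 20) *: h) (x - (69 / 20) *: h).
  by rewrite !(dotvBr, dotvBl, dotvZl, dotvZr) x1 (dotvC h x); field.
by have := qub (x - (69 / 20) *: h); have := qub h; rewrite -/M; lra.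
Qed.

Lemma sum_loss_hat h : dotv h h <= 1 -> d0 ^+ 2 <= dotv h h - dotv x h ^+ 2 ->
  S h <= M * (2 / 5 * K * dotv h h +
    20 / 31 * (576 / 725) * dotv h h ^+ 2 / Num.sqrt (dotv h h - dotv x h ^+ 2) + del).
Proof.
move=> h1 hD; have := hat_central h1 hD; set T := \sum_i _ => hT.
apply: (@le_trans _ _ (2 / 5 * qform a h + T)).
  rewrite /qform mulr_sumr -big_split; apply: ler_sum => i _.
  exact: loss_le_hat.
have HC : hatarea 2 (1 / 5) (9 / 5) (9 / 10) = 576 / 725 :> R by rewrite /hatarea; field.
by move: hT; rewrite HC -/M; have := qub h; rewrite -/M; lra.
Qed.

Lemma sum_loss_parabola_hat h : dotv h h <= 1 -> d0 ^+ 2 <= dotv h h - dotv x h ^+ 2 ->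
  S h <= M * (1 / 20 * K * (1 + 5 * dotv x h + 25 / 4 * dotv h h) +
    20 / 31 * (961 / 1250 * (85 / 118)) * dotv h h ^+ 2 / Num.sqrt (dotv h h - dotv x h ^+ 2) + del).
Proof.
move=> h1 hD; have := hat_narrow h1 hD; set T := \sum_i _ => hT.
apply: (@le_trans _ _ (1 / 20 * qform a (x + (5 / 2) *: h) + T)).
  rewrite /qform mulr_sumr -big_split; apply: ler_sum => i _.
  by rewrite dotvDr dotvZr; exact: loss_le_parabola_hat.
have HC : hatarea (17 / 10) (4 / 25) (7 / 5) (5 / 4) = 961 / 1250 * (85 / 118) :> R by rewrite /hatarea; field.
have hx : 1 + 5 * dotv x h + 25 / 4 * dotv h h = dotv (x + (5 / 2) *: h) (x + (5 / 2) *: h).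
  by rewrite !(dotvDr, dotvDl, dotvZl, dotvZr) x1 (dotvC h x); field.
by move: hT; rewrite hx HC -/M; have := qub (x + (5 / 2) *: h); rewrite -/M; lra.
Qed.

(** At a small [h] the orthogonal component may be below [d0], so the hat bound is applied at h /
    |h|, where that component is at least 3/5. The hat has area 3/5 as well, which leaves 20/31. *)
Lemma sum_loss_wide_hat h : h != 0 -> dotv h h <= (1 / 20) ^+ 2 ->
  dotv x h ^+ 2 <= (4 / 5) ^+ 2 * dotv h h ->
  S h <= M * (1 / 10 * K + 20 / 31 + del) * dotv h h.
Proof.
move=> hn0 hr hp; have q0 : 0 < dotv h h by rewrite lt_def dotvv_eq0 hn0 dotvv_ge0.
pose r := enorm h; have r2 : r ^+ 2 = dotv h h by exact: sqr_enorm.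
have r0 : 0 < r by rewrite sqrtr_gt0.
have r1 : r <= 1 / 20.
  by rewrite -ler_sqr ?nnegrE ?(ltW r0)// r2.
pose h' := r^-1 *: h; have hE : h = r *: h' by rewrite scalerA divff ?gt_eqF// scale1r.
have h'1 : dotv h' h' = 1.
  by rewrite dotvZl dotvZr -r2; field; rewrite gt_eqF.
have hp' : dotv x h' ^+ 2 <= (4 / 5) ^+ 2.
  by move: hp; rewrite -r2 {1}hE dotvZr exprMn mulrC ler_pM2r// exprn_gt0.
have hD : (3 / 5) ^+ 2 <= dotv h' h' - dotv x h' ^+ 2 by rewrite h'1; lra.
have sD : 3 / 5 <= Num.sqrt (dotv h' h' - dotv x h' ^+ 2).
  by rewrite -[3 / 5]ger0_norm// -sqrtr_sqr ler_wsqrtr.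
have hd : d0 ^+ 2 <= dotv h' h' - dotv x h' ^+ 2 by rewrite /d0; lra.
have := hat_wide _ hd; rewrite h'1 lexx => /(_ isT); set T := \sum_i _ => hT.
apply: (@le_trans _ _ (r ^+ 2 * (1 / 10 * qform a h' + T))).
  rewrite /qform mulr_sumr -big_split /= mulr_sumr; apply: ler_sum => i _.
  by rewrite {1}hE dotvZr; apply: loss_le_wide_hat; rewrite r0.
rewrite [leRHS]mulrC r2 ler_pM2l//.
have HC : hatarea 15 (- (1 / 5)) (1 / 5) 15 = 3 / 5 :> R by rewrite /hatarea; field.
have : 20 / 31 * hatarea 15 (- (1 / 5)) (1 / 5) 15 * 1 ^+ 2 /
    Num.sqrt (1 - dotv x h' ^+ 2) <= 20 / 31.
  rewrite h'1 in sD; rewrite HC ler_pdivrMr; last by lra.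
  by lra.
set c := _ / Num.sqrt _ in hT *; move=> c1.
have : (c + del) * M <= (20 / 31 + del) * M by rewrite ler_wpM2r// lerD2r.
by have := qub h'; rewrite h'1 -/M; move: hT; rewrite -/M; lra.
Qed.

(** The pieces: p <= - 0.6 r is left to the projection. If r^2 <= 21/20 t, the orthogonal component
    supports a hat, rescaled when r <= 1/20 and replaced by a parabola if moreover p >= 0.8 r.
    Otherwise p >= 0.8 r calls for one of two parabolas, according to r, and the remaining
    directions for a parabola with a hat; there the excluded region comes in. *)
Lemma sum_loss_le h : h != 0 -> dotv h h <= 1 ->
  ~ (6 / 10 * enorm h <= dotv x h /\ 6 / 10 <= enorm h) ->
  S h <= 98 / 100 * M * dotv h h.
Proof.
move=> hn0 h1 hreg; have q0 : 0 < dotv h h by rewrite lt_def dotvv_eq0 hn0 dotvv_ge0.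
have := sum_loss_projection (h := h); have := sum_loss_shrink (h := h).
have := sum_loss_shift h; have := sum_loss_hat h1; have := sum_loss_parabola_hat h1.
have := sum_loss_wide_hat hn0.
have := dotv_cauchy x h; rewrite x1 mul1r.
move: hreg; rewrite -sqr_enorm.
have r0 : 0 < enorm h by rewrite sqrtr_gt0.
have r1 : enorm h <= 1.
  by rewrite -ler_sqr ?nnegrE ?(ltW r0)// sqr_enorm expr1n.
move: (enorm h) (dotv x h) (S h) r0 r1 => r p s r0 r1 {h hn0 h1 q0}.
move=> hreg pr HS HD HC HB HB' HA.
have t0 : 0 <= Num.sqrt (r ^+ 2 - p ^+ 2) by exact: sqrtr_ge0.
have tE : Num.sqrt (r ^+ 2 - p ^+ 2) ^+ 2 = r ^+ 2 - p ^+ 2 by rewrite sqr_sqrtr// subr_ge0.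
move: (Num.sqrt _) t0 tE HC HD => t t0 tE HC HD.
have r2 : 0 < r ^+ 2 by rewrite exprn_gt0.
suff [c hs hc] : exists2 c, s <= M * c & c <= 98 / 100 * r ^+ 2.
  by apply: (le_trans hs); rewrite -mulrA mulrCA ler_wpM2l.
have p_le : p <= r.
  by apply: (le_trans (ler_norm p)); rewrite -ler_sqr ?nnegrE ?(ltW r0)// real_normK ?num_real.
have [pA|pA] := lerP p (- (6 / 10) * r).
  have [p0 hc] := case_projection r0 pA; exists (3 / 2 * K * (r ^+ 2 - p ^+ 2)) => //.
  by rewrite [leRHS]mulrA [M * _]mulrC; apply: HA.
have shrink : 4 / 5 * r <= p -> r <= 7 / 25 -> exists2 c, s <= M * c & c <= 98 / 100 * r ^+ 2.
  move=> pB rB; have [p0 hc] := case_shrink r0 p_le pB rB; eexists; last exact: hc.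
  by rewrite [leRHS]mulrA [M * _]mulrC; exact: HB'.
have small : r <= 1 / 20 -> p < 4 / 5 * r -> exists2 c, s <= M * c & c <= 98 / 100 * r ^+ 2.
  move=> rS pS; have [||h1 h2 h3] := @case_wide_hat R r p; do ?[exact/andP].
  by eexists; last exact: h3; rewrite [leRHS]mulrA; exact: HS.
have [rC|/ltW rC] := lerP (r ^+ 2) (21 / 20 * t).
  have [rS|/ltW rS] := lerP (1 / 20) r.
    have [hd hc] := case_hat rS t0 rC; eexists; last exact: hc.
    by apply: HC; rewrite -tE.
  have [pB|pB] := lerP (4 / 5 * r) p; last exact: small.
  by apply: shrink => //; apply: (le_trans rS); lra.
have [pB|pB] := lerP (4 / 5 * r) p.
  have [rB|/ltW rB] := lerP r (7 / 25); first exact: shrink.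
  have r6 : r <= 6 / 10.
    rewrite leNgt; apply/negP => h; apply: hreg; split; last exact: ltW.
    by apply: le_trans pB; rewrite ler_pM2r//; lra.
  have hr : 7 / 25 <= r <= 6 / 10 by rewrite rB.
  eexists; last exact: (case_shift hr pB t0 tE rC).
  by rewrite [leRHS]mulrA [M * _]mulrC.
have hr : 0 < r <= 1 by rewrite r0.
have hp : - (6 / 10) * r < p < 4 / 5 * r by rewrite pA.
have [hd hc] := case_parabola_hat hr t0 tE rC hp hreg.
by eexists; last exact: hc; apply: HD; rewrite -tE.
Qed.

End SumLoss.

(** * One gradient step *)

Section Descent.
Context {R : realType} {n m : nat}.
Implicit Types (a : 'I_m -> 'cV[R]_n) (x z h : 'cV[R]_n).

(** The cross term gives - 4 mu c, and the square 4 mu^2 / m^2 times the bound 16 m^2 |h|^2 on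
    |G|^2. *)
Lemma grad_step_le a x z (mu c : R) (h := x - z) : (0 < m)%N -> 0 <= mu ->
  (forall y, qform a y <= 2 * m%:R * dotv y y) ->
  \sum_i loss (dotv (a i) x) (dotv (a i) h) <= qform a h - c * m%:R * dotv h h ->
  dotv (x - (z - (mu / m%:R) *: grad_l a x z)) (x - (z - (mu / m%:R) *: grad_l a x z)) <=
  (1 - 4 * mu * c + 64 * mu ^+ 2) * dotv h h.
Proof.
move=> m0 mu0 qub hl; have M0 : 0 < m%:R :> R by rewrite ltr0n.
pose r i := dotv (a i) z - dotv (a i) x * tanh_weight a x z i.
pose G := \sum_i r i *: a i.
have -> : x - (z - (mu / m%:R) *: grad_l a x z) = h + (2 * mu / m%:R) *: G.
  rewrite /grad_l -/G scalerA opprB addrCA addrC /h; congr (_ + _ *: _); ring.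
have zE i : dotv (a i) z = dotv (a i) x - dotv (a i) h by rewrite /h dotvBr; ring.
have wE i : dotv (a i) h = dotv (a i) x - dotv (a i) z by rewrite /h dotvBr.
clearbody h.
have hG : dotv h G <= - (c * m%:R * dotv h h).
  have -> : dotv h G = \sum_i loss (dotv (a i) x) (dotv (a i) h) - qform a h.
    rewrite dotv_sumr /qform -sumrB; apply: eq_bigr => i _.
    by rewrite dotvZr (dotvC h) wE; exact: residual_weight.
  by lra.
have GG : dotv G G <= 16 * m%:R ^+ 2 * dotv h h.
  (* |G|^2 = sum_i r_i a_i^T G is split so that the quadratic form at [G] returns only half of
     |G|^2, which the left side absorbs. *)
  have : dotv G G <= m%:R * (4 * qform a h) + (4 * m%:R)^-1 * qform a G.
    rewrite {1}[in X in dotv _ X]/G dotv_sumr /qform !mulr_sumr -big_split.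
    apply: ler_sum => i _; rewrite dotvZr (dotvC G) /=.
    set g := dotv (a i) G.
    have h1 : r i ^+ 2 <= 4 * dotv (a i) h ^+ 2 by rewrite wE; exact: residual_weight_sq.
    apply: (@le_trans _ _ (m%:R * r i ^+ 2 + (4 * m%:R)^-1 * g ^+ 2)); last first.
      by rewrite lerD2r ler_pM2l.
    rewrite -subr_ge0.
    have -> : m%:R * r i ^+ 2 + (4 * m%:R)^-1 * g ^+ 2 - r i * g =
        (2 * m%:R * r i - g) ^+ 2 / (4 * m%:R) by field; rewrite gt_eqF.
    by rewrite divr_ge0 ?sqr_ge0// mulr_ge0// ltW.
  have h1 : m%:R * (4 * qform a h) <= m%:R * (4 * (2 * m%:R * dotv h h)).
    by rewrite ler_pM2l// ler_pM2l.
  have h2 : (4 * m%:R)^-1 * qform a G <= 1 / 2 * dotv G G.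
    rewrite ler_pdivrMl ?mulr_gt0//; apply: (le_trans (qub G)).
    by lra.
  by lra.
rewrite dotvDl !dotvDr !dotvZl !dotvZr (dotvC G h).
have h1 : 2 * mu / m%:R * dotv h G <= - (2 * mu * c * dotv h h).
  have -> : - (2 * mu * c * dotv h h) = 2 * mu / m%:R * - (c * m%:R * dotv h h).
    by field; rewrite gt_eqF.
  by rewrite ler_wpM2l// divr_ge0 ?mulr_ge0// ltW.
have h2 : 2 * mu / m%:R * (2 * mu / m%:R * dotv G G) <= 64 * mu ^+ 2 * dotv h h.
  have -> : 64 * mu ^+ 2 * dotv h h =
      2 * mu / m%:R * (2 * mu / m%:R * (16 * m%:R ^+ 2 * dotv h h)).
    by field; rewrite gt_eqF.
  by rewrite !ler_wpM2l// divr_ge0 ?mulr_ge0// ltW.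
by lra.
Qed.

(** For |h| <= |x| the nearer of x and - x to z is x: |2 x - h| >= |h| amounts to x^T h <= x^T x. *)
Lemma dist_sqr_ge x z : enorm (x - z) <= enorm x ->
  dotv (x - z) (x - z) <= dist z x ^+ 2.
Proof.
set h := x - z => hx.
have x0 := enorm_ge0 x; have h0 := enorm_ge0 h.
rewrite -sqr_enorm lerXn2r ?nnegrE//; first by rewrite /dist le_min !enorm_ge0.
rewrite /dist le_min; apply/andP; split.
  by rewrite ler_wsqrtr// -[z - x]opprB -/h dotvNl dotvNr opprK.
rewrite ler_wsqrtr//.
have -> : z + x = 2 *: x - h by rewrite /h opprB scaler_nat mulr2n [RHS]addrC [RHS]addrA subrK.
clearbody h; rewrite !(dotvBl, dotvBr, dotvZl, dotvZr) (dotvC h x).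
suff : dotv x h <= dotv x x by lra.
apply: (le_trans (ler_norm _)); rewrite -ler_sqr ?nnegrE ?dotvv_ge0// real_normK ?num_real//.
apply: (le_trans (dotv_cauchy _ _)); rewrite expr2 ler_wpM2l ?dotvv_ge0//.
by rewrite -!sqr_enorm lerXn2r.
Qed.

Lemma dist_sqr_le x z : dist z x ^+ 2 <= dotv (x - z) (x - z).
Proof.
rewrite -[x - z]opprB dotvNl dotvNr opprK -sqr_enorm lerXn2r ?nnegrE ?enorm_ge0//.
  by rewrite /dist le_min !enorm_ge0.
by rewrite /dist ge_min lexx.
Qed.

End Descent.

(** Reduction to |x| = 1 by homogeneity; 0.999 - 0.98 exceeds the claimed rate 0.01. *)
Lemma sum_loss_gap (R : realType) n m (a : 'I_m -> 'cV[R]_n) (x h : 'cV[R]_n)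
    (xh := (enorm x)^-1 *: x) (hh := (enorm x)^-1 *: h) : x != 0 ->
  (h != 0 -> \sum_i loss (dotv (a i) xh) (dotv (a i) hh) <= 98 / 100 * m%:R * dotv hh hh) ->
  999 / 1000 * m%:R * dotv h h <= qform a h ->
  \sum_i loss (dotv (a i) x) (dotv (a i) h) <= qform a h - 1 / 100 * m%:R * dotv h h.
Proof.
move=> xn0 hs hq; have [h0|hn0] := eqVneq h 0.
  have d0 (u : 'cV[R]_n) : dotv u 0 = 0 by rewrite /dotv mulmx0 mxE.
  rewrite big1 => [|i _]; last by rewrite h0 d0 /loss expr0n mul0r.
  by rewrite h0 d0 mulr0 subr0 qform_ge0.
have x0 : enorm x != 0 by rewrite -sqrf_eq0 sqr_enorm dotvv_eq0.
have -> : \sum_i loss (dotv (a i) x) (dotv (a i) h) =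
    enorm x ^+ 2 * \sum_i loss (dotv (a i) xh) (dotv (a i) hh).
  rewrite mulr_sumr; apply: eq_bigr => i _.
  by rewrite -lossZ// -!dotvZr !scalerA divff// !scale1r.
have x2 : 0 < enorm x ^+ 2 by rewrite lt_def sqrf_eq0 x0 sqr_ge0.
have e1 : enorm x ^+ 2 * (98 / 100 * m%:R * dotv hh hh) = 98 / 100 * m%:R * dotv h h.
  by rewrite /hh dotvZl dotvZr; field.
have : enorm x ^+ 2 * \sum_i loss (dotv (a i) xh) (dotv (a i) hh) <= 98 / 100 * m%:R * dotv h h.
  by rewrite -e1 ler_pM2l//; exact: hs.
have : 0 <= m%:R * dotv h h by rewrite mulr_ge0// dotvv_ge0.
by lra.
Qed.

(** The factor 5 counts two for the isometry and one for each of the three hats. *)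
Lemma loss_event (R : realType) : exists c0 c2 : R, [/\ 0 < c0, 0 < c2 &
  forall (n m : nat) (d : measure_display) (T : measurableType d) (P : probability T R)
    (X : 'I_m -> {RV P >-> borelV R n}) (x : 'cV[R]_n),
  (0 < n)%N -> (0 < m)%N -> (forall i, standard_gaussian (X i)) ->
  mutually_independent X -> c0 * n%:R <= m%:R -> dotv x x = 1 ->
  exists E : set T, [/\ measurable E, ((1 - 5 * expR (- c2 * m%:R))%:E <= P E)%E &
    forall w, E w -> let a i : 'cV[R]_n := X i w in
    [/\ forall y, 999 / 1000 * m%:R * dotv y y <= qform a y,
        forall y, qform a y <= 2 * m%:R * dotv y y &
        forall h, h != 0 -> dotv h h <= 1 ->
        ~ (6 / 10 * enorm h <= dotv x h /\ 6 / 10 <= enorm h) ->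
        \sum_i loss (dotv (a i) x) (dotv (a i) h) <= 98 / 100 * m%:R * dotv h h]]].
Proof.
pose d0 : R := (1 / 20) ^+ 2 / 2; pose del : R := (1 / 100) ^+ 2 / 10.
have d00 : 0 < d0 by rewrite /d0; lra.
have del01 : 0 < del <= 1 by rewrite /del; lra.
have [cr [er [cr0 er0 hR]]] := @rip_event R (1 / 1000) ltac:(lra).
have [cC [eC [cC0 eC0 hC]]] := @triform_event R 2 (1 / 5) (9 / 5) (9 / 10) del d0
  ltac:(lra) ltac:(lra) ltac:(lra) del01 d00.
have [cD [eD [cD0 eD0 hD]]] := @triform_event R (17 / 10) (4 / 25) (7 / 5) (5 / 4) del d0
  ltac:(lra) ltac:(lra) ltac:(lra) del01 d00.
have [cS [eS [cS0 eS0 hS]]] := @triform_event R 15 (- (1 / 5)) (1 / 5) 15 del d0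
  ltac:(lra) ltac:(lra) ltac:(lra) del01 d00.
pose c0 := cr + (cC + (cD + cS)); pose c2 := Num.min er (Num.min eC (Num.min eD eS)).
have pc0 : 0 < c0 by rewrite /c0 !addr_gt0.
have pc2 : 0 < c2 by rewrite /c2 !lt_min er0 eC0 eD0.
exists c0, c2; split=> // n m d T P a x n0 m0 ga ia hm x1.
have hle c : c <= c0 -> c * n%:R <= m%:R by move=> hc; apply: le_trans hm; rewrite ler_wpM2r.
have rc0 : cr <= c0 by rewrite /c0 lerDl !addr_ge0// ltW.
have Cc0 : cC <= c0 by rewrite /c0; lra.
have Dc0 : cD <= c0 by rewrite /c0; lra.
have Sc0 : cS <= c0 by rewrite /c0; lra.
have [ER [mER PER hER]] := hR n m d T P a n0 m0 ga ia (hle cr rc0).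
have [EC [mEC PEC hEC]] := hC n m d T P a x n0 m0 ga ia (hle cC Cc0) x1.
have [ED [mED PED hED]] := hD n m d T P a x n0 m0 ga ia (hle cD Dc0) x1.
have [ES [mES PES hES]] := hS n m d T P a x n0 m0 ga ia (hle cS Sc0) x1.
exists (ER `&` (EC `&` (ED `&` ES))); split.
- by do 3?[apply: measurableI => //].
- have := probability_setI_ge mER (measurableI _ _ mEC (measurableI _ _ mED mES)) PER
    (probability_setI_ge mEC (measurableI _ _ mED mES) PEC
      (probability_setI_ge mED mES PED PES)).
  apply: le_trans; rewrite lee_fin lerD2l lerN2.
  have hexp e : c2 <= e -> expR (- e * m%:R) <= expR (- c2 * m%:R).
    by move=> he; rewrite ler_expR ler_wpM2r// lerN2.
  have -> : 5 * expR (- c2 * m%:R) = 2 * expR (- c2 * m%:R) +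
      (expR (- c2 * m%:R) + (expR (- c2 * m%:R) + expR (- c2 * m%:R))) by ring.
  by rewrite !lerD ?ler_pM2l// hexp// /c2 !ge_min lexx ?orbT.
move=> w [wR [wC [wD wS]]] b.
have rip y := hER w wR y.
have qub y : qform b y <= 1001 / 1000 * m%:R * dotv y y.
  case/andP: (rip y) => _ /le_trans; apply; apply: ler_wpM2r; first exact: dotvv_ge0.
  by apply: ler_wpM2r => //; clear; lra.
have qub2 y : qform b y <= 2 * m%:R * dotv y y.
  apply: (le_trans (qub y)); apply: ler_wpM2r; first exact: dotvv_ge0.
  by apply: ler_wpM2r => //; clear; lra.
split=> // [y|h]; last exact: (sum_loss_le x1 qub (hEC w wC qub2) (hED w wD qub2) (hES w wS qub2)).
case/andP: (rip y) => /(le_trans _) h _; apply: h; apply: ler_wpM2r; first exact: dotvv_ge0.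
by apply: ler_wpM2r => //; clear; lra.
Qed.

Theorem theorem3 (R : realType) :
  exists c0 c1 c2 mu0 : R,
    [/\ 0 < c0, 0 < c1, 0 < c2 & 0 < mu0] /\
    forall mu : R, 0 < mu < mu0 ->
    exists rho0 : R, 0 < rho0 < 1 /\
    forall (n m : nat) (x : 'cV[R]_n),
      x != 0 ->
      c0 * n%:R <= m%:R ->
    forall (d : measure_display) (T : measurableType d) (P : probability T R)
      (a : 'I_m -> {RV P >-> borelV R n}),
      (forall i : 'I_m, standard_gaussian (a i)) ->
      mutually_independent a ->
    exists E : set T,
      [/\ measurable E,
          ((1 - c1 * expR (- c2 * m%:R))%:E < P E)%E &
          forall w : T, E w ->
          forall z : 'cV[R]_n,
            let h := x - z in
            enorm h <= enorm x ->
            ~ (dotv x h / (enorm x * enorm h) \in `[6 / 10, 1] /\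
               enorm h / enorm x \in `[6 / 10, 1]) ->
            dist (z - (mu / m%:R) *: grad_l (fun i => a i w) x z) x ^+ 2
              <= (1 - rho0) * dist z x ^+ 2].
Proof.
have [c0 [c2 [pc0 pc2 good]]] := loss_event R.
(* 6 > 5 makes the probability bound strict. For mu < 1/3600 one has 64 mu^2 <= mu / 50, so 1 - mu /
   25 + 64 mu^2 is at most 1 - mu / 50. *)
exists c0, 6, c2, ((1 / 60) ^+ 2); split; first by rewrite exprn_gt0.
move=> mu /andP[mu0 mu1].
have mu50 : 0 < mu / 50 < 1 by lra.
exists (mu / 50); split => // n m x xn0 hm d T P a ga ia.
have n0 : (0 < n)%N.
  by rewrite lt0n; apply/negP => /eqP n0; subst n; rewrite (flatmx0 x) eqxx in xn0.
have m0 : (0 < m)%N.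
  by rewrite -(ltr0n R); apply: lt_le_trans hm; rewrite mulr_gt0 ?ltr0n.
have x0 : enorm x != 0 by rewrite -sqrf_eq0 sqr_enorm dotvv_eq0.
have x0' : 0 < enorm x by rewrite lt_def x0 enorm_ge0.
pose xh := (enorm x)^-1 *: x.
have xh1 : dotv xh xh = 1 by rewrite /xh dotvZl dotvZr -sqr_enorm; field.
have [E [mE PE hE]] := good n m d T P a xh n0 m0 ga ia hm xh1.
exists E; split=> //.
  apply: lt_le_trans PE; rewrite lte_fin ltrD2l ltrN2 ltr_pM2r ?expR_gt0//.
  by rewrite ltr_nat.
move=> w Ew z h hx hreg; have [qlb qub hloss] := hE w Ew.
apply: (le_trans (dist_sqr_le _ _)).
have hgap : \sum_i loss (dotv (a i w : 'cV[R]_n) x) (dotv (a i w : 'cV[R]_n) h) <=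
    qform (fun i => a i w : 'cV[R]_n) h - 1 / 100 * m%:R * dotv h h.
  apply: sum_loss_gap => //.
  move=> hn0; rewrite -/xh; set hh := _ *: h.
  have hhn0 : hh != 0 by rewrite scaler_eq0 invr_eq0 (negbTE x0).
  have ehh : enorm hh = enorm h / enorm x.
    rewrite /enorm /hh dotvZl dotvZr mulrA -expr2 sqrtrM ?sqr_ge0// sqrtr_sqr.
    by rewrite ger0_norm ?invr_ge0 ?enorm_ge0// mulrC.
  have ehh1 : enorm hh <= 1 by rewrite ehh ler_pdivrMr// mul1r.
  apply: hloss => //; first by rewrite -sqr_enorm expr_le1// enorm_ge0.
  (* Cauchy-Schwarz and |h| <= |x| supply the upper ends 1 of the two intervals, so the lower bounds
     contradict the hypothesis on the region. *)
  move=> [h1 h2]; apply: hreg; rewrite -ehh !in_itv/= h2 ehh1; split=> //.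
  have h0 : 0 < enorm h by rewrite lt_def enorm_ge0 andbT -sqrf_eq0 sqr_enorm dotvv_eq0.
  apply/andP; split.
    rewrite ler_pdivlMr ?mulr_gt0//; move: h1; rewrite ehh /hh /xh dotvZl dotvZr.
    move=> h1; rewrite -(@ler_pM2r _ ((enorm x)^-1 ^+ 2)) ?exprn_gt0 ?invr_gt0//.
    have -> : 6 / 10 * (enorm x * enorm h) * (enorm x)^-1 ^+ 2 = 6 / 10 * (enorm h / enorm x).
      by field.
    by rewrite [leRHS]mulrC expr2 -[leRHS]mulrA.
  rewrite ler_pdivrMr ?mulr_gt0// mul1r; apply: (le_trans (ler_norm _)).
  rewrite -ler_sqr ?nnegrE ?mulr_ge0 ?enorm_ge0// real_normK ?num_real// exprMn !sqr_enorm.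
  exact: dotv_cauchy.
have := grad_step_le m0 (ltW mu0) qub hgap; set L := dotv _ _ => hL; apply: (le_trans hL).
apply: (@le_trans _ _ ((1 - mu / 50) * dotv h h)).
  rewrite ler_wpM2r ?dotvv_ge0//.
  have : mu * mu <= mu * (1 / 60) ^+ 2 by rewrite ler_pM2l// ltW.
  by lra.
apply: ler_wpM2l; last exact: dist_sqr_ge.
by case/andP: mu50 => _ mu50; rewrite subr_ge0 ltW.
Qed.
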